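(* Let $0<\delta\le1$, $d\ge1$, and let $\Delta=\Delta_1\times\cdots\times\Delta_d\subseteq\mathbb{Z}^n$, where $\mathbb{Z}^n=\mathbb{Z}^{2n_1+3}\times\cdots\times\mathbb{Z}^{2n_d+3}$ and each $\Delta_i\subseteq\mathbb{Z}^{2n_i+3}$ is a non-degenerate simplex of $n_i$ points. (i) If $S\subseteq\mathbb{Z}^n$ has upper Banach density at least $\delta$, then there exist integers $q_0=q_0(\delta,\Delta)$ and $\lambda_0=\lambda_0(S,\Delta)$ such that $S$ contains an isometric copy of $q_0\lambda\Delta$ for all $\lambda\in\sqrt{\mathbb{N}}$ with $\lambda\ge\lambda_0$. (ii) There exists a constant $N(\delta,\Delta)$ such that if $N\ge N(\delta,\Delta)$, then any $S\subseteq\{1,\dots,N\}^n$ with $|S|\ge\delta N^n$ contains an isometric copy of $\lambda\Delta$ for some $\lambda\in\sqrt{\mathbb{N}}$ with $1\le\lambda\le N$. Moreover, each of the isometric copies in (i) and (ii) can be realized in the special form $\Delta_1'\times\cdots\times\Delta_d'$ with each $\Delta_i'\subseteq\mathbb{Z}^{2n_i+3}$ an isometric copy of $q_0\lambda\Delta_i$ (in (i)) and of $\lambda\Delta_i$ (in (ii)), respectively.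
   Context: A non-degenerate simplex of $m$ points is a set of $m$ affinely independent points. $\sqrt{\mathbb{N}}:=\{\lambda:\lambda>0,\ \lambda^2\in\mathbb{Z}\}$. The upper Banach density of $S\subseteq\mathbb{Z}^n$ is $\delta^*(S)=\lim_{N\to\infty}\sup_{t\in\mathbb{R}^n}|S\cap(t+Q(N))|/|Q(N)|$ with $|\cdot|$ counting measure and $Q(N)=[-N/2,N/2]^n\cap\mathbb{Z}^n$. A finite configuration $\Delta'$ is an isometric copy of $\lambda\Delta$ if there is a bijection $\phi:\Delta\to\Delta'$ with $|\phi(v)-\phi(w)|=\lambda|v-w|$ for all $v,w\in\Delta$. *)

(* Defs.v *)
From mathcomp Require Import all_boot all_order all_algebra finmap.
From mathcomp Require Import all_classical all_reals all_analysis.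

Set Implicit Arguments.
Unset Strict Implicit.
Unset Printing Implicit Defensive.

Import Order.TTheory GRing.Theory Num.Theory.
Import numFieldNormedType.Exports.

Local Open Scope classical_set_scope.
Local Open Scope ring_scope.

Definition intvec (R : realType) m (v : 'rV[int]_m) : 'rV[R]_m :=
  map_mx (fun z : int => z%:~R) v.

(* Not the library norm `|v| on row vectors, which is the sup norm. *)
Definition euclid (R : realType) m (v : 'rV[R]_m) : R :=
  Num.sqrt (\sum_j (v ord0 j) ^+ 2).

Definition card_set (T : choiceType) (A : set T) : nat := #|` fset_set A|%fset.

Definition sqrtN (R : realType) : set R :=
  [set lam | 0 < lam /\ exists k : int, lam ^+ 2 = k%:~R].

Definition affinely_independent (R : realType) k m (p : 'I_k -> 'rV[R]_m) :=
  forall c : 'I_k -> R,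
    \sum_i c i = 0 -> \sum_i c i *: p i = 0 -> forall i, c i = 0.

(* Affine independence makes p injective, so A has exactly k points. *)
Definition nondegenerate_simplex (R : realType) k m (A : set 'rV[int]_m) :=
  exists p : 'I_k -> 'rV[int]_m,
    A = range p /\ affinely_independent (fun i => intvec R (p i)).

Definition isometric_copy (R : realType) m (lam : R) (A A' : set 'rV[int]_m) :=
  exists phi : 'rV[int]_m -> 'rV[int]_m,
    set_bij A A' phi /\
    forall v w, A v -> A w ->
      euclid (intvec R (phi v) - intvec R (phi w)) =
      lam * euclid (intvec R v - intvec R w).

(* Q(N): the integer points of [-N/2, N/2]^m. *)
Definition cube (R : realType) m (N : nat) : set 'rV[int]_m :=
  [set q | forall j, - (N%:R / 2) <= (q ord0 j)%:~R :> R /\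
                     (q ord0 j)%:~R <= N%:R / 2 :> R].

(* S meets t + Q(N) inside R^m: the shift t need not be integral. *)
Definition in_translate (R : realType) m (S : set 'rV[int]_m) (N : nat)
    (t : 'rV[R]_m) : set 'rV[int]_m :=
  [set x | S x /\ exists2 q, cube R N q & intvec R x = t + intvec R q].

Definition upper_Banach_density (R : realType) m (S : set 'rV[int]_m) : R :=
  lim (sup (range (fun t : 'rV[R]_m =>
         (card_set (in_translate S N t))%:R /
         (card_set (@cube R m N))%:R : R)) @[N --> \oo]).

(* A_1 x ... x A_d, with Z^(m_1) x ... x Z^(m_d) identified with
   Z^(m_1 + ... + m_d) by concatenating row vectors. *)
Definition block_prod d (m_ : 'I_d -> nat)
    (A : forall i, set 'rV[int]_(m_ i)) : set 'rV[int]_(\sum_i m_ i) :=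
  [set x | forall i, A i (submxrow x i)].

(* S contains an isometric copy of lam * (A_1 x ... x A_d) which is itself a
   product of isometric copies of the lam * A_i. *)
Definition contains_product_copy (R : realType) d (m_ : 'I_d -> nat)
    (S : set 'rV[int]_(\sum_i m_ i)) (lam : R)
    (A : forall i, set 'rV[int]_(m_ i)) :=
  exists A' : set 'rV[int]_(\sum_i m_ i),
    [/\ A' `<=` S,
        isometric_copy lam (block_prod A) A' &
        exists Ai' : forall i, set 'rV[int]_(m_ i),
          A' = block_prod Ai' /\ forall i, isometric_copy lam (A i) (Ai' i)].

(* Main.v *)
Require Import Defs.
From mathcomp Require Import all_boot all_order all_algebra finmap.
From mathcomp Require Import fingroup cyclic.
From mathcomp Require Import boolp ring lra zify.

(* Arithmetic input: if v_1, ..., v_r are independent in Z^(2r+5), there are q > 0 and a nonzero e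
   orthogonal to the v_j such that for every n >= 1 the Gram matrix q^2 n (v_i . v_j) is realised by
   integer vectors orthogonal to all v_j and to e.  Over Q this is Witt extension, from the fact
   that positive rationals are represented by x^2 + a y^2 + b z^2 + a b w^2 (a, b > 0); the
   denominators are bounded by splitting off short vectors of overlattices.  Adding t q v_j to the
   vectors for n = k - t^2 and applying finitely many rational reflections produces a family of
   copies of sqrt(k) v whose j-th vertex moves by t z under a change of one parameter, where z
   avoids every fixed hyperplane for most parameters and does not depend on k.

   Analysis: for g on a finite abelian group let B(q, l) g be its average over a cube of side l and
   step q.  By Cauchy-Schwarz and van der Corput, g - B(q D, l) g does not contribute to the average of g over
   these copies: repeated averaging along m independent vectors z annihilates it.  Hence the count
   of copies differs from the average of a power of B(q, L) g by at most a small constant plus a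
   multiple of the drop of the energy |B(q D, l) g|^2 - |B(q, M) g|^2.  The same holds for a product
   of simplices, one factor at a time, and since the all-box averages are bounded and monotone, a
   pigeonhole over the steps D^K, ..., D, 1 yields a stage where the drop is negligible. *)

Set Implicit Arguments.
Unset Strict Implicit.
Unset Printing Implicit Defensive.

Import Order.TTheory GRing.Theory Num.Theory.

Local Open Scope ring_scope.

(** The dimension [2 * r + 5] leaves room for the [r] vectors [v_j], for [r] orthogonal vectors with
    the scaled Gram matrix and for [e]; the four remaining dimensions make the required diagonal
    forms subforms of the standard one for every [n]. The obstacle is uniformity: the differences
    [z] and all denominators must not depend on [k], although the copies realise [k] exactly. Hence
    a copy is the sum of a part scaled by [k - t^2], which the parametrised reflections fix, and of
    [t q v_j], which they move; [k] enters through the fixed part alone. Reflections in vectors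
    [E_j + (a+1) e] keep the moves inside the span of the [E_j] and [e]; a last reflection, in a
    point of a curve with coordinate exponents [3^i], turns them out of any given hyperplane for
    most parameters. For several simplices the energy of one direction is measured in the presence
    of the others, so the pigeonhole runs on a sum over all choices, direction by direction, of the
    exponent 2 (energy) or [r + 1] (count). *)

(** * Reduced norms of quaternion algebras over the rationals *)

Definition nrd (a b c : rat) := exists x y z w : rat,
  c = x ^+ 2 - a * y ^+ 2 - b * z ^+ 2 + a * b * w ^+ 2.

(** With i^2 = a and j^2 = b the witnesses are the coordinates of a product of quaternions. Together
    with [nrdC12] and [nrdC23] this makes [nrd] a symmetric symbol on nonzero entries,
    multiplicative in each of them and blind to square factors. *)
Lemma nrdM a b c c' : nrd a b c -> nrd a b c' -> nrd a b (c * c').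
Proof.
move=> [x [y [z [w ->]]]] [x' [y' [z' [w' ->]]]].
exists (x * x' + a * y * y' + b * z * z' - a * b * w * w').
exists (x * y' + y * x' - b * z * w' + b * w * z').
exists (x * z' + z * x' + a * y * w' - a * w * y').
exists (x * w' + w * x' + y * z' - z * y').
ring.
Qed.

Lemma nrd_sqr a b s : nrd a b (s ^+ 2).
Proof. by exists s, 0, 0, 0; ring. Qed.

Lemma nrd1 a b : nrd a b 1.
Proof. by rewrite -(expr1n _ 2); apply: nrd_sqr. Qed.

Lemma nrd_cancel a b s c : s != 0 -> nrd a b (c * s ^+ 2) -> nrd a b c.
Proof.
move=> s0 H.
have -> : c = c * s ^+ 2 * s^-1 ^+ 2 by field.
exact: nrdM H (nrd_sqr _ _ _).
Qed.

Lemma nrdMr a b c s : s != 0 -> nrd a b s -> nrd a b (c * s) -> nrd a b c.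
Proof.
move=> s0 Hs H; apply: (nrd_cancel s0).
by rewrite expr2 mulrA; apply: nrdM.
Qed.

Lemma nrdC12 a b c : nrd a b c -> nrd b a c.
Proof. by move=> [x [y [z [w ->]]]]; exists x, z, y, w; ring. Qed.

(** With N(u,v) = u^2 - a v^2 the hypothesis reads c = N(x,y) - b N(z,w); dividing by N(z,w)
    expresses b, as N is multiplicative. If N(z,w) = 0, either z = w = 0 and c is itself a value of
    N, or a is a square and N represents everything. *)
Lemma nrdC23 a b c : a != 0 -> c != 0 -> nrd a b c -> nrd a c b.
Proof.
move=> a0 c0 [x [y [z [w E]]]]; rewrite E in c0 *.
have [N0|N0] := eqVneq (z ^+ 2 - a * w ^+ 2) 0; last first.
  exists ((x * z - a * y * w) / (z ^+ 2 - a * w ^+ 2)).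
  exists ((y * z - x * w) / (z ^+ 2 - a * w ^+ 2)).
  exists (z / (z ^+ 2 - a * w ^+ 2)), (w / (z ^+ 2 - a * w ^+ 2)).
  by field.
have [w0|w0] := eqVneq w 0.
  have z0 : z = 0.
    by move: N0; rewrite w0 expr0n /= mulr0 subr0 => /eqP; rewrite expf_eq0 => /eqP.
  rewrite w0 z0 in c0 *.
  set M := x ^+ 2 - a * y ^+ 2.
  have M0 : M != 0 by move: c0; rewrite expr0n /= !mulr0 subr0 addr0.
  exists ((b + 1) / 2), 0, ((b - 1) / 2 * x / M), ((b - 1) / 2 * y / M).
  by rewrite /M in M0 *; field.
have aE : a = (z / w) ^+ 2.
  have : z ^+ 2 = a * w ^+ 2 by lra.
  by rewrite exprMn exprVn => ->; field.
have e0 : z / w != 0 by apply: contraNneq a0 => e0; rewrite aE e0 expr0n.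
rewrite aE; exists ((b + 1) / 2), ((b - 1) / (2 * (z / w))), 0, 0.
have z0 : z != 0 by apply: contraNneq e0 => ->; rewrite mul0r.
by field; rewrite ?w0 ?z0.
Qed.

Lemma nrdMm a b b' c : a != 0 -> b != 0 -> b' != 0 -> c != 0 ->
  nrd a b c -> nrd a b' c -> nrd a (b * b') c.
Proof.
move=> a0 b0 b'0 c0 /(nrdC23 a0 c0) H /(nrdC23 a0 c0) H'.
by apply: nrdC23 => //; [rewrite mulf_neq0 | apply: nrdM].
Qed.

Lemma nrdMl a a' b c : a != 0 -> a' != 0 -> b != 0 -> c != 0 ->
  nrd a b c -> nrd a' b c -> nrd (a * a') b c.
Proof. by move=> *; apply: nrdC12; apply: nrdMm => //; apply: nrdC12. Qed.

Lemma neg1_neq0 : (-1 : rat) != 0. Proof. by []. Qed.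

Lemma nrd_opp a b : nrd a b (- b).
Proof. by exists 0, 0, 1, 0; ring. Qed.

(** The Steinberg relation b'/b + lz/b = 1 makes b'/b, hence b b', a norm for (a, lz/b). The
    hypothesis on [z * b] then strips z/b from the second entry, up to squares. *)
Lemma residue_shift (a : rat) (l b b' z : nat) : a != 0 ->
  (0 < l)%N -> (0 < b)%N -> (0 < b')%N -> (0 < z)%N -> b = (b' + l * z)%N ->
  nrd a (b * b')%:R (z * b)%:R -> nrd a l%:R (b * b')%:R.
Proof.
move=> a0 l0 b0 b'0 z0 E H.
have [lr br b'r zr] : [/\ l%:R != 0 :> rat, b%:R != 0 :> rat, b'%:R != 0 :> rat
  & z%:R != 0 :> rat] by rewrite !pnatr_eq0 -!lt0n.
have bb : (b * b')%:R != 0 :> rat by rewrite natrM mulf_neq0.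
have St : nrd a (l%:R * z%:R / b%:R) (b'%:R / b%:R).
  exists 1, 0, 1, 0; rewrite E natrD natrM in br *; by field.
have : nrd a (l%:R * z%:R / b%:R) (b * b')%:R.
  apply: (nrd_cancel (s := b%:R^-1)); first by rewrite invr_eq0.
  by rewrite natrM [X in nrd _ _ X](_ : _ = b'%:R / b%:R) //; field.
move/(nrdC23 a0 bb) => H1.
apply: nrdC23 => //.
have zb : (z * b)%:R != 0 :> rat by rewrite natrM mulf_neq0.
apply: (nrdMr zb) => //.
rewrite (_ : _ * _ = l%:R * z%:R / b%:R * b%:R ^+ 2); last by rewrite natrM; field.
by apply: nrdM H1 _; apply: nrd_sqr.
Qed.

(** Primes enter one at a time: symbols whose entries have all prime factors below [l] are settled
    before [l] appears. *)
Definition smooth (l n : nat) := (0 < n)%N && all (fun p => p < l)%N (primes n).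

Lemma smooth_small l n : (0 < n < l)%N -> smooth l n.
Proof.
case/andP=> n0 nl; rewrite /smooth n0; apply/allP => p.
by rewrite mem_primes => /and3P[_ _ /(dvdn_leq n0)] /leq_ltn_trans; apply.
Qed.

Lemma smoothM l a b : smooth l a -> smooth l b -> smooth l (a * b).
Proof.
case/andP=> a0 Ha /andP[b0 Hb]; rewrite /smooth muln_gt0 a0 b0; apply/allP => p.
by rewrite primesM // => /orP[/(allP Ha)|/(allP Hb)].
Qed.

Lemma smooth_ind l (P : nat -> Prop) : P 1%N -> (forall p, prime p -> (p < l)%N -> P p) ->
  (forall a b, (0 < a)%N -> (0 < b)%N -> P a -> P b -> P (a * b)%N) -> forall n, smooth l n -> P n.
Proof.
move=> P1 Pp PM; elim/ltn_ind => n IH /andP[n0 Hn].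
have [n1|n1] := leqP n 1; first by have -> : n = 1%N by lia.
have [p Hp /dvdnP[m nE]] : exists2 p, prime p & (p %| n)%N.
  by exists (pdiv n); [apply: pdiv_prime | apply: pdiv_dvd].
have m0 : (0 < m)%N by case: m nE => // nE; move: n0; rewrite nE.
have p1 := prime_gt1 Hp.
have prE q : (q \in primes n) = (q \in primes m) || (q == p).
  by rewrite nE primesM ?(prime_gt0 Hp) // (primes_prime Hp) inE.
rewrite nE; apply: PM => //; first exact: prime_gt0.
  apply: IH; first by rewrite nE; nia.
  by rewrite /smooth m0; apply/allP => q Hq; apply: (allP Hn); rewrite prE Hq.
by apply: Pp => //; apply: (allP Hn); rewrite prE eqxx orbT.
Qed.

(** The unit group is cyclic: a non-square is an odd power of a generator, and the product of two
    odd powers is an even one. *)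
Lemma nonsquare_cases (F : finFieldType) (w0 w : F) :
  (forall y, y * y != w0) -> w != 0 -> exists y, w = y * y \/ w = w0 * (y * y).
Proof.
move=> Hw0 wn0.
have w0n0 : w0 != 0 by have := Hw0 0; rewrite mulr0 eq_sym.
have /cyclicP[g Hg] := field_unit_group_cyclic [set: {unit F}]%G.
have gen (x : F) : x != 0 -> exists i, x = val g ^+ i.
  move=> x0; have xu : x \is a GRing.unit by rewrite unitfE.
  have : FinRing.Unit xu \in <[g]>%g by rewrite -Hg inE.
  by case/cycleP=> i /(congr1 val) /= ->; exists i; rewrite FinRing.val_unitX.
have [i Ei] := gen _ w0n0; have [j Ej] := gen _ wn0.
have ev k : ~~ odd k -> val g ^+ k = val g ^+ k./2 * val g ^+ k./2.
  by move=> kk; rewrite -exprD addnn -[in LHS](odd_double_half k) (negbTE kk).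
have oi : odd i by apply: contraT => /ev; rewrite -Ei => E; have := Hw0 (val g ^+ i./2); rewrite E eqxx.
have [oj|/ev Hj] := boolP (odd j); last by exists (val g ^+ j./2); left; rewrite {1}Ej.
have /ev : ~~ odd (i + j) by rewrite oddD oi oj.
rewrite exprD -Ei -Ej; set s := val g ^+ _ => E.
exists (s / w0); right; rewrite mulf_div -E; field; exact: w0n0.
Qed.

Lemma nonsquare_cases_nat l w0 w : prime l -> (0 < w < l)%N ->
  (forall y, y * y != w0 %[mod l])%N ->
  exists2 y, (0 < y < l)%N & (y * y = w %[mod l] \/ w0 * (y * y) = w %[mod l])%N.
Proof.
move=> lp /andP[w_gt0 wl] Hw0.
have modE (a b : nat) : (a == b %[mod l])%N = ((a%:R : 'F_l) == b%:R).
  apply/eqP/eqP => [E|/(congr1 val)]; first by rewrite -(Fp_nat_mod lp a) E Fp_nat_mod.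
  by rewrite /= !(val_Fp_nat lp).
have wn0 : (w%:R : 'F_l) != 0.
  by rewrite -[0]/(0%:R) -modE mod0n (modn_small wl) -lt0n.
have toN (y : 'F_l) : y != 0 -> exists2 k, (0 < k < l)%N & y = k%:R.
  move=> y0; exists (val y); last by rewrite natr_Zp.
  rewrite lt0n; apply/andP; split; last by have := ltn_ord y; rewrite [X in (_ < X)%N -> _](Fp_cast lp).
  by apply: contraNneq y0 => E; apply/eqP/val_inj.
have [|y Hy] := @nonsquare_cases _ (w0%:R : 'F_l) w%:R _ wn0.
  move=> y; have [->|/toN[k _ ->]] := eqVneq y 0; last by rewrite -natrM -modE Hw0.
  by rewrite mulr0; have := Hw0 0; rewrite modE.
have y0 : y != 0 by apply: contraNneq wn0 => y0; case: Hy => ->; rewrite y0 !mulr0.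
have [k k_lt Ek] := toN _ y0; exists k => //.
by case: Hy => Hy; [left|right]; apply/eqP; rewrite modE Hy Ek !natrM.
Qed.

Section Residues.
Variables (a : rat) (l : nat).
Hypotheses (a0 : a != 0) (lp : prime l).
Hypothesis IH : forall x y, smooth l x -> smooth l y -> nrd a x%:R y%:R.

(** In the division x y = z l + w the quotient z is below l, so z, x y and w are smooth and [IH]
    feeds [residue_shift]. This settles the symbol of x y w, from which the known factor x y
    cancels. *)
Lemma residue_mul x y w : (0 < x < l)%N -> (0 < y < l)%N -> (0 < w < l)%N ->
  (x * y = w %[mod l])%N -> nrd a l%:R (x * y)%:R -> nrd a l%:R w%:R.
Proof.
move=> Hx Hy Hw E H.
have wE : w = (x * y %% l)%N by rewrite E modn_small //; lia.
have := divn_eq (x * y) l; rewrite -wE => D.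
have [z0|z0] := posnP (x * y %/ l)%N; first by move: D H; rewrite z0 mul0n add0n => ->.
have zl : (x * y %/ l < l)%N by rewrite ltn_divLR; nia.
have sxy : smooth l (x * y) by apply: smoothM; apply: smooth_small.
have sw := smooth_small Hw.
have := @residue_shift a l (x * y) w (x * y %/ l) a0.
case/(_ (prime_gt0 lp)) => //; try lia.
- by apply: IH; apply: smoothM => //; apply: smooth_small; lia.
- move=> xx [yy [zz [ww Eq]]].
  apply: (@nrdMr _ _ _ (x * y)%:R) => //; first by rewrite pnatr_eq0; lia.
  by rewrite mulrC -natrM; exists xx, yy, zz, ww.
Qed.

(** Every prime below [l] is congruent to y^2 or to w0 y^2 modulo [l], and [residue_mul] transports
    the symbol along the congruence. *)
Lemma residue_all w0 : (0 < w0 < l)%N -> (forall y, y * y != w0 %[mod l])%N ->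
  nrd a l%:R w0%:R -> forall x, smooth l x -> nrd a l%:R x%:R.
Proof.
move=> Hw0 ns H0.
have sq x y : (0 < x < l)%N -> (0 < y < l)%N -> (y * y = x %[mod l])%N -> nrd a l%:R x%:R.
  by move=> Hx Hy E; apply: (residue_mul Hy Hy Hx E); rewrite natrM -expr2; apply: nrd_sqr.
apply: smooth_ind; first exact: nrd1.
  move=> w wp wl; have Hw : (0 < w < l)%N by rewrite prime_gt0.
  have [y Hy [E|E]] := nonsquare_cases_nat lp Hw ns; first exact: sq E.
  have y2 : (0 < y * y %% l < l)%N.
    rewrite ltn_mod (prime_gt0 lp) andbT lt0n; apply/negP => /eqP; move/eqP.
    by rewrite -/(dvdn _ _) Euclid_dvdM // orbb gtnNdvd //; lia.
  apply: (residue_mul Hw0 y2 Hw).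
    by rewrite modnMmr.
  by rewrite natrM; apply: nrdM => //; apply: (sq _ y) => //; rewrite modn_mod.
by move=> x y x0 y0 Hx Hy; rewrite natrM; apply: nrdM.
Qed.

Lemma residue_square x y : (0 < x < l)%N -> (y * y = x %[mod l])%N -> nrd a l%:R x%:R.
Proof.
move=> Hx E.
have E' : ((y %% l) * (y %% l) = x %[mod l])%N by rewrite modnMml modnMmr.
have Hy : (0 < y %% l < l)%N.
  rewrite ltn_mod (prime_gt0 lp) andbT lt0n; apply/negP => /eqP y0.
  by move: E'; rewrite y0 muln0 mod0n modn_small; lia.
by apply: (residue_mul Hy Hy Hx E'); rewrite natrM -expr2; apply: nrd_sqr.
Qed.

End Residues.

Section Stages.
Local Notation N x := (x%:R : rat).

Lemma natr_neq0 n : (0 < n)%N -> N n != 0. Proof. by rewrite pnatr_eq0 -lt0n. Qed.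

Lemma mulN1r_opp (x : rat) : -1 * - x = x. Proof. by rewrite mulN1r opprK. Qed.

Lemma smooth_gt0 l n : smooth l n -> (0 < n)%N. Proof. by case/andP. Qed.

Lemma smooth0F l : smooth 0 l -> l = 1%N.
Proof. by move: l; apply: smooth_ind => // a b _ _ -> ->. Qed.

Lemma smoothS l n : ~~ prime l -> smooth l.+1 n -> smooth l n.
Proof.
move=> lnp /andP[n0 /allP Hn]; rewrite /smooth n0; apply/allP => p Hp.
have := Hn p Hp; rewrite ltnS leq_eqVlt => /orP[/eqP E|//].
by move: Hp lnp; rewrite mem_primes E => /andP[->].
Qed.

Lemma smooth_prime l p : prime p -> (p < l.+1)%N -> smooth l p \/ p = l.
Proof.
move=> pp; rewrite ltnS leq_eqVlt => /orP[/eqP|] H; [by right|left].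
by rewrite /smooth prime_gt0 // primes_prime //= H.
Qed.

(** The bound on [x] keeps sums of two squares so small that the cofactor in the descent stays below
    [l]. *)
Lemma half_residue l y : (0 < l)%N -> exists2 x, (x.*2 <= l)%N & (x * x = y * y %[mod l])%N.
Proof.
move=> l0; have : (y %% l < l)%N by rewrite ltn_mod.
have E : ((y %% l) * (y %% l) = y * y %[mod l])%N by rewrite modnMml modnMmr.
move: (y %% l)%N E => z E zl.
have [zh|zh] := leqP z.*2 l; first by exists z.
exists (l - z)%N; first by lia.
rewrite -E; have -> : (z * z = (z.*2 - l) * l + (l - z) * (l - z))%N.
  have [k lE] : exists k, l = (z + k)%N by exists (l - z)%N; lia.
  have -> : (l - z = k)%N by lia.
  have -> : (z.*2 - l = z - k)%N by lia.
  have [j zE] : exists j, z = (k + j)%N by exists (z - k)%N; lia.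
  have -> : (z - k = j)%N by lia.
  by rewrite lE zE; nia.
by rewrite modnMDl.
Qed.

(** Taking for [w] the least positive non-square makes [w.-1] a square; [two_squares_m1] uses both
    facts. *)
Lemma nonsquare_or l : prime l -> (2 < l)%N ->
  exists2 w, (0 < w < l)%N & (forall y, y * y != w %[mod l])%N /\ exists y, (y * y = w.-1 %[mod l])%N.
Proof.
move=> lp l2.
pose ns w := (0 < w)%N && [forall y : 'I_l, (y * y)%N != w %[mod l]].
have nsP w : (0 < w)%N -> ns w = false -> exists y, (y * y = w %[mod l])%N.
  move=> w0; rewrite /ns w0 /= => /forallPn[y]; rewrite negbK => /eqP Hy; by exists y.
have wex : exists w, ns w.
  case: (pickP (fun w : 'I_l => ns w)) => [w Hw|none]; first by exists w.
  (* the squaring map on 'I_l would be onto, hence injective *)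
  pose sq (y : 'I_l) : 'I_l := Ordinal (ltn_pmod (y * y) (ltnW (ltnW l2))).
  have surj : forall w : 'I_l, exists y, sq y = w.
    move=> w; have [w0|w0] := posnP w.
      exists (Ordinal (ltnW (ltnW l2))); apply: val_inj; rewrite /= mod0n; by rewrite w0.
    have [y Hy] := nsP w w0 (none w).
    exists (Ordinal (ltn_pmod y (ltnW (ltnW l2)))); apply: val_inj => /=.
    by rewrite modnMml modnMmr Hy modn_small.
  have inj : injective sq.
    have: codom sq =i predT.
      by move=> w; have [y <-] := surj w; rewrite codom_f inE.
    by move=> /eq_card H; apply/injectiveP/card_uniqP; rewrite H size_map -cardE.
  have : sq (Ordinal (ltnW l2)) = sq (Ordinal (ltac:(by rewrite prednK ?(prime_gt0 lp)) : (l.-1 < l)%N)).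
    apply: val_inj => /=; rewrite muln1.
    have -> : (l.-1 * l.-1 = (l - 2) * l + 1)%N.
      have [k ->] : exists k, l = k.+2 by exists (l - 2)%N; lia.
      rewrite /=; nia.
    by rewrite modnMDl.
  by move=> /inj /(congr1 val) /=; lia.
case: (ex_minnP wex) => w Hw wmin.
have /andP[w_gt0 /forallP Hn] := Hw.
have wl : (w < l)%N.
  rewrite ltnNge; apply/negP => lw.
  have Hm : (w %% l < w)%N by apply: leq_trans lw; rewrite ltn_mod; lia.
  have : (w <= w %% l)%N.
    apply: wmin; rewrite /ns; apply/andP; split.
      rewrite lt0n; apply/negP => /eqP m0; have := Hn (Ordinal (ltnW (ltnW l2))).
      by rewrite /= mod0n m0 eqxx.
    by apply/forallP => y; rewrite modn_mod.
  by rewrite leqNgt Hm.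
exists w; first by rewrite w_gt0.
split.
  move=> y; have := Hn (Ordinal (ltn_pmod y (ltnW (ltnW l2)))).
  by rewrite /= modnMml modnMmr.
have [w1|w1] := posnP w.-1; first by exists 0%N; rewrite w1.
apply: nsP => //; apply: negbTE; apply/negP => /wmin; lia.
Qed.

(** Either -w is a square y^2, and then y^2 + (w - 1) + 1 vanishes modulo [l], or -w = w k^2, and
    then k^2 = -1. *)
Lemma two_squares_m1 l : prime l ->
  exists x y, [/\ (x.*2 <= l)%N, (y.*2 <= l)%N & (l %| x * x + y * y + 1)%N].
Proof.
move=> lp; have [l2|l2] := leqP l 2.
  have -> : l = 2%N by have := prime_gt1 lp; lia.
  by exists 1%N, 0%N.
have [w Hw [ns [x0 Hx]]] := nonsquare_or lp l2.
have l0 : (0 < l)%N by lia.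
have [k k_lt [E|E]] := nonsquare_cases_nat lp (w := l - w) ltac:(lia) ns.
  have [x xl Ex] := half_residue x0 l0; have [y yl Ey] := half_residue k l0.
  exists x, y; split=> //; rewrite /dvdn.
  have -> : (x * x + y * y + 1 = (y * y + (x * x + 1)))%N by lia.
  have E1 : (x * x + 1 = w %[mod l])%N.
    rewrite -modnDml Ex Hx modnDml; congr (_ %% _)%N; lia.
  by rewrite -modnDmr E1 modnDmr -modnDml Ey modnDml -modnDml E modnDml subnK ?modnn //; lia.
have [h hl Eh] := half_residue k l0.
exists h, 0%N; split=> //; rewrite muln0 addn0 /dvdn -modnDml Eh modnDml.
suff : (l %| w * (k * k + 1))%N.
  by rewrite Euclid_dvdM // => /orP[|/eqP //]; rewrite gtnNdvd //; lia.
by rewrite /dvdn mulnDr muln1 -modnDml E modnDml subnK ?modnn //; lia.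
Qed.

(** The four-square theorem by descent: a prime divides some x^2 + y^2 + 1 with a smaller cofactor,
    which is already a norm. *)
Lemma nrd_m1_m1 n : (0 < n)%N -> nrd (-1) (-1) (N n).
Proof.
move=> n0.
suff H l : forall n, smooth l n -> nrd (-1) (-1) (N n).
  by apply: (H n.+1); apply: smooth_small; rewrite n0 /=.
elim: l => [|l IH]; first by move=> m /smooth0F ->; apply: nrd1.
apply: smooth_ind; first exact: nrd1; last first.
  by move=> a b a0 b0 Ha Hb; rewrite natrM; apply: nrdM.
move=> p pp; rewrite ltnS leq_eqVlt => /orP[/eqP E|pl]; last first.
  by apply: IH; rewrite /smooth prime_gt0 // primes_prime //= pl.
have [x [y [xl yl /dvdnP[m Em]]]] := two_squares_m1 pp.
have p1 := prime_gt1 pp.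
have m0 : (0 < m)%N by case: m Em => //; lia.
have mp : (m < p)%N by nia.
apply: (@nrdMr _ _ _ (N m)); first exact: natr_neq0.
  by apply: IH; apply: smooth_small; lia.
rewrite -natrM mulnC -Em !natrD !natrM.
by exists (N x), (N y), 1, 0; ring.
Qed.

Lemma nrd_m1 n k : (0 < n)%N -> (0 < k)%N -> nrd (-1) (N n) (N k).
Proof.
move=> n0 k0.
suff H l : forall n k, smooth l n -> smooth l k -> nrd (-1) (N n) (N k).
  by apply: (H (n + k).+1); apply: smooth_small; lia.
elim: l => [|l IH]; first by move=> x y /smooth0F -> /smooth0F ->; apply: nrd1.
have [lp|lnp] := boolP (prime l); last first.
  by move=> x y /(smoothS lnp) Hx /(smoothS lnp) Hy; apply: IH.
have l1 := prime_gt1 lp; have ln0 := natr_neq0 (prime_gt0 lp).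
have L_m1 : nrd (-1) (N l) (-1) by apply: nrdC23 => //; apply: nrd_m1_m1; apply: prime_gt0.
have Hl x : smooth l x -> nrd (-1) (N l) (N x).
  (* If -1 is a square modulo [l], some w^2 + 1 = m l with m < l is a norm whatever the second
     entry. Otherwise l - 1 is a non-square and can serve as [w0], because 1 - l and -1 are norms
     for (-1, l). *)
  have [/existsP[w /eqP Hw]|/existsPn ns] := boolP [exists w : 'I_l, (w * w == l.-1 %[mod l])%N].
    have /dvdnP[m Em] : (l %| w * w + 1)%N.
      by rewrite /dvdn -modnDml Hw modnDml addn1 prednK ?modnn // prime_gt0.
    have wl := ltn_ord w.
    have m0 : (0 < m)%N by case: m Em => //; lia.
    have ml : (m < l)%N by nia.
    move=> Hx; have x0 := smooth_gt0 Hx; have xn0 := natr_neq0 x0.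
    apply: nrdC23 => //; apply: (@nrdMr _ _ _ (N m)); first exact: natr_neq0.
      by apply: IH => //; apply: smooth_small; lia.
    by rewrite -natrM mulnC -Em natrD natrM; exists (N w), 1, 0, 0; ring.
  have ns' y : (y * y != l.-1 %[mod l])%N.
    have := ns (Ordinal (ltn_pmod y (prime_gt0 lp))).
    by rewrite /= modnMml modnMmr.
  have l1' : (1 < l)%N by [].
  have [l2|l2] := leqP l 2.
    by move: (ns' 1%N); have -> : l = 2%N by lia.
  apply: (@residue_all _ _ neg1_neq0 lp _ l.-1) => //; first by lia.
  rewrite -[X in nrd _ _ X](mulN1r_opp); apply: nrdM => //.
  by exists 1, 0, 1, 0; rewrite -subn1 natrB ?prime_gt0 //; ring.
have LL : nrd (-1) (N l) (N l).
  by rewrite -[X in nrd _ _ X](mulN1r_opp); apply: nrdM => //; apply: nrd_opp.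
move=> x y Hx; move: y; apply: smooth_ind; first exact: nrd1; last first.
  by move=> a b _ _ Ha Hb; rewrite natrM; apply: nrdM.
move=> q qp /(smooth_prime qp) Hq; have q0 := prime_gt0 qp.
move: x Hx; apply: smooth_ind; first by apply: nrdC23; rewrite ?natr_neq0 //; exact: nrd1.
  move=> p pp /(smooth_prime pp) Hp; case: Hp Hq => [Hp|->] [Hq|->] => //.
  - exact: IH.
  - by have p0 := natr_neq0 (prime_gt0 pp); apply: nrdC23 => //; exact: Hl.
  - exact: Hl.
move=> a b a0 b0 Ha Hb; rewrite natrM; apply: nrdMm => //; exact: natr_neq0.
Qed.

(** Since -1 and -x are norms for (l, x), so is x, which settles repeated entries. For primes p, q <
    l, if p is a square modulo l then [residue_square] gives the symbol of q, l, p; if not, p is a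
    non-square with the known symbol of p, l, p, and [residue_all] applies. *)
Lemma nrd_pos_nat n k i : (0 < n)%N -> (0 < k)%N -> (0 < i)%N -> nrd (N n) (N k) (N i).
Proof.
move=> n0 k0 i0.
suff H l : forall n k i, smooth l n -> smooth l k -> smooth l i -> nrd (N n) (N k) (N i).
  by apply: (H (n + k + i).+1); apply: smooth_small; lia.
elim: l => [|l IH]; first by move=> x y z /smooth0F -> /smooth0F -> /smooth0F ->; apply: nrd1.
have [lp|lnp] := boolP (prime l); last first.
  by move=> x y z /(smoothS lnp) Hx /(smoothS lnp) Hy /(smoothS lnp) Hz; apply: IH.
have l1 := prime_gt1 lp; have ln0 := natr_neq0 (prime_gt0 lp).
have L_m1 x : (0 < x)%N -> nrd (N l) (N x) (-1).
  move=> x0; have xn0 := natr_neq0 x0; apply: nrdC23 => //.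
  by apply: nrdC12; exact: nrd_m1 (prime_gt0 lp) x0.
have nsq_diag x : (0 < x)%N -> nrd (N l) (N x) (N x).
  move=> x0; rewrite -[X in nrd _ _ X](mulN1r_opp); apply: nrdM; [exact: L_m1 | exact: nrd_opp].
have Hl a x : smooth l a -> smooth l x -> nrd (N a) (N l) (N x).
  have small p : prime p -> (p < l)%N -> smooth l p.
    by move=> pp pl; rewrite /smooth prime_gt0 // primes_prime //= pl.
  have main p q : prime p -> (p < l)%N -> prime q -> (q < l)%N -> nrd (N p) (N l) (N q).
    move=> pp pl qp ql; have p0 := natr_neq0 (prime_gt0 pp); have q0 := natr_neq0 (prime_gt0 qp).
    have IHa a' b c : smooth l a' -> smooth l b -> smooth l c -> nrd (N a') (N b) (N c) by exact: IH.
    have [/existsP[w /eqP Hw]|/existsPn ns] := boolP [exists w : 'I_l, (w * w == p %[mod l])%N].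
      apply: nrdC12; apply: nrdC23 => //; apply: nrdC12.
      apply: (@residue_square _ _ q0 lp _ _ _ _ Hw); first by move=> *; apply: IHa => //; apply: small.
      by rewrite prime_gt0.
    have ns' y : (y * y != p %[mod l])%N.
      have := ns (Ordinal (ltn_pmod y (prime_gt0 lp))).
      by rewrite /= modnMml modnMmr.
    apply: (@residue_all _ _ p0 lp _ p) => //; last exact: small.
    - by move=> *; apply: IHa => //; apply: small.
    - by rewrite prime_gt0.
    - by apply: nrdC12; apply: nsq_diag; apply: prime_gt0.
  move=> Ha; move: x; apply: smooth_ind; first exact: nrd1; last first.
    by move=> x y _ _ Hx Hy; rewrite natrM; apply: nrdM.
  move=> q qp ql; have q0 := natr_neq0 (prime_gt0 qp).
  move: a Ha; apply: smooth_ind.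
  - by apply: nrdC12; apply: nrdC23 => //; exact: nrd1.
  - by move=> p pp pl; apply: main.
  - move=> x y x0 y0 Hx Hy; rewrite natrM; apply: nrdMl => //; exact: natr_neq0.
have Hl2 a x : smooth l a -> smooth l.+1 x -> nrd (N a) (N l) (N x).
  move=> Ha; move: x; apply: smooth_ind; first exact: nrd1; last first.
    by move=> x y _ _ Hx Hy; rewrite natrM; apply: nrdM.
  move=> p pp /(smooth_prime pp) [Hp|->]; first exact: Hl.
  have a0 := smooth_gt0 Ha; have an0 := natr_neq0 a0.
  rewrite -[X in nrd _ _ X](mulN1r_opp); apply: nrdM; last exact: nrd_opp.
  by apply: nrdC12; apply: L_m1.
have Ll x y : smooth l x -> smooth l.+1 y -> nrd (N l) (N x) (N y).
  by move=> Hx Hy; apply: nrdC12; apply: Hl2.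
have Lll y : smooth l.+1 y -> nrd (N l) (N l) (N y).
  move: y; apply: smooth_ind; first exact: nrd1; last first.
    by move=> x y _ _ Hx Hy; rewrite natrM; apply: nrdM.
  move=> p pp /(smooth_prime pp) [Hp|->]; last exact: nsq_diag (prime_gt0 lp).
  have p0 := natr_neq0 (prime_gt0 pp).
  apply: nrdC23 => //; apply: Ll => //.
  by rewrite /smooth prime_gt0 // primes_prime //= ltnSn.
move=> x y z Hx Hy Hz; have z0 := smooth_gt0 Hz; have zn0 := natr_neq0 z0.
move: x Hx; apply: smooth_ind.
- have y0 := natr_neq0 (smooth_gt0 Hy); by apply: nrdC12; apply: nrdC23 => //; exact: nrd1.
- move=> p pp pl; have p0 := natr_neq0 (prime_gt0 pp).
  move: y Hy; apply: smooth_ind.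
  + by apply: nrdC23 => //; exact: nrd1.
  + move=> q qp ql; case: (smooth_prime pp pl) (smooth_prime qp ql) => [Hp|->] [Hq|->].
    * move: z Hz {z0 zn0}; apply: smooth_ind; first exact: nrd1.
      - move=> s sp sl; case: (smooth_prime sp sl) => [Hs|->]; first exact: IH.
        have q0 := natr_neq0 (prime_gt0 qp).
        by apply: nrdC23 => //; apply: Hl.
      - by move=> a b a0 b0 Ha Hb; rewrite natrM; apply: nrdM.
    * exact: Hl2.
    * exact: Ll.
    * exact: Lll.
  + move=> a b a0 b0 Ha Hb; rewrite natrM; apply: nrdMm => //; exact: natr_neq0.
- have yn0 := natr_neq0 (smooth_gt0 Hy).
  by move=> a b a0 b0 Ha Hb; rewrite natrM; apply: nrdMl => //; exact: natr_neq0.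
Qed.

Lemma pos_rat_nat (a : rat) : 0 < a -> exists2 n, (0 < n)%N & exists2 s, s != 0 & N n = a * s ^+ 2.
Proof.
move=> a0; have d0 := denq_neq0 a.
exists (`|numq a| * `|denq a|)%N.
  by rewrite muln_gt0 !absz_gt0 d0 numq_eq0 gt_eqF.
exists (denq a)%:~R; first by rewrite intr_eq0.
have E : (`|numq a|%N%:R : rat) = (numq a)%:~R.
  by rewrite natr_absz ger0_norm // numq_ge0 ltW.
have E' : (`|denq a|%N%:R : rat) = (denq a)%:~R.
  by rewrite natr_absz ger0_norm.
by rewrite natrM E E' numqE; ring.
Qed.

(** The signs of -a and -b are expanded by multiplicativity, leaving symbols whose entries are -1 or
    positive integers. *)
Theorem nrd_definite (a b c : rat) : 0 < a -> 0 < b -> 0 < c -> nrd (- a) (- b) c.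
Proof.
have m0 := neg1_neq0.
move=> /pos_rat_nat[n n0 [s s0 E]] /pos_rat_nat[k k0 [t t0 E']] /pos_rat_nat[i i0 [u u0 E'']].
have H : nrd (- N n) (- N k) (N i).
  rewrite -[- N n]mulN1r -[- N k]mulN1r.
  have [nn kk ii] : [/\ N n != 0, N k != 0 & N i != 0] by rewrite !natr_neq0.
  have mk : -1 * N k != 0 by rewrite mulf_neq0.
  apply: nrdMl => //; apply: nrdMm => //.
  - exact: nrd_m1_m1.
  - exact: nrd_m1.
  - by apply: nrdC12; apply: nrd_m1.
  - exact: nrd_pos_nat.
move: H; rewrite E E' E'' => - [x [y [z [w Hw]]]]; apply: (nrd_cancel u0).
by exists x, (s * y), (t * z), (s * t * w); rewrite Hw; ring.
Qed.
End Stages.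

(** * Orthogonal frames over the rationals *)

Definition dot (R : comNzRingType) m (x y : 'rV[R]_m) : R := \sum_j x ord0 j * y ord0 j.

Section Dot.
Variables (R : comNzRingType) (m : nat).
Implicit Types x y z : 'rV[R]_m.

Lemma dotC x y : dot x y = dot y x.
Proof. by apply: eq_bigr => j _; rewrite mulrC. Qed.

Lemma dotDl x y z : dot (x + y) z = dot x z + dot y z.
Proof. by rewrite -big_split; apply: eq_bigr => j _; rewrite mxE mulrDl. Qed.

Lemma dotZl a x z : dot (a *: x) z = a * dot x z.
Proof. by rewrite mulr_sumr; apply: eq_bigr => j _; rewrite mxE mulrA. Qed.

Lemma dotDr x y z : dot z (x + y) = dot z x + dot z y.
Proof. by rewrite dotC dotDl !(dotC z). Qed.

Lemma dotZr a x z : dot z (a *: x) = a * dot z x.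
Proof. by rewrite dotC dotZl dotC. Qed.

Lemma dotNl x z : dot (- x) z = - dot x z.
Proof. by rewrite -scaleN1r dotZl mulN1r. Qed.

Lemma dotNr x z : dot z (- x) = - dot z x.
Proof. by rewrite dotC dotNl dotC. Qed.

Lemma dot0l z : dot 0 z = 0.
Proof. by rewrite -(scale0r 0) dotZl mul0r. Qed.

Lemma dot0r z : dot z 0 = 0.
Proof. by rewrite dotC dot0l. Qed.

Lemma dot_suml (I : Type) (r : seq I) (P : pred I) (F : I -> 'rV[R]_m) z :
  dot (\sum_(i <- r | P i) F i) z = \sum_(i <- r | P i) dot (F i) z.
Proof. by elim/big_rec2: _ => [|i u v _ <-]; rewrite ?dot0l ?dotDl. Qed.

Lemma dot_sumr (I : Type) (r : seq I) (P : pred I) (F : I -> 'rV[R]_m) z :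
  dot z (\sum_(i <- r | P i) F i) = \sum_(i <- r | P i) dot z (F i).
Proof. by rewrite dotC dot_suml; apply: eq_bigr => i _; rewrite dotC. Qed.

Lemma dot_mx x y : (x *m y^T) = (dot x y)%:M.
Proof.
by apply/matrixP => i j; rewrite !ord1 !mxE eqxx mulr1n; apply: eq_bigr => k _; rewrite mxE.
Qed.

Lemma dot_orth (O : 'M[R]_m) x y : O *m O^T = 1%:M -> dot (x *m O) (y *m O) = dot x y.
Proof.
move=> HO; have : (x *m O) *m (y *m O)^T = x *m y^T.
  by rewrite trmx_mul mulmxA -(mulmxA x) HO mulmx1.
by rewrite !dot_mx => /matrixP/(_ 0 0); rewrite !mxE eqxx !mulr1n.
Qed.

End Dot.

Lemma dot_gt0 (R : realDomainType) m (x : 'rV[R]_m) : (0 < dot x x) = (x != 0).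
Proof.
have ge : 0 <= dot x x by apply: sumr_ge0 => j _; rewrite -expr2 sqr_ge0.
rewrite lt_def ge andbT; congr (~~ _); apply/eqP/eqP => [|->]; last by rewrite dot0l.
move=> /eqP; rewrite psumr_eq0 => [/allP H|j _]; last by rewrite -expr2 sqr_ge0.
apply/rowP => j; have := H j (mem_index_enum _).
by rewrite mulf_eq0 orbb => /eqP ->; rewrite mxE.
Qed.

Lemma dot_eq0 (R : realDomainType) m (x : 'rV[R]_m) : (dot x x == 0) = (x == 0).
Proof.
have [->|x0] := eqVneq x 0; first by rewrite dot0l eqxx.
by rewrite gt_eqF // dot_gt0.
Qed.

Definition refl (F : fieldType) m (w : 'rV[F]_m) : 'M[F]_m :=
  1%:M - (2 / dot w w) *: (w^T *m w).

Section Refl.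
Variables (F : fieldType) (m : nat).
Implicit Types x y w : 'rV[F]_m.

Lemma refl_act w x : x *m refl w = x - (2 * dot x w / dot w w) *: w.
Proof.
rewrite /refl mulmxBr mulmx1 -scalemxAr mulmxA dot_mx mul_scalar_mx scalerA.
by congr (_ - _ *: _); rewrite mulrAC.
Qed.

Lemma refl_sym w : (refl w)^T = refl w.
Proof. by rewrite /refl linearB /= trmx1 linearZ /= trmx_mul trmxK. Qed.

Lemma refl_orth w : dot w w != 0 -> refl w *m (refl w)^T = 1%:M.
Proof.
move=> w0; rewrite refl_sym {2}/refl mulmxBr mulmx1 -scalemxAr mulmxA.
have -> : refl w *m w^T = - w^T.
  rewrite -[LHS]trmxK trmx_mul trmxK refl_sym refl_act -mulrA mulfV // mulr1.
  by rewrite scaler_nat mulr2n opprD addrA subrr sub0r linearN.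
by rewrite mulNmx scalerN opprK /refl subrK.
Qed.

Lemma refl_perp w x : dot x w = 0 -> x *m refl w = x.
Proof. by move=> h; rewrite refl_act h mulr0 mul0r scale0r subr0. Qed.

Lemma refl_swap x y : dot x x = dot y y -> dot (x - y) (x - y) != 0 ->
  x *m refl (x - y) = y.
Proof.
move=> E; set w := x - y => w0; rewrite refl_act.
have -> : 2 * dot x w / dot w w = 1.
  rewrite -[RHS](mulfV w0); congr (_ / _).
  by rewrite /w !(dotDl, dotDr, dotNl, dotNr) -E (dotC y x); ring.
by rewrite scale1r /w opprB addrC subrK.
Qed.

End Refl.

(* Locked: equality on [rat] unfolds to a conjunction on numerators and denominators. *)
Definition perp m (x y : 'rV[rat]_m) : bool := locked (dot x y == 0).

Lemma perpP m (x y : 'rV[rat]_m) : reflect (dot x y = 0) (perp x y).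
Proof. by rewrite /perp -lock; exact: eqP. Qed.

Definition normed m (x : 'rV[rat]_m) a : bool := locked (dot x x == a).

Lemma normedP m (x : 'rV[rat]_m) a : reflect (dot x x = a) (normed x a).
Proof. by rewrite /normed -lock; exact: eqP. Qed.

Lemma perpC m (x y : 'rV[rat]_m) : perp x y = perp y x.
Proof. by rewrite /perp dotC. Qed.

Definition has_norms m (xs : seq 'rV[rat]_m) (s : seq rat) := map (fun x => dot x x) xs == s.
Arguments has_norms : simpl never.

Lemma has_norms_cons m (x : 'rV[rat]_m) xs a s :
  has_norms (x :: xs) (a :: s) = normed x a && has_norms xs s.
Proof. by rewrite /has_norms /normed -lock /= eqseq_cons. Qed.

Lemma has_norms_nil m : has_norms ([::] : seq 'rV[rat]_m) [::].
Proof. by []. Qed.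

Definition fr m (xs : seq 'rV[rat]_m) (s : seq rat) := pairwise (@perp m) xs && has_norms xs s.

Definition perps m (xs : seq 'rV[rat]_m) z := all (fun x => perp x z) xs.

(** The diagonal form with entries [t] is a subform of the one with entries [s]. Inclusion of the
    spans is expressed through orthogonality, in the shape in which [rep_cat] keeps the rest of a
    frame orthogonal. *)
Inductive rep (s t : seq rat) : Prop := Rep of (forall m (xs : seq 'rV[rat]_m), fr xs s ->
  exists2 ys, fr ys t & forall z, perps xs z -> perps ys z).

Lemma rep_refl s : rep s s. Proof. by split=> m xs H; exists xs. Qed.

Lemma rep_trans t s u : rep s t -> rep t u -> rep s u.
Proof.
case=> H1 [H2]; split=> m xs /H1[ys /H2[zs Hz Pz] Py]; exists zs => // z /Py; exact: Pz.
Qed.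

Lemma fr_cat m (xs ys : seq 'rV[rat]_m) s t : size xs = size s ->
  fr (xs ++ ys) (s ++ t) = [&& fr xs s, fr ys t & all (perps xs) ys].
Proof.
move=> sz; rewrite /fr pairwise_cat /has_norms map_cat eqseq_cat ?size_map //.
have -> : allrel (@perp m) xs ys = all (perps xs) ys.
  by rewrite allrelC.
by rewrite -!andbA; do ![bool_congr].
Qed.

Lemma fr_size m (xs : seq 'rV[rat]_m) s : fr xs s -> size xs = size s.
Proof. by case/andP=> _ /eqP <-; rewrite size_map. Qed.

Lemma rep_cat u s t : rep s t -> rep (u ++ s) (u ++ t).
Proof.
case=> H; split=> m xs Hx.
have sz : size (take (size u) xs) = size u.
  by rewrite size_takel // (fr_size Hx) size_cat leq_addr.
rewrite -(cat_take_drop (size u) xs) in Hx *.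
move: Hx; rewrite fr_cat // => /and3P[H1 H2 H3].
have [ys Hy Py] := H _ _ H2.
exists (take (size u) xs ++ ys).
  rewrite fr_cat // H1 Hy; apply/allP => y Hy'; apply/allP => x Hx'.
  have : perps ys x by apply: Py; apply/allP => z Hz; rewrite perpC; move/allP: (allP H3 z Hz); apply.
  by move/allP => /(_ y Hy'); rewrite perpC.
by move=> z; rewrite /perps !all_cat => /andP[-> /Py].
Qed.

Lemma rep_perm s t : perm_eq s t -> rep s t.
Proof.
move=> Hst; split=> m xs Hx; have /andP[Ho /eqP Hm] := Hx.
have /(perm_iotaP 0)[Is HIs Et] : perm_eq t s by rewrite perm_sym.
have sz := fr_size Hx.
have HIs' : perm_eq Is (iota 0 (size xs)) by rewrite sz.
pose ys := [seq nth 0 xs i | i <- Is].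
have pxy : perm_eq xs ys.
  rewrite perm_sym /ys; apply: (perm_trans (perm_map _ HIs')).
  by rewrite -[X in map _ (iota 0 (size X))](mkseq_nth 0 xs) size_mkseq -/(mkseq _ _) mkseq_nth.
exists ys; last by move=> z; rewrite /perps (perm_all _ pxy).
apply/andP; split.
  have oth i j : (i < size xs)%N -> (j < size xs)%N -> i != j -> perp (nth 0 xs i) (nth 0 xs j).
    move=> si sj; rewrite neq_ltn => /orP[] ij.
      by move/(pairwiseP 0): Ho; apply.
    by rewrite perpC; move/(pairwiseP 0): Ho; apply.
  have uI : uniq Is by rewrite (perm_uniq HIs') iota_uniq.
  have lI i : (i < size Is)%N -> (nth 0%N Is i < size xs)%N.
    by move=> /(mem_nth 0%N); rewrite (perm_mem HIs') mem_iota.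
  apply/(pairwiseP 0) => i j; rewrite !inE /ys size_map => si sj ij.
  rewrite !(nth_map 0%N) //; apply: oth; rewrite ?lI //.
  by rewrite nth_uniq // ltn_eqF.
apply/eqP; rewrite Et /ys -map_comp; apply/eq_in_map => i.
rewrite (perm_mem HIs') mem_iota add0n => /= ilt.
by rewrite -Hm (nth_map 0).
Qed.

Ltac count_lia := repeat match goal with
  | |- context [nat_of_bool ?b] => let v := fresh "v" in set v := (nat_of_bool b); clearbody v end; lia.

Lemma rep_drop s u : rep (s ++ u) s.
Proof.
split=> m xs Hx; have sz : size (take (size s) xs) = size s.
  by rewrite size_takel // (fr_size Hx) size_cat leq_addr.
move: Hx; rewrite -(cat_take_drop (size s) xs) fr_cat // => /and3P[H1 _ _].
by exists (take (size s) xs) => // z; rewrite /perps all_cat => /andP[].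
Qed.

Lemma rep_sub s t u : perm_eq s (t ++ u) -> rep s t.
Proof. by move=> /rep_perm H; apply: rep_trans H _; apply: rep_drop. Qed.

Lemma rep_catr s t u : rep s t -> rep (s ++ u) (t ++ u).
Proof.
move=> H; apply: (rep_trans (t := u ++ s)); first by apply: rep_perm; rewrite perm_catC.
by apply: (rep_trans (rep_cat u H)); apply: rep_perm; rewrite perm_catC.
Qed.

Lemma rep_scale a k : rep [:: a] [:: a * k ^+ 2].
Proof.
split=> m xs H; have sz := fr_size H; move: sz H; case: xs => [|x [|? ?]] //= _.
rewrite /fr has_norms_cons => /and3P[_ /normedP xa _].
exists [:: k *: x]; last first.
  by move=> z; rewrite /perps /= !andbT => /perpP h; apply/perpP; rewrite dotZl h mulr0.
by rewrite /fr /= has_norms_cons has_norms_nil andbT; apply/normedP; rewrite dotZl dotZr xa; ring.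
Qed.

(** With i^2 = -a and j^2 = -b, multiplication by x + yi + zj + wk is a similarity of factor [c];
    the new frame is the image of the old one. *)
Lemma rep_quat a b x y z w (c := x ^+ 2 + a * y ^+ 2 + b * z ^+ 2 + a * b * w ^+ 2) :
  rep [:: 1; a; b; a * b] [:: c; c * a; c * b; c * (a * b)].
Proof.
split=> m xs H; have sz := fr_size H; move: sz H; case: xs => [|e0 [|e1 [|e2 [|e3 [|? ?]]]]] //= _.
rewrite /fr /= !has_norms_cons !andbT -!andbA => /and5P[/perpP d01 /perpP d02 /perpP d03 /perpP d12].
move=> /and5P[/perpP d13 /perpP d23 /normedP n0 /normedP n1 /andP[/normedP n2 /normedP n3]].
pose L p0 p1 p2 p3 := p0 *: e0 + p1 *: e1 + p2 *: e2 + p3 *: e3.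
have dL p0 p1 p2 p3 q0 q1 q2 q3 : dot (L p0 p1 p2 p3) (L q0 q1 q2 q3) =
    p0 * q0 + a * p1 * q1 + b * p2 * q2 + a * b * p3 * q3.
  rewrite /L !(dotDl, dotDr, dotZl, dotZr) (dotC e1 e0) (dotC e2 e0) (dotC e3 e0).
  by rewrite (dotC e2 e1) (dotC e3 e1) (dotC e3 e2) d01 d02 d03 d12 d13 d23 n0 n1 n2 n3; ring.
exists [:: L x y z w; L (- a * y) x (a * w) (- z); L (- b * z) (- b * w) x y;
           L (- (a * b) * w) (b * z) (- a * y) x].
  rewrite /fr /= !has_norms_cons has_norms_nil !andbT -!andbA.
  by do ![apply/andP; split]; (apply/perpP || apply/normedP); rewrite dL /c; ring.
move=> v; rewrite /perps /= !andbT => /and4P[/perpP z0 /perpP z1 /perpP z2 /perpP z3].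
by do ![apply/andP; split]; apply/perpP; rewrite /L !(dotDl, dotZl) z0 z1 z2 z3 !mulr0 !addr0.
Qed.

(* Similarity of a definite Pfister form: its multipliers are all positive rationals. *)
Lemma rep_pfister (a b c : rat) : 0 < a -> 0 < b -> 0 < c ->
  rep [:: 1; a; b; a * b] [:: c; c * a; c * b; c * (a * b)].
Proof.
move=> a0 b0 c0; have [x [y [z [w ->]]]] := nrd_definite a0 b0 c0.
have := @rep_quat a b x y z w.
by congr (rep _ [:: _; _; _; _]); ring.
Qed.

Lemma rep_scale1 a k s : rep (a :: s) (a * k ^+ 2 :: s).
Proof. exact: (rep_catr s (@rep_scale a k)). Qed.

Lemma rep_four (n : rat) : 0 < n -> rep [:: 1; 1; 1; 1] [:: n; n; n; n].
Proof.
by move=> n0; have := @rep_pfister 1 1 n ltr01 ltr01 n0; rewrite !mulr1.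
Qed.

Lemma rep_four_nseq (n : rat) a : 0 < n -> rep (nseq (4 * a) 1) (nseq (4 * a) n).
Proof.
move=> n0; elim: a => [|a IH]; first by rewrite muln0; apply: rep_refl.
rewrite mulnS (nseqD 4 (4 * a) 1) (nseqD 4 (4 * a) n).
apply: rep_trans (rep_catr _ (rep_four n0)) _.
exact: (@rep_cat [:: n; n; n; n] _ _ IH).
Qed.

(** Four ones become four d's; two of these with the remaining two ones form the Pfister form 1, 1,
    d, d, which is scaled by nd. Dividing two of the vectors by d turns the entries n d^2 into n. *)
Lemma rep_six (n d : rat) : 0 < n -> 0 < d ->
  rep (nseq 6 1) [:: n; n; d; d; n * d; n * d].
Proof.
move=> n0 d0; have nd0 : 0 < n * d by rewrite mulr_gt0.
apply: (rep_trans (rep_catr [:: 1; 1] (rep_four d0))).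
apply: (rep_trans (t := [:: d; d] ++ [:: 1; 1; d; 1 * d])).
  by apply: rep_perm; apply/seq.permP => p; rewrite !mul1r /=; count_lia.
apply: (rep_trans (rep_cat [:: d; d] (rep_pfister ltr01 d0 nd0))) => /=.
apply: (rep_trans (rep_cat [:: d; d; n * d; n * d * 1] (@rep_scale1 (n * d * d) d^-1 _))).
apply: (rep_trans (rep_cat [:: d; d; n * d; n * d * 1; n * d * d * d^-1 ^+ 2]
  (@rep_scale (n * d * (1 * d)) d^-1))) => /=.
have d1 : d != 0 by rewrite gt_eqF.
rewrite (_ : n * d * d * d^-1 ^+ 2 = n); last by field.
rewrite (_ : n * d * (1 * d) * d^-1 ^+ 2 = n); last by field.
by apply: rep_perm; apply/seq.permP => p; rewrite !mulr1 /=; count_lia.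
Qed.

Section Seqs.
Variable n : rat.
Definition pairs (s : seq rat) := s ++ [seq n * x | x <- s].

End Seqs.

(** After tensoring with the form 1, n only the dimension and the product of the entries matter: 1,
    n, xd, nxd is a Pfister form, and scaling it by x gives x, nx, d, nd up to squares. *)
Lemma rep_pairs (n : rat) k (g : seq rat) : 0 < n -> size g = k.+1 -> all (fun x => 0 < x) g ->
  rep (pairs n (nseq k 1 ++ [:: \prod_(x <- g) x])) (pairs n g).
Proof.
move=> n0; elim: k g => [|k IH] [|x g] //= [sz] /andP[x0 g0].
  by case: g sz {g0} => //= _; rewrite big_seq1; apply: rep_refl.
have d0 : 0 < \prod_(y <- g) y by rewrite big_seq; apply: prodr_gt0 => y; move/allP: g0; apply.
rewrite big_cons; set d := \prod_(y <- g) y in d0 *.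
have S1 : rep (pairs n [:: 1; x * d]) (pairs n [:: x; d]).
  have x1 : x != 0 by rewrite gt_eqF.
  apply: (rep_trans (t := [:: 1; n; x * d; n * (x * d)])).
    by apply: rep_perm; apply/seq.permP => p; rewrite /= ?mulr1; count_lia.
  apply: (rep_trans (rep_pfister n0 (mulr_gt0 x0 d0) x0)).
  apply: (rep_trans (rep_cat [:: x; x * n] (@rep_scale1 (x * (x * d)) x^-1 _))).
  apply: (rep_trans (rep_cat [:: x; x * n; x * (x * d) * x^-1 ^+ 2] (@rep_scale (x * (n * (x * d))) x^-1))) => /=.
  rewrite (_ : x * (x * d) * x^-1 ^+ 2 = d); last by field.
  rewrite (_ : x * (n * (x * d)) * x^-1 ^+ 2 = n * d); last by field.
  by apply: rep_perm; apply/seq.permP => p; rewrite (mulrC x n) /=; count_lia.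
apply: rep_trans (rep_perm _) (rep_trans (rep_catr (pairs n (nseq k 1)) S1) _).
  by apply/seq.permP => p; rewrite /pairs; do 4?[rewrite ?(map_cat, count_cat) /=]; count_lia.
apply: (rep_trans (t := pairs n [:: x] ++ pairs n (nseq k 1 ++ [:: d]))).
  by apply: rep_perm; apply/seq.permP => p; rewrite /pairs; do 4?[rewrite ?(map_cat, count_cat) /=]; count_lia.
apply: rep_trans (rep_cat _ (IH _ sz g0)) _.
by apply: rep_perm; apply/seq.permP => p; rewrite /pairs; do 4?[rewrite ?(map_cat, count_cat) /=]; count_lia.
Qed.

(** The entries [g] will carry the given frame, the entries [n * x] its scaled copy, and [d], which
    does not involve [n], the vector [e]. *)
Lemma rep_main (n : rat) (g : seq rat) (d := \prod_(x <- g) x) : 0 < n -> all (fun x => 0 < x) g ->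
  rep (nseq (2 * size g + 5) 1) (g ++ [seq n * x | x <- g] ++ [:: d]).
Proof.
move=> n0 g0; have d0 : 0 < d by rewrite /d big_seq; apply: prodr_gt0 => y; move/allP: g0; apply.
case E : (size g) => [|k].
  have := size0nil E => g_nil; rewrite /d g_nil big_nil /=.
  exact: (@rep_sub _ [:: 1] [:: 1; 1; 1; 1]).
rewrite catA -/(pairs n g).
apply: (rep_trans (t := pairs n (nseq k 1 ++ [:: d]) ++ [:: d])); last first.
  by apply: rep_catr; apply: rep_pairs.
apply: (rep_trans (t := nseq k 1 ++ (nseq k n ++ [:: d; d; n * d]))); last first.
  apply: rep_perm; apply/seq.permP => p; rewrite /pairs map_cat map_nseq mulr1; do 4?[rewrite ?count_cat /=]; count_lia.
have -> : (2 * k.+1 + 5 = k + (k + 7))%N by lia.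
rewrite nseqD; apply: rep_cat.
have kE := divn_eq k 4; move: (k %/ 4)%N (k %% 4)%N (ltn_pmod k (isT : 0 < 4)%N) kE => a j j4 kE.
(* Blocks of four ones give most of the entries n. The six of [rep_six] supply d, d, nd and up to
   two more n; for remainder 3 a further block of four covers them. *)
have [j2|j3] := leqP j 2.
  have -> : (k + 7 = 4 * a + 6 + j.+1)%N by lia.
  rewrite (nseqD _ j.+1) (nseqD _ 6) -catA.
  apply: (rep_trans (rep_catr _ (rep_four_nseq a n0))).
  apply: (rep_trans (rep_cat _ (rep_catr _ (rep_six n0 d0)))).
  rewrite kE mulnC nseqD -catA; apply: rep_cat.
  apply: (@rep_sub _ _ (nseq (2 - j) n ++ [:: n * d] ++ nseq j.+1 1)).
  apply/seq.permP => p; rewrite !count_cat /= !count_nseq.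
  case: j j2 {j4 kE} => [|[|[|//]]] _ /=; count_lia.
have -> : (k + 7 = 4 * a.+1 + 6)%N by lia.
rewrite (nseqD _ 6); apply: (rep_trans (rep_catr _ (rep_four_nseq a.+1 n0))).
apply: (rep_trans (rep_cat _ (rep_six n0 d0))).
have -> : (4 * a.+1 = k + 1)%N by lia.
rewrite nseqD -catA; apply: rep_cat.
apply: (@rep_sub _ _ [:: n; n; n; n * d]).
by apply/seq.permP => p /=; count_lia.
Qed.

(** Once the tails are aligned, one reflection exchanges the images of the two heads; it fixes the
    tail because both heads are orthogonal to it. *)
Lemma witt m (xs ys : seq 'rV[rat]_m) (s : seq rat) : all (fun x => 0 < x) s -> fr xs s -> fr ys s ->
  exists2 O : 'M[rat]_m, O *m O^T = 1%:M & [seq x *m O | x <- xs] = ys.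
Proof.
elim: xs ys s => [|x xs IH] [|y ys] [|a s] //; try by [move=> _ /fr_size | move=> _ _ /fr_size].
  by move=> _ _ _; exists 1%:M; rewrite ?trmx1 ?mulmx1.
rewrite /fr /= !has_norms_cons => /andP[a0 s0] /andP[/andP[xo xp] /andP[/normedP xa xs_]] /andP[/andP[yo yp] /andP[/normedP ya ys_]].
have frx : fr xs s by rewrite /fr xp.
have fry : fr ys s by rewrite /fr yp.
have [O HO E] := IH ys s s0 frx fry.
have NE : dot (x *m O) (x *m O) = dot y y by rewrite dot_orth // xa ya.
have [xy|xy] := eqVneq (x *m O) y; first by exists O => //; rewrite E xy.
have w0 : dot (x *m O - y) (x *m O - y) != 0 by rewrite dot_eq0 subr_eq0.
exists (O *m refl (x *m O - y)).
  by rewrite trmx_mul mulmxA -(mulmxA O) refl_orth // mulmx1.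
rewrite mulmxA refl_swap //; congr (_ :: _); rewrite -[RHS]E.
apply/eq_in_map => z zs; rewrite /= mulmxA refl_perp //.
rewrite dotC dotDl dotNl dot_orth //; move/allP: xo => /(_ z zs)/perpP ->.
have : z *m O \in ys by rewrite -E; apply: (map_f (mulmxr O)).
by move/(allP yo)/perpP ->; rewrite subr0.
Qed.

Section Orthogonal.
Variables (m : nat) (O : 'M[rat]_m).
Hypothesis HO : O *m O^T = 1%:M.

Lemma perp_orth (x y : 'rV[rat]_m) : perp (x *m O) (y *m O) = perp x y.
Proof. by rewrite /perp dot_orth. Qed.

Lemma perps_orth (xs : seq 'rV[rat]_m) z : perps [seq x *m O | x <- xs] (z *m O) = perps xs z.
Proof. by rewrite /perps all_map; apply: eq_all => x /=; rewrite perp_orth. Qed.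

Lemma fr_orth (xs : seq 'rV[rat]_m) s : fr [seq x *m O | x <- xs] s = fr xs s.
Proof.
have E1 : relpre (mulmxr O) (@perp m) =2 @perp m by move=> x y /=; rewrite perp_orth.
have E2 : (fun x : 'rV[rat]_m => dot x x) \o mulmxr O =1 fun x => dot x x.
  by move=> x /=; rewrite dot_orth.
rewrite /fr (pairwise_map (mulmxr O)) /has_norms -(map_comp _ (mulmxr O)) (eq_map E2).
by congr (_ && _); exact: (eq_pairwise E1 xs).
Qed.
End Orthogonal.

Lemma fr_std m : fr [seq (delta_mx 0 i : 'rV[rat]_m) | i <- enum 'I_m] (nseq m 1).
Proof.
have dd (i j : 'I_m) : dot (delta_mx 0 i) (delta_mx 0 j) = (i == j)%:R :> rat.
  rewrite /dot (bigD1 i) //= !mxE !eqxx /= mul1r big1 ?addr0 ?(eq_sym j) // => l li.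
  by rewrite !mxE (negbTE li) mul0r.
apply/andP; split.
  rewrite pairwise_map; have := enum_uniq 'I_m; rewrite uniq_pairwise.
  by apply: sub_pairwise => i j /= ij; apply/perpP; rewrite dd (negbTE ij).
rewrite /has_norms -map_comp; apply/eqP; rewrite -[in RHS](size_enum_ord m).
by elim: (enum 'I_m) => //= i s ->; rewrite dd eqxx.
Qed.

(* The vector e does not depend on n. *)
Theorem scaled_frames m (E : seq 'rV[rat]_m) (g : seq rat) : m = (2 * size g + 5)%N ->
  all (fun x => 0 < x) g -> fr E g ->
  exists e : 'rV[rat]_m, [/\ e != 0, perps E e & forall n : rat, 0 < n ->
    exists2 Z, fr Z [seq n * x | x <- g] & perps Z e /\ all (perps E) Z].
Proof.
move=> mE g0 HE; set d := \prod_(x <- g) x.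
have d0 : 0 < d by rewrite /d big_seq; apply: prodr_gt0 => y; move/allP: g0; apply.
have std n : 0 < n -> exists Y Z (w : 'rV[rat]_m), [/\ fr Y g, fr Z [seq n * x | x <- g],
    dot w w = d & [/\ perps Y w, perps Z w & all (perps Y) Z]].
  move=> n0; have Hstd : fr [seq (delta_mx 0 i : 'rV[rat]_m) | i <- enum 'I_m] (nseq (2 * size g + 5) 1).
    by rewrite -mE; exact: fr_std.
  case: (rep_main n0 g0) => /(_ _ _ Hstd)[ys Hys _].
  have sy := fr_size Hys; rewrite -(cat_take_drop (size g) ys) in Hys.
  move: Hys; rewrite fr_cat; last by rewrite size_takel // sy size_cat leq_addr.
  set Y := take _ _; set R := drop _ _ => /and3P[HY HR HYR].
  have sR : size R = (size g).+1 by rewrite size_drop sy !size_cat size_map /=; lia.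
  rewrite -(cat_take_drop (size g) R) in HR HYR.
  move: HR; rewrite fr_cat; last by rewrite size_map size_takel // sR.
  have : size (drop (size g) R) = 1%N by rewrite size_drop sR; lia.
  move: HYR; rewrite all_cat.
  set Z := take _ _; case: (drop _ _) => [|w [|//]] //= /andP[YZ /andP[Yw _]] _ /and3P[HZ Hw].
  rewrite andbT => Zw.
  exists Y, Z, w; split => //.
  by move: Hw; rewrite /fr has_norms_cons => /and3P[_ /normedP].
have [Y [Z [w [HY _ Hw [Yw _ _]]]]] := std 1 ltr01.
have [O HO EO] := witt g0 HY HE.
have NE : dot (w *m O) (w *m O) = d by rewrite (dot_orth w w HO).
have eE : perps E (w *m O).
  by rewrite -EO perps_orth.
exists (w *m O); split => //; first by rewrite -dot_gt0 NE.
move=> n n0; have [Y' [Z' [w' [HY' HZ' Hw' [Yw' Zw' YZ']]]]] := std n n0.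
have frw (A : seq 'rV[rat]_m) v : fr A g -> dot v v = d -> perps A v -> fr (A ++ [:: v]) (g ++ [:: d]).
  move=> HA Hv Av; rewrite fr_cat ?(fr_size HA) // HA /= Av /fr /= has_norms_cons has_norms_nil !andbT; exact/normedP.
(* The frame [Y'] with [w'] has the same norms as [E] with the vector chosen for n = 1, so the
   configuration built for [n] can be moved onto the fixed one. *)
have [|O' HO' EO'] := @witt m (Y' ++ [:: w']) (E ++ [:: w *m O]) (g ++ [:: d]) _ (frw _ _ HY' Hw' Yw') (frw _ _ HE NE eE).
  by rewrite all_cat g0 /= d0.
move: EO'; rewrite map_cat => /eqP; rewrite eqseq_cat; last by rewrite size_map (fr_size HY') (fr_size HE).
rewrite /= eqseq_cons andbT => /andP[/eqP EY /eqP Ew].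
exists [seq z *m O' | z <- Z'].
  by rewrite fr_orth.
split; first by rewrite -Ew perps_orth.
by rewrite -EY all_map; apply: sub_all YZ' => z; rewrite /= perps_orth.
Qed.

(** * Bounded denominators *)

Definition iv n (z : 'rV[int]_n) : 'rV[rat]_n := map_mx intr z.

Lemma iv_D n (x y : 'rV[int]_n) : iv (x + y) = iv x + iv y.
Proof. exact: raddfD. Qed.
Lemma iv_B n (x y : 'rV[int]_n) : iv (x - y) = iv x - iv y.
Proof. exact: raddfB. Qed.
Lemma iv_Z n (a : int) (x : 'rV[int]_n) : iv (a *: x) = a%:~R *: iv x.
Proof. by apply/rowP => i; rewrite !mxE intrM. Qed.
Lemma iv_inj n : injective (@iv n).
Proof. by move=> x y /rowP E; apply/rowP => i; have := E i; rewrite !mxE => /intr_inj. Qed.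
Lemma dot_iv n (x y : 'rV[int]_n) : dot (iv x) (iv y) = (dot x y)%:~R.
Proof. by rewrite /dot rmorph_sum; apply: eq_bigr => i _; rewrite !mxE rmorphM. Qed.

Lemma clear_denoms n (x : 'rV[rat]_n) : exists2 d : nat, (0 < d)%N & exists z, d%:R *: x = iv z.
Proof.
pose d := (\prod_i `|denq (x ord0 i)|)%N.
have d0 : (0 < d)%N by rewrite prodn_gt0 // => i; rewrite absz_gt0 denq_neq0.
exists d => //; exists (\row_i (numq (x ord0 i) * (d %/ `|denq (x ord0 i)|)%N%:Z)).
apply/rowP => i; rewrite !mxE intrM numqE.
have /dvdnP[k E] : (`|denq (x ord0 i)| %| d)%N by rewrite /d (bigD1 i) //= dvdn_mulr.
rewrite E mulnK ?absz_gt0 ?denq_neq0 // natrM natr_absz ger0_norm //.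
by rewrite -pmulrn; ring.
Qed.

Section Lattice.
Variables (n m : nat) (B : 'M[rat]_(n, m)).
Let beta (x y : 'rV[rat]_n) : rat := dot (x *m B) (y *m B).
Hypothesis beta_int : forall x y : 'rV[int]_n, beta (iv x) (iv y) \is a Num.int.

Let betaC x y : beta x y = beta y x. Proof. exact: dotC. Qed.
Let betaDl x y z : beta (x + y) z = beta x z + beta y z.
Proof. by rewrite /beta mulmxDl dotDl. Qed.
Let betaNl x z : beta (- x) z = - beta x z.
Proof. by rewrite /beta mulNmx dotNl. Qed.
Let betaZl a x z : beta (a *: x) z = a * beta x z.
Proof. by rewrite /beta -scalemxAl dotZl. Qed.
Let betaDr x y z : beta z (x + y) = beta z x + beta z y.
Proof. by rewrite betaC betaDl !(betaC z). Qed.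
Let betaZr a x z : beta z (a *: x) = a * beta z x.
Proof. by rewrite betaC betaZl betaC. Qed.

Definition eqmod (t : nat) (x y : 'rV[rat]_n) := exists z : 'rV[int]_n, x - y = t%:R *: iv z.

(* [dense L]: the index of tZ^n in L is at least t^n, for all suitably divisible t *)
Definition dense (L : 'rV[rat]_n -> Prop) := exists2 t : nat, (0 < t)%N &
  (forall z, L (t%:R *: iv z)) /\ forall t', (0 < t')%N -> (t %| t')%N ->
  exists (I : finType) (f : I -> 'rV[rat]_n), [/\ (t' ^ n <= #|I|)%N,
    forall i, L (f i) & forall i j, eqmod t' (f i) (f j) -> i = j].

Definition integral_lattice (L : 'rV[rat]_n -> Prop) :=
  [/\ L 0, forall x y, L x -> L y -> L (x - y) & forall x y, L x -> L y -> beta x y \is a Num.int].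

Lemma dense_Zn : dense (fun x => exists z, x = iv z).
Proof.
exists 1%N => //; split=> [z|t t0 _]; first by exists z; rewrite scale1r.
exists {ffun 'I_n -> 'I_t}, (fun f : {ffun 'I_n -> 'I_t} => iv (\row_i (f i : nat)%:Z)); split.
- by rewrite card_ffun !card_ord.
- by move=> f; exists (\row_i (f i : nat)%:Z).
move=> f g [z E]; apply/ffunP => i; apply: val_inj => /=.
have Ei : (f i : nat)%:Z - (g i : nat)%:Z = t%:Z * z ord0 i.
  apply: (@intr_inj rat); move/rowP: E => /(_ i); rewrite !mxE => E.
  by rewrite rmorphB /= E intrM.
have := ltn_ord (f i); have := ltn_ord (g i); move: Ei.
move: (z ord0 i) (nat_of_ord (f i)) (nat_of_ord (g i)) => u a b Ei bt at_.
have [u1|u1|u1] := ltgtP u 0; last by move: Ei; rewrite u1 mulr0; lia.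
  have : t%:Z * u <= - t%:Z by nia.
  lia.
have : t%:Z <= t%:Z * u by nia.
lia.
Qed.

Lemma Zn_lattice : integral_lattice (fun x => exists z, x = iv z).
Proof.
split; first by exists 0; apply/rowP => i; rewrite !mxE.
  by move=> x y [z ->] [w ->]; exists (z - w); rewrite iv_B.
by move=> x y [z ->] [w ->]; apply: beta_int.
Qed.

Lemma pigeonhole (I : finType) s (c : I -> 'I_s) : (0 < s)%N ->
  exists r, (#|I| <= #|[pred i | c i == r]| * s)%N.
Proof.
move=> s0; have [/existsP[r Hr]|/existsPn H] := boolP [exists r, #|I| <= #|[pred i | c i == r]| * s]%N.
  by exists r.
have E : #|I| = (\sum_(r < s) #|[pred i | c i == r]|)%N.
  rewrite -sum1_card (partition_big c predT) //=.
  by apply: eq_bigr => r _; rewrite sum1_card.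
have : (\sum_(r < s) (#|[pred i | c i == r]| * s + 1) <= \sum_(r < s) #|I|)%N.
  by apply: leq_sum => r _; rewrite addn1 ltnNge H.
rewrite big_split /= -big_distrl /= -E !sum_nat_const card_ord muln1 mulnC.
by rewrite -[X in (_ <= X)%N]addn0 leq_add2l leqn0 eqn0Ngt s0.
Qed.

Lemma ex_min (P : nat -> Prop) : (exists k, P k) -> exists2 k, P k & forall j, (j < k)%N -> ~ P j.
Proof.
move=> [k Pk]; have ex : exists k, `[< P k >] by exists k; apply/asboolP.
case: (ex_minnP ex) => j /asboolP Pj jmin; exists j => // i ij /asboolP Pi.
by have := jmin i Pi; rewrite leqNgt ij.
Qed.

(** Let K be the part of L pairing integrally with x, and L' = K + Zx. If s is the least positive
    integer with s x in L, the class of s beta(y, x) modulo s shows that K has index at most s in L,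
    while the multiples j x, j < s, are distinct modulo L. So passing from L to L' does not lose
    density. *)
Lemma lattice_add L x : integral_lattice L -> dense L -> beta x x \is a Num.int ->
  exists L', [/\ integral_lattice L', dense L', L' x &
    forall y, L y -> beta y x \is a Num.int -> L' y].
Proof.
move=> [L0 LB Lint] [t t0 [Lt Ld]] xx.
have LN y : L y -> L (- y) by move=> Hy; rewrite -[- y]add0r; apply: LB.
have LD y z : L y -> L z -> L (y + z) by move=> Hy Hz; rewrite -[z]opprK; apply: LB => //; apply: LN.
have Lmn y k : L y -> L (k%:R *: y).
  by move=> Hy; elim: k => [|k IH]; rewrite ?scale0r // -natr1 scalerDl scale1r; apply: LD.
pose K y := L y /\ beta y x \is a Num.int.
pose L' y := exists2 j : int, True & K (y - j%:~R *: x).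
have K0 : K 0 by split=> //; rewrite /beta mul0mx dot0l.
have KB y z : K y -> K z -> K (y - z).
  by move=> [Ly yx] [Lz zx]; split; [exact: LB | rewrite betaDl betaNl rpredB].
have K' y : K y -> L' y by move=> Ky; exists 0 => //; rewrite scale0r subr0.
exists L'; split.
- split; first exact: K'.
    move=> y z [j _ Ky] [k _ Kz]; exists (j - k) => //.
    rewrite (_ : _ - _ = (y - j%:~R *: x) - (z - k%:~R *: x)); first exact: KB.
    by rewrite rmorphB scalerBl /=; apply/rowP => i; rewrite !mxE; ring.
  move=> y z [j _ [Ly yx]] [k _ [Lz zx]].
  have Ey : y = (y - j%:~R *: x) + j%:~R *: x by rewrite subrK.
  have Ez : z = (z - k%:~R *: x) + k%:~R *: x by rewrite subrK.
  move: (y - _) (z - _) Ey Ez Ly yx Lz zx => y' z' -> -> Ly yx Lz zx.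
  rewrite betaDl !betaDr !betaZl !betaZr (betaC x z').
  have := Lint _ _ Ly Lz; move: yx zx xx.
  move: (beta y' x) (beta z' x) (beta x x) (beta y' z') => a b c d a1 b1 c1 d1.
  by rewrite !rpredD // !rpredM ?intr_int.
- have [s [s0 Lsx] smin] : exists2 s : nat, (0 < s)%N /\ L (s%:R *: x) &
      forall j, (j < s)%N -> ~ ((0 < j)%N /\ L (j%:R *: x)).
    apply: (@ex_min (fun s => (0 < s)%N /\ L (s%:R *: x))).
    have [d d0 [z Ez]] := clear_denoms x; exists (t * d)%N; rewrite muln_gt0 t0 d0; split=> //.
    by rewrite natrM -scalerA Ez; apply: Lt.
  have sr : s%:R != 0 :> rat by rewrite pnatr_eq0 -lt0n.
  have bs y : L y -> s%:R * beta y x \is a Num.int by rewrite -betaZr => Ly; apply: Lint.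
  have Ks t' z : (t * s %| t')%N -> K (t'%:R *: iv z).
    move=> /dvdnP[k ->]; have -> : (k * (t * s))%:R *: iv z = (k * s)%:R *: (t%:R *: iv z).
      by rewrite scalerA -natrM; congr (_%:R *: _); lia.
    split; first exact: Lmn.
    by rewrite betaZl natrM -mulrA; apply: rpredM; [exact: rpred_nat | exact: bs].
  exists (t * s)%N; first by rewrite muln_gt0 t0.
  split=> [z|t' t'0 tt']; first by apply: K'; apply: Ks.
  have [I [f [cI fL finj]]] := Ld t' t'0 (dvdn_trans (dvdn_mulr _ (dvdnn _)) tt').
  pose cl i : 'I_s := Ordinal (ltn_pmod (absz (Num.floor (s%:R * beta (f i) x) %% s)%Z) s0).
  have clE i j : cl i = cl j -> beta (f i - f j) x \is a Num.int.
    have szn0 : (s%:Z != 0) by rewrite gt_eqF // ltz_nat.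
    move=> /(congr1 val) /=.
    have small u : (absz (u %% s)%Z < s)%N.
      by rewrite -ltz_nat gez0_abs ?modz_ge0 // ltz_mod.
    rewrite !modn_small // => E.
    have {}E : (Num.floor (s%:R * beta (f i) x) %% s)%Z = (Num.floor (s%:R * beta (f j) x) %% s)%Z.
      by rewrite -[LHS]gez0_abs ?modz_ge0 // -[RHS]gez0_abs ?modz_ge0 // E.
    move/eqP: E; rewrite eqz_mod_dvd => /dvdzP[k Ek].
    have := bs _ (fL i); have := bs _ (fL j).
    move/floorK => Ej /floorK Ei.
    have : s%:R * (beta (f i) x - beta (f j) x) = s%:R * k%:~R.
      rewrite mulrBr -Ei -Ej -rmorphB /= Ek intrM mulrC; congr (_ * _).
    by move/(mulfI sr); rewrite betaDl betaNl => ->; apply: intr_int.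
  have [r Hr] := pigeonhole cl s0.
  have [I0|[i0 Hi0]] : #|[pred i | cl i == r]| = 0%N \/ exists i0, cl i0 == r.
    have [->|/card_gt0P[i0 Hi0]] := posnP #|[pred i | cl i == r]|; first by left.
    by right; exists i0.
    by move: cI; rewrite leqNgt; move: Hr; rewrite I0 mul0n leqn0 => /eqP ->; rewrite expn_gt0 t'0.
  pose J := ({i : I | cl i == r} * 'I_s)%type.
  exists J, (fun ij : J => (f (val ij.1) - f i0) + (ij.2 : nat)%:R *: x); split.
  - by rewrite card_prod card_ord card_sig; apply: leq_trans cI Hr.
  - move=> [[i /= Hi] j]; exists j%:Z => //=; rewrite addrK; split; first exact: LB.
    by apply: clE; rewrite (eqP Hi) (eqP Hi0).
  move=> [[i Hi] j] [[i' Hi'] j'] /= [z Ez].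
  have Kii : K (f i - f i').
    by split; [exact: LB | apply: clE; rewrite (eqP Hi) (eqP Hi')].
  have Ljj : L ((j : nat)%:R *: x - (j' : nat)%:R *: x).
    have -> : (j : nat)%:R *: x - (j' : nat)%:R *: x = t'%:R *: iv z - (f i - f i').
      by rewrite -Ez; apply/rowP => l; rewrite !mxE; ring.
    by apply: LB; [case: (Ks t' z tt') | case: Kii].
  have Ej : j = j'.
    have ord (a b : 'I_s) : (a < b)%N -> L ((b : nat)%:R *: x - (a : nat)%:R *: x) -> False.
      move=> ab H; apply: (smin (b - a)%N); first by have := ltn_ord b; lia.
      by rewrite subn_gt0 ab natrB ?(ltnW ab) // scalerBl.
    apply: val_inj; case: (ltngtP (j : nat) j') => // jj; first last.
      by case: (ord _ _ jj Ljj).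
    by case: (ord _ _ jj); rewrite -opprB; apply: LN.
  rewrite Ej; congr (_, _); apply: val_inj => /=; apply: finj; exists z.
  by rewrite -Ez Ej; apply/rowP => l; rewrite !mxE; ring.
- by exists 1 => //; rewrite scale1r subrr.
- by move=> y Ly yx; apply: K'.
Qed.

Lemma lattice_family (xs : seq 'rV[rat]_n) :
  (forall x y, x \in xs -> y \in xs -> beta x y \is a Num.int) ->
  exists L, [/\ integral_lattice L, dense L & forall x, x \in xs -> L x].
Proof.
elim: xs => [_|x xs IH H]; first by eexists; split; [exact: Zn_lattice | exact: dense_Zn |].
have [y z yx zx|L [HL dL xL]] := IH; first by apply: H; rewrite inE ?yx ?zx orbT.
have [|L' [HL' dL' L'x sub]] := lattice_add (x := x) HL dL; first by apply: H; apply: mem_head.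
exists L'; split=> // y; rewrite inE => /predU1P[->//|yx]; apply: sub; first exact: xL.
by apply: H; rewrite inE ?eqxx ?yx ?orbT.
Qed.

(** A form of Minkowski's argument: L has at least (2t)^n classes modulo 2t Z^n, and a period cube
    is cut into t^n cells of side 2. Two classes share a cell, and their reduced difference is the
    short vector. *)
Lemma short_vector L : (0 < n)%N -> integral_lattice L -> dense L ->
  exists2 w, L w & w != 0 /\ forall i, `|w ord0 i| < 2.
Proof.
move=> n0 [L0 LB Lint] [t t0 [Lt Ld]].
have [I [f [cI fL finj]]] := Ld (t * 2)%N ltac:(by rewrite muln_gt0 t0) (dvdn_mulr _ (dvdnn _)).
have tr : (t * 2)%:R != 0 :> rat by rewrite pnatr_eq0 -lt0n muln_gt0 t0.
have tp : 0 < (t * 2)%:R :> rat by rewrite lt_def tr ler0n.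
pose fl (c : rat) : int := Num.floor (c / (t * 2)%:R).
pose rd (c : rat) : rat := c - (t * 2)%:R * (fl c)%:~R.
have rd_bd c : 0 <= rd c < (t * 2)%:R.
  have /andP[] := floor_itv (c / (t * 2)%:R); rewrite -/(fl c).
  rewrite ler_pdivlMr // ltr_pdivrMr // intrD => h1 h2.
  by rewrite /rd; apply/andP; split; lra.
pose ce (c : rat) : nat := `|Num.floor (rd c / 2)|%N.
have ce_bd c : (ce c)%:R <= rd c / 2 < (ce c)%:R + 1.
  have /andP[r0 r1] := rd_bd c.
  have := floor_itv (rd c / 2).
  have F0 : 0 <= Num.floor (rd c / 2) by rewrite floor_ge0 divr_ge0.
  by rewrite intrD /ce natr_absz ger0_norm.
have ce_lt c : (ce c < t)%N.
  have /andP[r0 r1] := rd_bd c; have /andP[c0 c1] := ce_bd c.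
  by rewrite -(ltr_nat rat); move: r1; rewrite natrM; lra.
pose F (i : I) : {ffun 'I_n -> 'I_t} := [ffun l => Ordinal (ce_lt (f i ord0 l))].
have [i [j [ij Fij]]] : exists i j, i != j /\ F i = F j.
  have /injectivePn[i [j ij E]] : ~~ injectiveb F.
    apply/negP => /injectiveP /leq_card; rewrite card_ffun !card_ord leqNgt => /negP; apply.
    by apply: leq_trans cI; rewrite ltn_exp2r //; lia.
  by exists i, j.
pose z := \row_l (fl (f i ord0 l) - fl (f j ord0 l)).
exists (f i - f j - (t * 2)%:R *: iv z).
  apply: (LB); first exact: LB.
  have -> : (t * 2)%:R *: iv z = t%:R *: iv (2%:Z *: z).
    by apply/rowP => l; rewrite !mxE natrM intrM; ring.
  exact: Lt.
split.
  apply: contra ij => /eqP E; apply/eqP; apply: finj; exists z.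
  by apply/eqP; rewrite -subr_eq0 E.
move=> l; rewrite !mxE.
have /ffunP/(_ l) := Fij; rewrite !ffunE => /(congr1 val) /= E.
have := ce_bd (f i ord0 l); have := ce_bd (f j ord0 l); rewrite E {2 4}/rd.
rewrite -/(rd (f i ord0 l)) -/(rd (f j ord0 l)).
have -> : f i ord0 l - f j ord0 l - (t * 2)%:R * (fl (f i ord0 l) - fl (f j ord0 l))%:~R =
          rd (f i ord0 l) - rd (f j ord0 l).
  by rewrite /rd rmorphB /=; ring.
by rewrite ltr_norml => /andP[a1 a2] /andP[b1 b2]; lra.
Qed.
End Lattice.

Section BoundedDenominators.
Variable m : nat.
Implicit Types V : 'M[rat]_m.

Lemma integer_basis V : exists B : 'M[int]_(\rank V, m), (map_mx intr B :=: V)%MS.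
Proof.
have H i : exists d : nat, (0 < d)%N /\ exists z, d%:R *: row i (row_base V) = iv z.
  by have [d d0 Hd] := clear_denoms (row i (row_base V)); exists d.
have [d Hd] := choice H.
have [z Hz] := choice (fun i => (Hd i).2).
have D0 : (\row_i (d i)%:R : 'rV[rat]_(\rank V)) \in [pred D : 'rV[rat]_(\rank V) | [forall i, D ord0 i != 0]].
  by rewrite inE; apply/forallP => i; rewrite mxE pnatr_eq0 -lt0n; case: (Hd i).
exists (\matrix_i z i).
have -> : map_mx intr (\matrix_i z i) = diag_mx (\row_i (d i)%:R) *m row_base V :> 'M[rat]_(_, m).
  apply/row_matrixP => i; rewrite row_mul row_diag_mx -scalemxAl mxE -rowE Hz.
  by rewrite /iv -map_row rowK.
apply: eqmx_trans (eq_row_base V).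
apply: eqmxMfull; rewrite row_full_unit unitmxE det_diag unitfE.
by apply/prodf_neq0 => i _; rewrite mxE pnatr_eq0 -lt0n; case: (Hd i).
Qed.

(** [A] bounds the norm of any vector with coordinates below 2 in a fixed integer basis of [V], so
    it precedes the choice of [x]. The short vector is taken in an integral lattice containing the
    x_i, hence pairs integrally with them. *)
Lemma short_dual V k : (0 < \rank V)%N -> exists A : nat, forall x : 'I_k -> 'rV[rat]_m,
  (forall i, (x i <= V)%MS) -> (forall i j, dot (x i) (x j) \is a Num.int) ->
  exists w : 'rV[rat]_m, [/\ (w <= V)%MS, w != 0,
    exists2 a : nat, (a <= A)%N & dot w w = a%:R & forall i, dot w (x i) \is a Num.int].
Proof.
move=> V0; have [B HB] := integer_basis V; set n := \rank V in V0 B HB.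
set Br := map_mx intr B : 'M[rat]_(n, m) in HB.
have Bfree : row_free Br by rewrite /row_free HB.
have iB z : iv z *m Br = iv (z *m B) by rewrite /iv map_mxM.
have bint (z z' : 'rV[int]_n) : dot (iv z *m Br) (iv z' *m Br) \is a Num.int.
  by rewrite !iB dot_iv intr_int.
pose M : rat := \sum_i \sum_j 4 * `|dot (row i Br) (row j Br)|.
exists (`|Num.ceil M|)%N => x xV xint.
have crd i : exists c, x i = c *m Br by apply/submxP; rewrite HB.
have [c Hc] := choice crd.
have [|L [HL dL cL]] := @lattice_family n m Br bint [seq c i | i <- enum 'I_k].
  by move=> y z /mapP[i _ ->] /mapP[j _ ->]; rewrite -!Hc.
have [L0 LB Lint] := HL.
have [w Lw [w0 wb]] := short_vector V0 HL dL.
exists (w *m Br).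
have wV : (w *m Br <= V)%MS by rewrite -HB submxMl.
have wn0 : w *m Br != 0.
  apply: contra w0 => /eqP E; apply/eqP; apply: (row_free_inj Bfree); by rewrite mul0mx.
split => //; last first.
  by move=> i; rewrite Hc; apply: Lint => //; apply: cL; apply: map_f; rewrite mem_enum.
have nonneg : 0 <= dot (w *m Br) (w *m Br) by apply: ltW; rewrite dot_gt0.
have bd : dot (w *m Br) (w *m Br) <= M.
  have wE : w *m Br = \sum_i w ord0 i *: row i Br by rewrite mulmx_sum_row.
  rewrite wE dot_suml; apply: ler_sum => i _; rewrite dotZl dot_sumr mulr_sumr.
  apply: ler_sum => j _; rewrite dotZr mulrA; apply: le_trans (ler_norm _) _.
  rewrite normrM ler_wpM2r //= normrM.
  have -> : (4 : rat) = 2 * 2 by [].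
  by apply: ler_pM => //; apply: ltW.
have /intrP[a Ea] := Lint _ _ Lw Lw.
move: nonneg bd; rewrite Ea; case: a {Ea} => a; last by rewrite ler0z.
move=> _ bd; exists a => //.
have : (a%:Z <= Num.ceil M) by rewrite -(ler_int rat); apply: le_trans bd (ceil_ge _).
by move=> h; rewrite -lez_nat gez0_abs //; apply: le_trans h.
Qed.

Lemma refl_sub V (w x : 'rV[rat]_m) : (w <= V)%MS -> (x <= V)%MS -> (x *m refl w <= V)%MS.
Proof. by move=> wV xV; rewrite refl_act addmx_sub // eqmx_opp scalemx_sub. Qed.

Definition perpmx V (w : 'rV[rat]_m) : 'M[rat]_m := (V :&: kermx w^T)%MS.

Lemma perpmxP V w (x : 'rV[rat]_m) : (x <= perpmx V w)%MS = (x <= V)%MS && (dot x w == 0).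
Proof.
rewrite sub_capmx; congr (_ && _); apply/sub_kermxP/eqP => [|h]; rewrite dot_mx.
  by move/matrixP/(_ 0 0); rewrite !mxE eqxx mulr1n.
by rewrite h -scalemx1 scale0r.
Qed.

Lemma rank_perpmx V w : (w <= V)%MS -> w != 0 -> (\rank (perpmx V w) < \rank V)%N.
Proof.
move=> wV w0; rewrite ltnNge; apply/negP => le.
have : (V <= perpmx V w)%MS.
  by rewrite -(geq_leqif (mxrank_leqif_sup (capmxSl V (kermx w^T)))); exact: le.
by move=> /(submx_trans wV); rewrite perpmxP wV /= dot_eq0 (negbTE w0).
Qed.

(** Induction on the rank. The short vector has one of finitely many norms a; for each, a vector [w]
    of [V] of that norm is fixed in advance, and a reflection preserving [V] carries the short
    vector to [w]. The complement of [w] is handled by induction, and [q] is the product over a. *)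
Theorem bounded_denominators V k : exists2 q : nat, (0 < q)%N &
  forall x : 'I_k -> 'rV[rat]_m, (forall i, (x i <= V)%MS) ->
    (forall i j, dot (x i) (x j) \is a Num.int) ->
  exists y : 'I_k -> 'rV[int]_m, (forall i, (iv (y i) <= V)%MS) /\
    forall i j, dot (iv (y i)) (iv (y j)) = q%:R ^+ 2 * dot (x i) (x j).
Proof.
have [n] := ubnP (\rank V); elim: n V => // n IH V rV.
have [V0|V0] := posnP (\rank V).
  exists 1%N => // x xV _; exists (fun=> 0); split=> [i|i j].
    by rewrite /iv map_mx0 sub0mx.
  have x0 l : x l = 0.
    by apply/eqP; rewrite -submx0; apply: submx_trans (xV l) _; rewrite submx0 -mxrank_eq0 V0.
  by rewrite /iv map_mx0 !x0 dot0l mulr0.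
have [A HA] := short_dual k V0.
have step a : exists2 q : nat, (0 < q)%N & forall (x : 'I_k -> 'rV[rat]_m) w, (forall i, (x i <= V)%MS) ->
    (forall i j, dot (x i) (x j) \is a Num.int) -> (w <= V)%MS -> w != 0 -> dot w w = a%:R ->
    (forall i, dot w (x i) \is a Num.int) ->
  exists y : 'I_k -> 'rV[int]_m, (forall i, (iv (y i) <= V)%MS) /\
    forall i j, dot (iv (y i)) (iv (y j)) = q%:R ^+ 2 * dot (x i) (x j).
  have [[w [wV w0 wa]]|none] := pselect (exists w, [/\ (w <= V)%MS, w != 0 & dot w w = a%:R]); last first.
    by exists 1%N => // x w _ _ wV w0 wa _; case: none; exists w.
  have ar : (a%:R : rat) != 0 by rewrite -wa dot_eq0.
  have [q0 q00 Hq] := IH (perpmx V w) (leq_trans (rank_perpmx wV w0) rV).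
  have [d d0 [wz Ew]] := clear_denoms w.
  (* [d] clears the denominators of [w], [q0] comes from the complement, and [a] from projecting: a
     x_i = b_i w + u_i with integral Gram matrix for the u_i. *)
  exists (d * q0 * a)%N; first by rewrite !muln_gt0 d0 q00 lt0n -(pnatr_eq0 rat).
  move=> x v xV xint vV v0 va vx.
  have [O [HO OV OE]] : exists O : 'M[rat]_m, [/\ O *m O^T = 1%:M,
      forall u : 'rV_m, (u <= V)%MS -> (u *m O <= V)%MS & v *m O = w].
    have [vw|vw] := eqVneq v w.
      by exists 1%:M; rewrite trmx1 !mulmx1; split=> // u; rewrite mulmx1.
    have n0 : dot (v - w) (v - w) != 0 by rewrite dot_eq0 subr_eq0.
    exists (refl (v - w)); split; [exact: refl_orth| |by apply: refl_swap => //; rewrite va wa].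
    by move=> u uV; apply: refl_sub => //; rewrite addmx_sub // eqmx_opp.
  pose b i := dot (x i *m O) w.
  have bE i : b i = dot v (x i) by rewrite /b -OE dot_orth // dotC.
  pose u i := a%:R *: (x i *m O) - b i *: w.
  have uV i : (u i <= perpmx V w)%MS.
    rewrite perpmxP addmx_sub ?scalemx_sub ?OV //=; last by rewrite eqmx_opp scalemx_sub.
    by rewrite dotDl dotNl !dotZl -/(b i) wa; apply/eqP; ring.
  have uE i j : dot (u i) (u j) = a%:R ^+ 2 * dot (x i) (x j) - a%:R * (b i * b j).
    rewrite /u !(dotDl, dotDr, dotNl, dotNr, dotZl, dotZr) dot_orth // wa (dotC w) -/(b j) -/(b i); ring.
  have [|y [yV yE]] := Hq u uV.
    by move=> i j; rewrite uE; rewrite rpredB // rpredM ?rpredX ?rpred_nat // ?rpredM // ?bE.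
  have [bz Hbz] := choice (fun i => elimT intrP (vx i)).
  exists (fun i => (q0%:Z * bz i) *: wz + d%:Z *: y i).
  have vE i : iv ((q0%:Z * bz i) *: wz + d%:Z *: y i) = (d * q0)%:R * b i *: w + d%:R *: iv (y i).
    rewrite iv_D !iv_Z -Ew scalerA bE Hbz intrM natrM -!pmulrn; congr (_ *: _ + _); ring.
  split=> [i|i j]; rewrite !vE.
    have := yV i; rewrite perpmxP => /andP[yVi _].
    by rewrite addmx_sub ?scalemx_sub.
  have y0 l : dot (iv (y l)) w = 0 by have := yV l; rewrite perpmxP => /andP[_ /eqP].
  rewrite !(dotDl, dotDr, dotZl, dotZr) yE uE wa (dotC w) !y0 !natrM; ring.
have [q Hq] := choice (fun a => let: ex_intro2 q q0 H := step a in ex_intro _ q (conj q0 H)).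
exists (\prod_(a < A.+1) q a)%N; first by rewrite prodn_gt0 // => a; case: (Hq a).
move=> x xV xint; have [w [wV w0 [a aA wa] wx]] := HA x xV xint.
have [y [yV yE]] := (Hq a).2 x w xV xint wV w0 wa wx.
pose r := (\prod_(b < A.+1 | b != inord a) q b)%N.
have rE : (\prod_(a < A.+1) q a = q a * r)%N.
  by rewrite (bigD1 (inord a)) //= inordK.
exists (fun i => r%:Z *: y i); split=> [i|i j]; rewrite !iv_Z; first by rewrite scalemx_sub.
by rewrite dotZl dotZr yE rE natrM -pmulrn; ring.
Qed.
End BoundedDenominators.

(** * Scaled copies and their reflections *)

Lemma gram_schmidt m r (v : nat -> 'rV[rat]_m) :
  (forall i, (i < r)%N -> ~~ (v i <= \sum_(l < i) <<v l>>)%MS) ->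
  exists E (L : nat -> nat -> rat), forall i, (i < r)%N ->
   [/\ E i != 0, v i = E i + \sum_(l < i) L i l *: E l & forall l, (l < i)%N -> dot (E i) (E l) = 0].
Proof.
move=> ind; pose V i := (\sum_(l < i) <<v l>>)%MS.
have VS i j : (i <= j)%N -> (V i <= V j)%MS.
  by move=> ij; apply/sumsmx_subP => l _; apply: (sumsmx_sup (widen_ord ij l)).
have vV l i : (l < i)%N -> (v l <= V i)%MS.
  by move=> li; apply: (sumsmx_sup (Ordinal li)); rewrite // genmxE.
suff H s : (s <= r)%N -> exists (E : nat -> 'rV[rat]_m) (L : nat -> nat -> rat), forall i, (i < s)%N ->
   [/\ E i != 0, v i = E i + \sum_(l < i) L i l *: E l, (E i - v i <= V i)%MS &
      forall l, (l < i)%N -> dot (E i) (E l) = 0].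
  by have [E [L H']] := H r (leqnn r); exists E, L => i /H' [].
elim: s => [_|s IH sr]; first by exists (fun=> 0), (fun _ _ => 0).
have [E [L H]] := IH (ltnW sr).
pose c l := dot (v s) (E l) / dot (E l) (E l).
pose w := v s - \sum_(l < s) c l *: E l.
have EV l : (l < s)%N -> (E l <= V s)%MS.
  move=> ls; have [_ _ EV _] := H l ls.
  by rewrite -[E l](subrK (v l)) addmx_sub ?vV //; apply: submx_trans EV (VS _ _ (ltnW ls)).
have wV : (w - v s <= V s)%MS.
  rewrite /w addrAC subrr add0r -scaleN1r scalemx_sub //.
  by apply: summx_sub => l _; apply: scalemx_sub; apply: EV.
exists (fun i => if i == s then w else E i), (fun i l => if i == s then c l else L i l) => i.
rewrite ltnS leq_eqVlt; case: eqP => [-> _|_ /= i_s].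
  have dE l : (l < s)%N -> dot w (E l) = 0.
    move=> ls; rewrite /w dotDl dotNl dot_suml (bigD1 (Ordinal ls)) //= dotZl /c divfK.
      rewrite big1 ?addr0 ?subrr // => k; rewrite -val_eqE /= => kl.
      rewrite dotZl; case: (ltngtP k l) kl => // kl _.
        by have [_ _ _ H'] := H l ls; rewrite [dot (E k) (E l)]dotC H' ?mulr0.
      by have [_ _ _ H'] := H k (ltn_ord k); rewrite (H' l kl) mulr0.
    by rewrite dot_eq0; have [] := H l ls.
  split=> //.
  - apply: contraTneq (ind s sr) => w0; rewrite negbK -[v s]opprK -scaleN1r scalemx_sub //.
    by move: wV; rewrite w0 sub0r.
  - rewrite /w [X in _ = _ + X](eq_bigr (fun l : 'I_s => c l *: E l)) ?subrK // => l _.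
    by rewrite ltn_eqF.
  - by move=> l ls; rewrite ltn_eqF // dE.
have [H1 H2 H3 H4] := H i i_s; split=> //.
  rewrite {1}H2; congr (_ + _); apply: eq_bigr => l _.
  by rewrite ltn_eqF // (ltn_trans (ltn_ord l)).
by move=> l li; rewrite ltn_eqF ?H4 // (ltn_trans li).
Qed.

Lemma gram_ext m r (E Z : nat -> 'rV[rat]_m) (L : nat -> nat -> rat) (n : rat) :
  (forall i j, (i < r)%N -> (j < r)%N -> dot (Z i) (Z j) = n * dot (E i) (E j)) ->
  forall i j, (i < r)%N -> (j < r)%N ->
    dot (Z i + \sum_(l < i) L i l *: Z l) (Z j + \sum_(l < j) L j l *: Z l)
    = n * dot (E i + \sum_(l < i) L i l *: E l) (E j + \sum_(l < j) L j l *: E l).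
Proof.
move=> H i j ir jr; rewrite !dotDl !dotDr !dot_suml !dot_sumr !mulrDr H //.
rewrite !mulr_sumr; congr (_ + _ + (_ + _)); apply: eq_bigr => l _.
- by rewrite !dotZr H ?(ltn_trans (ltn_ord l)) // mulrCA.
- by rewrite !dotZl H ?(ltn_trans (ltn_ord l)) // mulrCA.
rewrite !dotZl !dot_sumr !mulr_sumr; apply: eq_bigr => k _.
by rewrite !dotZr H ?(ltn_trans (ltn_ord l)) ?(ltn_trans (ltn_ord k)) //; ring.
Qed.

(** [scaled_frames] scales the Gram-Schmidt frame of [v], and the same triangular coefficients turn
    the result into a scaled copy of [v]. It lies in the complement of the [E i] and [e], a space
    independent of [n], so one [q] serves for all [n]. *)
Theorem scaled_copies m r (v : nat -> 'rV[int]_m) : m = (2 * r + 5)%N ->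
  (forall i, (i < r)%N -> ~~ (iv (v i) <= \sum_(l < i) <<iv (v l)>>)%MS) ->
  exists (E : nat -> 'rV[rat]_m) (e : 'rV[rat]_m) (q : nat), [/\ e != 0, (0 < q)%N,
    (forall i, (i < r)%N -> [/\ dot (E i) (iv (v i)) != 0,
       forall j, (j < i)%N -> dot (E i) (iv (v j)) = 0, dot e (E i) = 0 & dot e (iv (v i)) = 0]) &
    forall n : nat, (0 < n)%N -> exists a : nat -> 'rV[int]_m,
      (forall i j, (i < r)%N -> (j < r)%N -> dot (a i) (a j) = (q ^ 2 * n)%:Z * dot (v i) (v j)) /\
      forall i j, (i < r)%N -> (j < r)%N -> [/\ dot (iv (a i)) e = 0, dot (iv (a i)) (E j) = 0 &
        dot (a i) (v j) = 0]].
Proof.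
move=> mr ind; have [E [L H]] := gram_schmidt ind.
pose Es := [seq E i | i <- iota 0 r]; pose g := [seq dot x x | x <- Es].
have szE : size Es = r by rewrite size_map size_iota.
have nE i : (i < r)%N -> nth 0 Es i = E i by move=> ir; rewrite (nth_map 0%N) ?size_iota // nth_iota.
have orth i j : (i < r)%N -> (j < r)%N -> i != j -> dot (E i) (E j) = 0.
  move=> ir jr; case: ltngtP => // ij _.
    by have [_ _ H'] := H j jr; rewrite dotC H'.
  by have [_ _ H'] := H i ir; rewrite H'.
have frE : fr Es g.
  rewrite /fr /has_norms eqxx andbT; apply/(pairwiseP 0) => i j; rewrite !inE szE => ir jr ij.
  by apply/perpP; rewrite !nE // orth // ltn_eqF.
have g0 : all (fun x => 0 < x) g.
  rewrite /g /Es -map_comp all_map; apply/allP => i; rewrite mem_iota => /= ir.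
  by rewrite dot_gt0; have [] := H i ir.
have [|e [e0 /allP Ee Hn]] := scaled_frames _ g0 frE; first by rewrite size_map szE.
have eE i : (i < r)%N -> dot e (E i) = 0.
  move=> ir; rewrite dotC; apply/perpP; apply: Ee.
  by apply/mapP; exists i => //; rewrite mem_iota.
pose A : 'M[rat]_(r.+1, m) := \matrix_(i < r.+1) (if (i < r)%N then E i else e).
pose V := kermx A^T.
have VP x : (x <= V)%MS -> dot x e = 0 /\ forall j, (j < r)%N -> dot x (E j) = 0.
  move=> /sub_kermxP xA; have D (i : 'I_r.+1) : dot x (if (i < r)%N then E i else e) = 0.
    have := congr1 (fun u : 'rV_r.+1 => u ord0 i) xA; rewrite !mxE; apply: etrans.
    by apply: eq_bigr => j _; rewrite !mxE.
  split=> [|j jr]; first by have := D ord_max; rewrite /= ltnn.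
  by have := D (widen_ord (leqnSn r) (Ordinal jr)); rewrite /= jr.
have PV x : dot x e = 0 -> (forall j, (j < r)%N -> dot x (E j) = 0) -> (x <= V)%MS.
  move=> xe xE; apply/sub_kermxP/rowP => i; rewrite !mxE.
  rewrite (_ : \sum_j _ = dot x (if (i < r)%N then E i else e)).
    by case: ifP => ir; rewrite ?xe ?xE.
  by apply: eq_bigr => j _; rewrite !mxE.
have [q q0 Hq] := bounded_denominators V r.
have vE i j : (i < r)%N -> dot (E i) (iv (v j)) = dot (E i) (E j) + \sum_(l < j) L j l * dot (E i) (E l) \/ (r <= j)%N.
  move=> ir; case: (ltnP j r) => jr; [left|by right].
  have [_ -> _] := H j jr; rewrite dotDr dot_sumr; congr (_ + _).
  by apply: eq_bigr => l _; rewrite dotZr.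
exists E, e, q; split=> // [i ir|n n0].
  have [Ei Hv Ho] := H i ir; split=> [|j ji||].
  - have [->|] := vE i i ir; last by rewrite leqNgt ir.
    by rewrite big1 ?addr0 ?dot_eq0 // => l _; rewrite Ho ?mulr0.
  - have [->|] := vE i j ir; last by rewrite leqNgt (ltn_trans ji).
    by rewrite Ho // add0r big1 // => l _; rewrite Ho ?mulr0 // (ltn_trans (ltn_ord l)).
  - exact: eE.
  rewrite Hv dotDr dot_sumr eE // add0r big1 // => l _.
  by rewrite dotZr eE ?mulr0 // (ltn_trans (ltn_ord l)).
have [|Z frZ [/allP Ze /allP ZE]] := Hn n%:R; first by rewrite ltr0n.
have szZ : size Z = r by rewrite (fr_size frZ) !size_map size_iota.
pose z i := nth 0 Z i.
have zZ i : (i < r)%N -> z i \in Z by move=> ir; rewrite mem_nth ?szZ.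
have gz i j : (i < r)%N -> (j < r)%N -> dot (z i) (z j) = n%:R * dot (E i) (E j).
  move=> ir jr; move: frZ => /andP[/(pairwiseP 0) pz /eqP nz].
  have [->|ij] := eqVneq i j.
    have := congr1 (fun s => nth 0 s j) nz.
    by rewrite (nth_map 0) ?szZ // (nth_map 0) ?size_map ?size_iota // (nth_map 0) ?size_map ?size_iota // nE.
  rewrite orth // mulr0; case: (ltngtP i j) ij => // ij _.
    by apply/perpP/pz; rewrite ?inE ?szZ.
  by rewrite dotC; apply/perpP/pz; rewrite ?inE ?szZ.
pose a0 i := z i + \sum_(l < i) L i l *: z l.
have ga i j : (i < r)%N -> (j < r)%N -> dot (a0 i) (a0 j) = n%:R * dot (iv (v i)) (iv (v j)).
  move=> ir jr; rewrite (gram_ext _ gz) //.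
  by have [_ -> _] := H i ir; have [_ -> _] := H j jr.
have aV i : (i < r)%N -> (a0 i <= V)%MS.
  move=> ir; have lz l : (l < r)%N -> (z l <= V)%MS.
    move=> lr; apply: PV => [|j jr]; first by apply/perpP; apply: Ze; apply: zZ.
    rewrite dotC; apply/perpP; apply: (allP (ZE _ (zZ _ lr))).
    by apply/mapP; exists j => //; rewrite mem_iota.
  rewrite addmx_sub ?lz //; apply: summx_sub => l _; apply: scalemx_sub.
  by apply: lz; apply: ltn_trans (ltn_ord l) ir.
have [|i j|y [yV gy]] := Hq (fun i : 'I_r => a0 i); first by move=> i; exact: aV.
  by rewrite ga // dot_iv rpredM ?intr_int ?rpred_nat.
exists (fun i => if insub i is Some i' then y i' else 0).
have yE i (ir : (i < r)%N) : (if insub i is Some i' then y i' else 0) = y (Ordinal ir) by rewrite insubT.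
split=> [i j ir jr|i j ir jr].
  by rewrite !yE; apply/(@intr_inj rat); rewrite -dot_iv gy /= ga // dot_iv !intrM -pmulrn natrM natrX -mulrA.
rewrite yE; have [Ha Hb] := VP _ (yV (Ordinal ir)); split; [exact: Ha|exact: Hb|].
apply/(@intr_inj rat); rewrite -dot_iv; have [_ -> _] := H j jr.
rewrite dotDr dot_sumr Hb // add0r big1 // => l _.
by rewrite dotZr Hb ?mulr0 // (ltn_trans (ltn_ord l)).
Qed.

(** The exponents are powers of 3 because a sum of two of them determines the pair: distinct
    quadratic monomials restrict to distinct powers of the parameter. *)
Definition curve m (s : nat) : 'rV[rat]_m := \row_(i < m) s.+1%:R ^+ (3 ^ i).

Lemma sum_pow3 i j a b : (3 ^ i + 3 ^ j = 3 ^ a + 3 ^ b)%N -> (i = a /\ j = b) \/ (i = b /\ j = a).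
Proof.
have key i' j' a' b' : (i' <= j')%N -> (a' <= b')%N ->
    (3 ^ i' + 3 ^ j' = 3 ^ a' + 3 ^ b')%N -> (j' < b')%N -> False.
  move=> ij ab E jb; have : (3 ^ j'.+1 <= 3 ^ b')%N by rewrite leq_exp2l.
  have : (3 ^ i' <= 3 ^ j')%N by rewrite leq_exp2l.
  have : (0 < 3 ^ a')%N by rewrite expn_gt0.
  by rewrite expnS; lia.
have main i' j' a' b' : (i' <= j')%N -> (a' <= b')%N ->
    (3 ^ i' + 3 ^ j' = 3 ^ a' + 3 ^ b')%N -> i' = a' /\ j' = b'.
  move=> ij ab E; have jb : j' = b'.
    case: (ltngtP j' b') => // jb; first by case: (key _ _ _ _ ij ab E jb).
    by case: (key _ _ _ _ ab ij (esym E) jb).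
  by split=> //; move: E; rewrite jb => /addIn /eqP; rewrite eqn_exp2l // => /eqP.
case: (leqP i j) => ij; case: (leqP a b) => ab E.
- by left; apply: main.
- by right; apply: (main _ _ b a) => //; [exact: ltnW | rewrite E addnC].
- by have [|->->] := main _ _ _ _ (ltnW ij) ab; [rewrite addnC | right].
- by have [|->->] := main _ _ _ _ (ltnW ij) (ltnW ab); [rewrite addnC E addnC | left].
Qed.

(** Up to a nonzero factor the pairing is k |x|^2 - 2 (w.x)(nu.x) on the curve, with k = nu.w, a
    polynomial of degree at most 2 * 3^m. If it vanished, its diagonal coefficients would sum to m k
    = 2 k, so k = 0 as m is not 2, and the other coefficients would then force nu = 0. *)
Lemma few_orthogonal m (w nu : 'rV[rat]_m) M : m != 2%N -> w != 0 -> nu != 0 ->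
  (#|[pred s : 'I_M | dot nu (w *m refl (curve m s)) == 0%R]| <= 2 * 3 ^ m)%N.
Proof.
move=> m2 w0 nu0; pose k := dot nu w.
pose C (i j : 'I_m) := k * (i == j)%:R - 2 * (w 0 i * nu 0 j).
pose P : {poly rat} := \sum_ij C ij.1 ij.2 *: 'X^(3 ^ ij.1 + 3 ^ ij.2).
have PE s : P.[s.+1%:R] = k * dot (curve m s) (curve m s) - 2 * (dot w (curve m s) * dot nu (curve m s)).
  rewrite /P horner_sum (eq_bigr (fun ij => k * ((ij.1 == ij.2)%:R * (curve m s 0 ij.1 * curve m s 0 ij.2))
      - 2 * ((w 0 ij.1 * curve m s 0 ij.1) * (nu 0 ij.2 * curve m s 0 ij.2)))); last first.
    by move=> [i j] _ /=; rewrite hornerZ hornerXn exprD !mxE /C; ring.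
  rewrite sumrB -!mulr_sumr; congr (_ * _ - _ * _).
    rewrite -(pair_bigA _ (fun i j => (i == j)%:R * (curve m s 0 i * curve m s 0 j))) /=.
    apply: eq_bigr => i _; rewrite (bigD1 i) //= eqxx mul1r big1 ?addr0 // => j ji.
    by rewrite eq_sym (negbTE ji) mul0r.
  rewrite -(pair_bigA _ (fun i j => (w 0 i * curve m s 0 i) * (nu 0 j * curve m s 0 j))) /=.
  rewrite /dot mulr_suml; apply: eq_bigr => i _; rewrite mulr_sumr.
  by apply: eq_bigr.
have Pn0 : P != 0.
  apply/eqP => P0; have cE a b : \sum_(ij : 'I_m * 'I_m) C ij.1 ij.2 * (3 ^ a + 3 ^ b == 3 ^ ij.1 + 3 ^ ij.2)%N%:R = 0.
    have := congr1 (fun p : {poly rat} => p`_(3 ^ a + 3 ^ b)) P0.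
    rewrite /= coef0 /P coef_sum => {2}<-; apply: eq_bigr => ij _.
    by rewrite coefZ coefXn.
  have cd (a : 'I_m) : k = 2 * (w 0 a * nu 0 a).
    have := cE a a; rewrite (bigD1 (a, a)) //= eqxx mulr1 big1 ?addr0.
      by rewrite /C eqxx mulr1 => /eqP; rewrite subr_eq0 => /eqP.
    move=> [i j] /= ne; case: eqP => [/sum_pow3 E|]; last by rewrite mulr0.
    by case/eqP: ne; case: E => [] [/val_inj -> /val_inj ->].
  have co (a b : 'I_m) : a != b -> w 0 a * nu 0 b + w 0 b * nu 0 a = 0.
    move=> ab; have := cE a b; rewrite (bigD1 (a, b)) //= eqxx mulr1 (bigD1 (b, a)) /=; last first.
      by rewrite xpair_eqE negb_and eq_sym ab.
    rewrite addnC eqxx mulr1 big1 ?addr0.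
      rewrite /C (negbTE ab) eq_sym (negbTE ab) !mulr0 !sub0r -opprD -mulrDr => /eqP.
      by rewrite oppr_eq0 mulf_eq0 pnatr_eq0 /= => /eqP.
    move=> [i j] /= /andP[n1 n2]; case: eqP => [/sum_pow3 E|]; last by rewrite mulr0.
    by case: E => [] [/val_inj E1 /val_inj E2]; move: n1 n2; rewrite E1 E2 eqxx.
  have k0 : k = 0.
    have : \sum_(a < m) k = \sum_(a < m) 2 * (w 0 a * nu 0 a) by apply: eq_bigr => a _; apply: cd.
    rewrite sumr_const card_ord -mulr_sumr -[\sum_(i < m) _]/(dot w nu) dotC -/k => /eqP.
    rewrite -[k *+ m]mulr_natl -subr_eq0 -mulrBl mulf_eq0 subr_eq0 eqr_nat (negbTE m2) => /= /eqP //.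
  have [i wi] : exists i, w 0 i != 0 by apply/rV0Pn.
  case/eqP: nu0; apply/rowP => j; rewrite mxE.
  have nui : nu 0 i = 0.
    by have /esym/eqP := cd i; rewrite k0 !mulf_eq0 pnatr_eq0 /= (negbTE wi) => /eqP.
  have [<- //|ij] := eqVneq i j.
  by have /eqP := co i j ij; rewrite nui mulr0 addr0 mulf_eq0 (negbTE wi) => /eqP.
have szP : (size P <= (2 * 3 ^ m).+1)%N.
  apply: (leq_trans (size_sum _ _ _)); apply/bigmax_leqP => [[i j] _] /=.
  apply: (leq_trans (size_scale_leq _ _)); rewrite size_polyXn ltnS mul2n -addnn.
  by apply: leq_add; rewrite leq_exp2l // ltnW.
rewrite -ltnS; apply: leq_trans szP.
pose rs := [seq ((s : nat).+1%:R : rat) | s : 'I_M <- enum [pred s : 'I_M | dot nu (w *m refl (curve m s)) == 0]].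
have -> : #|[pred s : 'I_M | dot nu (w *m refl (curve m s)) == 0]| = size rs by rewrite size_map -cardE.
apply: max_poly_roots => //; last first.
  rewrite map_inj_uniq ?enum_uniq // => s t /eqP; rewrite eqr_nat eqSS => /eqP; exact: val_inj.
rewrite /rs all_map; apply/allP => s; rewrite mem_enum inE /= => /eqP.
rewrite rootE PE refl_act dotDr dotNr dotZr -/k.
have x0 : dot (curve m s) (curve m s) != 0.
  rewrite dot_eq0; have [i wi] : exists i, w 0 i != 0 by apply/rV0Pn.
  by apply/rV0Pn; exists i; rewrite mxE expf_neq0 // pnatr_eq0.
move: (dot (curve m s) (curve m s)) (dot w _) (dot nu (curve m s)) x0 => X a b x0 E.
have -> : k * X - 2 * (a * b) = X * (k - 2 * a / X * b) by field.
by rewrite E mulr0.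
Qed.

Section Update.
Variables (r M : nat).
Definition upd (p : {ffun 'I_r -> 'I_M}) (j : nat) (a : 'I_M) : {ffun 'I_r -> 'I_M} :=
  [ffun i : 'I_r => if i == j :> nat then a else p i].

Lemma sum_upd (V : nmodType) (F : {ffun 'I_r -> 'I_M} -> V) (j : 'I_r) :
  \sum_p \sum_a F (upd p j a) = (\sum_p F p) *+ M.
Proof.
rewrite pair_bigA /=.
pose h (x : {ffun 'I_r -> 'I_M} * 'I_M) := (upd x.1 j x.2, x.1 j).
have hK : involutive h.
  move=> [p a]; rewrite /h /=; congr (_, _); last by rewrite ffunE eqxx.
  by apply/ffunP => i; rewrite !ffunE; case: eqP => // /val_inj ->.
rewrite (reindex_inj (inv_inj hK)) /=.
rewrite (eq_bigr (fun x => F x.1)) => [|[p a] _ /=]; last first.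
  congr F; apply/ffunP => i; rewrite !ffunE; case: eqP => // /val_inj -> //.
rewrite -(pair_bigA _ (fun p _ => F p)) /= -sumrMnl.
by apply: eq_bigr => p _; rewrite sumr_const card_ord.
Qed.

Lemma sum_upd_nat (F : {ffun 'I_r -> 'I_M} -> nat) (j : 'I_r) :
  (\sum_p \sum_a F (upd p j a) = (\sum_p F p) * M)%N.
Proof.
have natM (x k : nat) : x *+ k = (x * k)%N by elim: k => [|k IH]; rewrite ?muln0 // mulrS mulnS IH.
by rewrite -natM; exact: (sum_upd F j).
Qed.
End Update.

Definition ivf m (x : 'rV[rat]_m) : 'rV[int]_m := map_mx Num.floor x.
Lemma ivfK m (x : 'rV[rat]_m) : (forall i, x 0 i \is a Num.int) -> iv (ivf x) = x.
Proof. by move=> H; apply/rowP => i; rewrite !mxE floorK. Qed.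

Lemma common_denom (I : finType) (F : I -> rat) :
  exists2 h : nat, (0 < h)%N & forall i, h%:R * F i \is a Num.int.
Proof.
have [d d0 [z Ez]] := clear_denoms (\row_(i < #|I|) F (enum_val i)).
exists d => // i; have := congr1 (fun u : 'rV_ _ => u 0 (enum_rank i)) Ez.
by rewrite !mxE enum_rankK => ->; apply: intr_int.
Qed.

(** Row vectors are multiplied from the left, so the factor of highest index acts first. *)
Fixpoint chain m (F : nat -> 'M[rat]_m) j := if j is i.+1 then F i *m chain F i else 1%:M.

Lemma chain_ext m (F G : nat -> 'M[rat]_m) j : (forall i, (i < j)%N -> F i = G i) -> chain F j = chain G j.
Proof. by elim: j => //= j IH H; rewrite H // IH // => i ij; apply: H; apply: ltnW. Qed.

Lemma chain_orth m (F : nat -> 'M[rat]_m) j (x y : 'rV[rat]_m) :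
  (forall i, (i < j)%N -> F i *m (F i)^T = 1%:M) -> dot (x *m chain F j) (y *m chain F j) = dot x y.
Proof.
elim: j x y => [|j IH] x y H /=; first by rewrite !mulmx1.
by rewrite !mulmxA IH ?dot_orth ?H // => i ij; apply: H; apply: ltnW.
Qed.

Lemma iv_Zn m n (x : 'rV[int]_m) : iv (n%:Z *: x) = n%:R *: iv x.
Proof. by rewrite iv_Z -pmulrn. Qed.

Lemma split_difference m (x a : 'rV[rat]_m) (A B R : 'M[rat]_m) (h q : rat) : a *m A = a *m B ->
  h *: ((a + q *: x) *m (A *m R)) - h *: ((a + q *: x) *m (B *m R)) = (h * q) *: (x *m (A - B) *m R).
Proof.
move=> aAB; rewrite !mulmxA !mulmxDl aAB !scalerDr opprD addrACA subrr add0r.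
by rewrite -!scalemxAl !scalerA mulmxBr mulmxBl scalerBr.
Qed.

Lemma dot_refl m (x w : 'rV[rat]_m) : dot (x *m refl w) x = dot x x - 2 * dot x w ^+ 2 / dot w w.
Proof. by rewrite refl_act dotDl dotNl dotZl [dot w x]dotC expr2 mulrA mulrAC. Qed.

(** The first [r] parameters select reflections and the last one a point of [curve]. The
    construction is triangular: vertex [j] sees parameters 0..j and the last one, and changing
    parameter [j] moves only its [v_j] component. *)
Theorem configurations m r (v : nat -> 'rV[int]_m) M : m = (2 * r + 5)%N ->
  (forall i, (i < r)%N -> ~~ (iv (v i) <= \sum_(l < i) <<iv (v l)>>)%MS) ->
  exists (C0 : nat) (z : nat -> {ffun 'I_r.+1 -> 'I_M} -> 'I_M -> 'I_M -> 'rV[int]_m),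
  [/\ (0 < C0)%N,
    forall j nu, (j < r)%N -> nu != 0 ->
      (M * #|[pred x : {ffun 'I_r.+1 -> 'I_M} * ('I_M * 'I_M) | dot nu (z j x.1 x.2.1 x.2.2) == 0%R]|
       <= (2 * 3 ^ m).+1 * #|{: {ffun 'I_r.+1 -> 'I_M} * ('I_M * 'I_M)}|)%N &
    forall T k : nat, (T ^ 2 <= k)%N -> exists u : nat -> {ffun 'I_r.+1 -> 'I_M} -> nat -> 'rV[int]_m,
      [/\ forall i j p t, (i < r)%N -> (j < r)%N -> (t < T)%N ->
            dot (u i p t) (u j p t) = (C0 ^ 2 * k)%:Z * dot (v i) (v j),
        forall j l p a t, (j < l)%N -> (l < r)%N -> u j (upd p l a) t = u j p t &
        forall j p a a' t, (j < r)%N -> (t < T)%N ->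
          u j (upd p j a') t - u j (upd p j a) t = t%:Z *: z j p a a']].
Proof.
move=> mr ind; have [E [e [q [e0 q0 HE Ha]]]] := scaled_copies mr ind.
pose P := {ffun 'I_r.+1 -> 'I_M}; pose at_ (p : P) i : nat := p (inord i).
(* [w j a] is orthogonal to v_i for i < j and to the scaled vectors, so [rho j a] fixes both. Hence
   all vertices may be thought of as images under one common isometry. *)
pose w j (a : nat) := E j + a.+1%:R *: e; pose rho j a := refl (w j a).
pose W p := chain (fun j => rho j (at_ p j)).
have wv j i a : (j < r)%N -> (i <= j)%N -> dot (iv (v i)) (w j a) = dot (E j) (iv (v i)).
  move=> jr ij; have [_ _ _ ev] := HE i (leq_ltn_trans ij jr).
  by rewrite /w dotDr dotZr dotC [dot _ e]dotC ev mulr0 addr0.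
have ww j a : (j < r)%N -> dot (w j a) (w j a) != 0.
  move=> jr; have [Ev _ _ _] := HE j jr; rewrite dot_eq0; apply: contraNneq Ev => w0.
  by rewrite -(wv j j a) // w0 dot0r.
have wwE j a : (j < r)%N -> dot (w j a) (w j a) = dot (E j) (E j) + a.+1%:R ^+ 2 * dot e e.
  move=> jr; have [_ _ eE _] := HE j jr.
  by rewrite /w dotDl !dotDr !dotZl !dotZr [dot (E j) e]dotC eE; ring.
have rv j i a : (j < r)%N -> (i < j)%N -> iv (v i) *m rho j a = iv (v i).
  move=> jr ij; have [_ Ev _ _] := HE j jr.
  by apply: refl_perp; rewrite wv ?Ev // ltnW.
have Worth p j x y : (j <= r)%N -> dot (x *m W p j) (y *m W p j) = dot x y.
  by move=> jr; apply: chain_orth => i ij; apply: refl_orth; apply: ww; apply: leq_trans jr.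
have W0 p : W p 0 = 1%:M by [].
have WS p j : W p j.+1 = rho j (at_ p j) *m W p j by [].
have m0 : (0 < m)%N by rewrite mr; lia.
have cc s : dot (curve m s) (curve m s) != 0.
  by rewrite dot_eq0; apply/rV0Pn; exists (Ordinal m0); rewrite mxE expf_neq0 // pnatr_eq0.
have atu p l a i : (i <= r)%N -> (l <= r)%N -> at_ (upd p l a) i = if i == l then a : nat else at_ p i.
  by move=> ir lr; rewrite /at_ ffunE inordK //; case: ifP.
have Wext p l a j : (j <= l)%N -> (l <= r)%N -> W (upd p l a) j = W p j.
  move=> jl lr; apply: chain_ext => i ij; have il : (i < l)%N by apply: leq_trans jl.
  by rewrite atu ?ltn_eqF // ltnW // (leq_trans il).
have atr p l a : (l < r)%N -> at_ (upd p l a) r = at_ p r by move=> lr; rewrite atu ?gtn_eqF // ltnW.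
have ats p j a : (j < r)%N -> at_ (upd p j a) j = a by move=> jr; rewrite atu ?eqxx // ltnW.
clearbody W.
(* The products of the [rho] preserve the span of the [E j] and [e]; the reflection in a curve
   point, steered by parameter [r], takes the differences out of it. *)
have [Rm RE] : exists Rm, forall p j, Rm p j = W p j *m refl (curve m (at_ p r)).
  by exists (fun p j => W p j *m refl (curve m (at_ p r))).
have Rorth p j x y : (j <= r)%N -> dot (x *m Rm p j) (y *m Rm p j) = dot x y.
  by move=> jr; rewrite !RE !mulmxA dot_orth ?Worth // refl_orth.
have Rext p l a j : (j <= l)%N -> (l < r)%N -> Rm (upd p l a) j = Rm p j.
  by move=> jl lr; rewrite !RE (Wext _ _ _ _ jl (ltnW lr)) (atr _ _ _ lr).
have RS p j a : (j < r)%N -> Rm (upd p j a) j.+1 = rho j a *m Rm p j.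
  by move=> jr; rewrite !RE WS (ats _ _ _ jr) (Wext _ _ _ _ (leqnn j) (ltnW jr)) (atr _ _ _ jr) mulmxA.
have [h h0 Hh] := common_denom (fun x : P * 'I_r.+1 * 'I_m * 'I_m => Rm x.1.1.1 x.1.1.2 x.1.2 x.2).
have hint (y : 'rV[int]_m) p j i : (j <= r)%N -> (h%:R *: (iv y *m Rm p j)) 0 i \is a Num.int.
  move=> jr; rewrite !mxE mulr_sumr; apply: rpred_sum => k _.
  by rewrite mxE mulrCA rpredM ?intr_int //; exact: (Hh (p, Ordinal (jr : (j < r.+1)%N), k, i)).
pose zq j p (a a' : 'I_M) : 'rV[rat]_m := (h * q)%:R *: (iv (v j) *m (rho j a' - rho j a) *m Rm p j).
have zR j p a a' : (j < r)%N -> zq j p a a' =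
    h%:R *: (iv (q%:Z *: v j) *m Rm (upd p j a') j.+1) - h%:R *: (iv (q%:Z *: v j) *m Rm (upd p j a) j.+1).
  move=> jr; rewrite (RS _ _ _ jr) (RS _ _ _ jr) iv_Zn -[q%:R *: _]add0r split_difference ?mul0mx //.
  by rewrite -natrM.
exists (h * q)%N, (fun j p a a' => ivf (zq j p a a')).
have zK j p a a' : (j < r)%N -> iv (ivf (zq j p a a')) = zq j p a a'.
  by move=> jr; apply: ivfK => i; rewrite zR // mxE [X in _ + X]mxE; apply: rpredB; apply: hint.
(* The inner product of the image with v_j recovers the norm of [w j a], which increases with a
   since e is nonzero. *)
have rinj j (a b : nat) : (j < r)%N -> iv (v j) *m rho j a = iv (v j) *m rho j b -> a = b.
  move=> jr /(congr1 (fun x => dot x (iv (v j)))); rewrite !dot_refl => /addrI/oppr_inj.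
  rewrite !wv //; have [Ev _ _ _] := HE j jr.
  have c2 : 2 * dot (E j) (iv (v j)) ^+ 2 != 0 by rewrite mulf_neq0 // expf_neq0.
  move=> /(mulfI c2)/invr_inj.
  rewrite !wwE // => /addrI /(mulIf _); rewrite dot_eq0 e0 => /(_ isT) /eqP.
  by rewrite eqrXn2 ?ler0n // eqr_nat eqSS => /eqP.
split; first by rewrite muln_gt0 h0.
- move=> j nu jr nu0; have nu0' : iv nu != 0.
    by apply: contraNneq nu0 => E0; apply/eqP/iv_inj; rewrite E0; apply/rowP => i; rewrite !mxE.
  pose bad p a a' : nat := dot nu (ivf (zq j p a a')) == 0.
  have -> : #|[pred x : P * ('I_M * 'I_M) | dot nu (ivf (zq j x.1 x.2.1 x.2.2)) == 0]|
      = (\sum_(aa : 'I_M * 'I_M) \sum_(p : P) bad p aa.1 aa.2)%N.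
    by rewrite exchange_big pair_bigA /= -sum1_card big_mkcond; apply: eq_bigr => x _; rewrite inE /bad; case: eqP.
  (* For a != a' the polynomial bound in the last parameter applies; for a = a' the difference is 0
     and all parameters are bad. The diagonal is a fraction 1/M of all pairs and causes the
     successor in [(2 * 3 ^ m).+1]. *)
  have fewbad (a a' : 'I_M) : (M * \sum_(p : P) bad p a a' <= #|P| * (2 * 3 ^ m + (a == a') * M))%N.
    rewrite mulnC -(sum_upd_nat (fun p => bad p a a') ord_max) -[ord_max : nat]/r.
    rewrite -sum_nat_const; apply: leq_sum => p _.
    case: eqP => [_|aa].
      apply: leq_trans (leq_addl _ _); rewrite mul1n -[X in (_ <= X)%N]muln1 -[X in (_ <= X * _)%N]card_ord -sum_nat_const.
      by apply: leq_sum => s _; rewrite /bad; case: (_ == _).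
    rewrite mul0n addn0; pose u : 'rV[rat]_m := (h * q)%:R *: (iv (v j) *m (rho j a' - rho j a) *m W p j).
    have u0 : u != 0.
      rewrite scaler_eq0 negb_or pnatr_eq0 -lt0n muln_gt0 h0 q0 /= -dot_eq0 Worth ?(ltnW jr) // dot_eq0.
      rewrite mulmxBr subr_eq0; apply/eqP => /(rinj _ _ _ jr) aa'; apply: aa; exact/esym/val_inj.
    have := few_orthogonal M _ u0 nu0'; move=> /(_ (_ : m != 2%N)) => H; apply: leq_trans (H _); last first.
      by rewrite mr; apply/eqP; lia.
    rewrite -sum1_card [X in (_ <= X)%N]big_mkcond; apply: leq_sum => s _; rewrite inE /bad.
    rewrite (_ : (dot nu _ == 0) = (dot (iv nu) (u *m refl (curve m s)) == 0)); first by case: eqP.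
    rewrite -(intr_eq0 rat) -dot_iv zK // /zq RE (Wext _ _ _ _ (ltnW jr) (leqnn r)) atu // eqxx /u.
    by rewrite !mulmxA -scalemxAl.
  rewrite big_distrr /=; apply: (@leq_trans (\sum_(aa : 'I_M * 'I_M) #|P| * (2 * 3 ^ m + (aa.1 == aa.2) * M))%N).
    by apply: leq_sum => aa _; apply: fewbad.
  rewrite -big_distrr big_split /= sum_nat_const !card_prod card_ord.
  rewrite -(pair_bigA _ (fun a b : 'I_M => (a == b) * M)%N) /=.
  rewrite (eq_bigr (fun=> M)) => [|a _]; last first.
    by rewrite (bigD1 a) //= eqxx mul1n big1 ?addn0 // => b /negbTE; rewrite eq_sym => ->.
  by rewrite sum_nat_const card_ord; rewrite -/P -mulnSr mulnA mulnC.
move=> T k Tk.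
have Hn n : exists a : nat -> 'rV[int]_m, (0 < n)%N ->
      (forall i j, (i < r)%N -> (j < r)%N -> dot (a i) (a j) = (q ^ 2 * n)%:Z * dot (v i) (v j)) /\
      forall i j, (i < r)%N -> (j < r)%N -> [/\ dot (iv (a i)) e = 0, dot (iv (a i)) (E j) = 0 &
        dot (a i) (v j) = 0].
  by case: n => [|n]; [exists (fun=> 0) | have [a Ga] := Ha n.+1 isT; exists a].
have [a Ga] := choice Hn.
have kt t : (t < T)%N -> (0 < k - t ^ 2)%N.
  by move=> tT; rewrite subn_gt0; apply: leq_trans Tk; rewrite ltn_exp2r.
(* The two parts are orthogonal, with Gram factors q^2 (k - t^2) and q^2 t^2, adding up to q^2 k. *)
pose b j t := a (k - t ^ 2)%N j + (t * q)%:Z *: v j.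
pose uq j p t := h%:R *: (iv (b j t) *m Rm p j.+1).
have uK j p t : (j < r)%N -> iv (ivf (uq j p t)) = uq j p t.
  by move=> jr; apply: ivfK => i; apply: hint.
have ar i j n s : (0 < n)%N -> (i < r)%N -> (j < r)%N -> iv (a n i) *m rho j s = iv (a n i).
  move=> n0 ir jr; have [_ /(_ i j ir jr)[ae aE _]] := Ga n n0.
  by apply: refl_perp; rewrite /w dotDr dotZr ae aE mulr0 addr0.
have bR i j p t : (t < T)%N -> (i <= j)%N -> (j < r)%N -> iv (b i t) *m Rm p j.+1 = iv (b i t) *m Rm p i.+1.
  move=> tT; rewrite !RE; elim: j => [|j IH]; first by rewrite leqn0 => /eqP ->.
  rewrite leq_eqVlt => /predU1P[-> //|]; rewrite ltnS => ij jr; rewrite -IH ?(ltnW jr) //.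
  rewrite WS !mulmxA; congr (_ *m _ *m _); rewrite /b iv_D iv_Z mulmxDl -scalemxAl ar ?kt //.
    by rewrite rv.
  exact: leq_ltn_trans (ltnW jr).
exists (fun j p t => ivf (uq j p t)); split.
- move=> i j p t ir jr tT; apply/(@intr_inj rat); rewrite -dot_iv !uK // /uq dotZl dotZr.
  have [l [lr il jl]] : exists l, [/\ (l < r)%N, (i <= l)%N & (j <= l)%N].
    by exists (maxn i j); rewrite gtn_max ir jr leq_maxl leq_maxr.
  rewrite -(bR i l) // -(bR j l) // Rorth // dot_iv /b.
  have [Ga1 Ga2] := Ga _ (kt t tT).
  rewrite dotDl !dotDr !dotZl !dotZr Ga1 //; have [_ _ ->] := Ga2 i j ir jr.
  rewrite [dot (v i) (a _ j)]dotC; have [_ _ ->] := Ga2 j i jr ir.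
  rewrite !mulr0 addr0 add0r (_ : h%:R = h%:Z%:~R) // -!intrM; congr (_%:~R).
  have /subnK : (t ^ 2 <= k)%N by have := kt t tT; lia.
  move: (k - t ^ 2)%N => n <-; rewrite !expnS !expn0 !muln1 !(PoszM, PoszD).
  by move: (dot _ _) => V; ring.
- move=> j l p c t jl lr; congr ivf; rewrite /uq Rext //.
move=> j p c c' t jr tT; apply: iv_inj; rewrite iv_B iv_Z !uK // zK // /uq.
rewrite (RS _ _ _ jr) (RS _ _ _ jr) /b iv_D iv_Zn split_difference ?ar ?kt // /zq scalerA.
by rewrite -pmulrn -!natrM; congr (_%:R *: _); lia.
Qed.

(** * Averages over finite abelian groups *)

Section Avg.
Variable R : realFieldType.
Definition avg (I : finType) (F : I -> R) : R := (\sum_i F i) / #|I|%:R.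
Implicit Types I J : finType.

Lemma eq_avg I (F G : I -> R) : F =1 G -> avg F = avg G.
Proof. by move=> E; rewrite /avg (eq_bigr G). Qed.
Lemma avgD I (F G : I -> R) : avg (fun i => F i + G i) = avg F + avg G.
Proof. by rewrite /avg big_split mulrDl. Qed.
Lemma avgN I (F : I -> R) : avg (fun i => - F i) = - avg F.
Proof. by rewrite /avg sumrN mulNr. Qed.
Lemma avgB I (F G : I -> R) : avg (fun i => F i - G i) = avg F - avg G.
Proof. by rewrite avgD avgN. Qed.
Lemma avgZl I c (F : I -> R) : avg (fun i => c * F i) = c * avg F.
Proof. by rewrite /avg -mulr_sumr mulrA. Qed.
Lemma avgZr I c (F : I -> R) : avg (fun i => F i * c) = avg F * c.
Proof. by rewrite /avg -mulr_suml mulrAC. Qed.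
Lemma avg_le I (F G : I -> R) : (forall i, F i <= G i) -> avg F <= avg G.
Proof. by move=> H; rewrite /avg ler_wpM2r ?invr_ge0 ?ler0n // ler_sum. Qed.
Lemma avg_ge0 I (F : I -> R) : (forall i, 0 <= F i) -> 0 <= avg F.
Proof. by move=> H; rewrite /avg divr_ge0 ?ler0n // sumr_ge0. Qed.
Lemma avg_const I c : (0 < #|I|)%N -> avg (fun _ : I => c) = c.
Proof. by move=> I0; rewrite /avg sumr_const -[c *+ _]mulr_natr mulfK // pnatr_eq0 -lt0n. Qed.
Lemma avg_le_const I c (F : I -> R) : 0 <= c -> (forall i, F i <= c) -> avg F <= c.
Proof.
move=> c0 H; have [I0|I0] := posnP #|I|; first by rewrite /avg I0 invr0 mulr0.
by rewrite -[leRHS](avg_const c I0); apply: avg_le.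
Qed.
Lemma avg_norm I (F : I -> R) : `|avg F| <= avg (fun i => `|F i|).
Proof.
rewrite /avg normrM normfV normr_nat ler_wpM2r ?invr_ge0 ?ler0n //.
exact: ler_norm_sum.
Qed.
Lemma avg_norm_le I c (F : I -> R) : 0 <= c -> (forall i, `|F i| <= c) -> `|avg F| <= c.
Proof. by move=> c0 H; apply: le_trans (avg_norm F) _; apply: avg_le_const. Qed.
Lemma avgC I J (F : I -> J -> R) : avg (fun i => avg (F i)) = avg (fun j => avg (fun i => F i j)).
Proof. by rewrite /avg -!mulr_suml exchange_big /= mulrAC. Qed.
Lemma avg_pair I J (F : I * J -> R) : avg F = avg (fun i => avg (fun j => F (i, j))).
Proof.
rewrite /avg -mulr_suml pair_bigA /= card_prod natrM invfM mulrA mulrAC.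
by congr (_ / _ / _); apply: eq_bigr => -[].
Qed.
Lemma avg_sqr I (F : I -> R) : (avg F) ^+ 2 <= avg (fun i => F i ^+ 2).
Proof.
have [I0|I0] := posnP #|I|; first by rewrite /avg I0 invr0 !mulr0 expr0n.
set s := avg F; rewrite -subr_ge0.
have -> : avg (fun i => F i ^+ 2) - s ^+ 2 = avg (fun i => (F i - s) ^+ 2).
  rewrite [RHS](eq_avg (G := fun i => (F i ^+ 2 - (2 * s) * F i) + s ^+ 2)); last by move=> i; ring.
  by rewrite avgD avgB avgZl avg_const // -/s; ring.
by apply: avg_ge0 => i; apply: sqr_ge0.
Qed.
(** The power function lies above its tangent at s; averaging with s the mean gives [avg_pow]. *)
Lemma tangent_pow (a s : R) e : 0 <= a -> 0 <= s -> s ^+ e.+1 + e.+1%:R * s ^+ e * (a - s) <= a ^+ e.+1.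
Proof.
move=> a0 s0; elim: e => [|e IH]; first by rewrite !expr1 expr0; lra.
rewrite [leRHS]exprS; apply: le_trans (ler_wpM2l a0 IH); rewrite -subr_ge0.
have -> : a * (s ^+ e.+1 + e.+1%:R * s ^+ e * (a - s)) - (s ^+ e.+2 + e.+2%:R * s ^+ e.+1 * (a - s))
   = e.+1%:R * s ^+ e * (a - s) ^+ 2.
  by rewrite !exprS -[e.+2]addn1 natrD; ring.
by apply: mulr_ge0; rewrite ?sqr_ge0 // mulr_ge0 ?ler0n ?exprn_ge0.
Qed.
Lemma avg_pow I (F : I -> R) e : (forall i, 0 <= F i) -> (avg F) ^+ e.+1 <= avg (fun i => F i ^+ e.+1).
Proof.
move=> F0; have [I0|I0] := posnP #|I|; first by rewrite /avg I0 invr0 !mulr0 expr0n.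
set s := avg F; have s0 : 0 <= s by apply: avg_ge0.
apply: le_trans (avg_le (fun i => tangent_pow e (F0 i) s0)).
by rewrite avgD avg_const // avgZl avgB avg_const // subrr mulr0 addr0.
Qed.
Lemma avg_upd r M (F : {ffun 'I_r -> 'I_M} -> R) (j : 'I_r) :
  (0 < M)%N -> avg F = avg (fun p => avg (fun a => F (upd p j a))).
Proof.
move=> M0; rewrite {2}/avg /avg -mulr_suml sum_upd -[(\sum_p F p) *+ M]mulr_natr card_ord.
by rewrite mulfK // pnatr_eq0 -lt0n.
Qed.

(** A unit shift of the window exchanges a single term of the n summands. *)
Lemma window (f : int -> R) n c : (0 < n)%N -> (forall i, `|f i| <= 1) ->
  `|avg (fun t : 'I_n => f (t%:Z + c)) - avg (fun t : 'I_n => f t)| <= 2 / n%:R * `|c|%:~R.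
Proof.
move=> n0 f1; have n0' : 0 < n%:R :> R by rewrite ltr0n.
pose W c := avg (fun t : 'I_n => f (t%:Z + c)).
have step d : `|W (d + 1) - W d| <= 2 / n%:R.
  rewrite /W /avg -mulrBl -sumrB card_ord normrM [ `|_^-1|]gtr0_norm ?invr_gt0 // ler_pM2r ?invr_gt0 //.
  have -> : \sum_(t < n) (f (t%:Z + (d + 1)) - f (t%:Z + d)) = f (n%:Z + d) - f d.
    have E k : \sum_(t < k) (f (t%:Z + (d + 1)) - f (t%:Z + d)) = f (k%:Z + d) - f d.
      elim: k => [|k IH]; first by rewrite big_ord0 add0r subrr.
      rewrite big_ord_recr /= IH; have -> : k%:Z + (d + 1) = k.+1%:Z + d by lia.
      by ring.
    exact: E.
  by apply: le_trans (ler_normB _ _) _; rewrite -[2]/(1 + 1); apply: lerD.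
have natl k d : `|W (d + k%:Z) - W d| <= 2 / n%:R * k%:R.
  elim: k => [|k IH]; first by rewrite addr0 subrr normr0 mulr0.
  have -> : d + k.+1%:Z = d + k%:Z + 1 by lia.
  rewrite (_ : W _ - W d = (W (d + k%:Z + 1) - W (d + k%:Z)) + (W (d + k%:Z) - W d)); last by ring.
  apply: le_trans (ler_normD _ _) _; rewrite -[k.+1%:R]natr1 mulrDr mulr1 addrC.
  exact: lerD.
have -> : avg (fun t : 'I_n => f t) = W 0 by apply: eq_avg => t; rewrite addr0.
rewrite -/(W c); case: (ger0P c) => c0.
  case: c c0 => // k _; rewrite -pmulrn; have := natl k 0; rewrite add0r; exact.
have [k ->] : exists k : nat, c = - k%:Z by exists `|c|%N; lia.
rewrite distrC opprK -pmulrn; have := natl k (- k%:Z); rewrite addNr; exact.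
Qed.
End Avg.

Section Operators.
Variables (R : realFieldType) (T : finZmodType).
Implicit Types (h g : T -> R) (I J : finType).

Lemma avg_shift h s : avg (fun x => h (x + s)) = avg h.
Proof.
rewrite /avg; congr (_ / _); rewrite (reindex_inj (addIr (- s))) /=.
by apply: eq_bigr => x _; rewrite subrK.
Qed.

Lemma cardT : (0 < #|T|)%N. Proof. by apply/card_gt0P; exists 0. Qed.

Definition op I (s : I -> T) h : T -> R := fun x => avg (fun i => h (x + s i)).
Definition norm2 h : R := avg (fun x => h x ^+ 2).
Definition lip (e : R) (z : T) h := forall x, `|h (x + z) - h x| <= e.
Definition cyc z n := op (fun i : 'I_n => z *+ i).

Lemma op_comm I J (s : I -> T) (s' : J -> T) h : op s (op s' h) = op s' (op s h).
Proof.
apply/funext => x; rewrite /op avgC; apply: eq_avg => j; apply: eq_avg => i.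
by rewrite addrAC.
Qed.
Lemma opB I (s : I -> T) h g : op s (fun x => h x - g x) = (fun x => op s h x - op s g x).
Proof. by apply/funext => x; rewrite /op avgB. Qed.
Lemma op_norm I (s : I -> T) h c : 0 <= c -> (forall x, `|h x| <= c) -> forall x, `|op s h x| <= c.
Proof. by move=> c0 H x; apply: avg_norm_le. Qed.
Lemma op_range I (s : I -> T) h : (forall x, 0 <= h x <= 1) -> forall x, 0 <= op s h x <= 1.
Proof.
move=> H x; apply/andP; split; first by apply: avg_ge0 => i; case/andP: (H (x + s i)).
by apply: avg_le_const => // i; case/andP: (H (x + s i)).
Qed.
Lemma lip_op I (s : I -> T) h e z : 0 <= e -> lip e z h -> lip e z (op s h).
Proof.
move=> e0 H x; rewrite /op -avgB; apply: avg_norm_le => // i.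
by rewrite addrAC; apply: H.
Qed.
Lemma lip_mulz h e z c x : 0 <= e -> lip e z h -> `|h (x + z *~ c) - h x| <= e * `|c|%:~R.
Proof.
move=> e0 H; have natl k y : `|h (y + z *+ k) - h y| <= e * k%:R.
  elim: k => [|k IH]; first by rewrite mulr0n addr0 subrr normr0 mulr0.
  rewrite mulrSr addrA (_ : _ - _ = (h (y + z *+ k + z) - h (y + z *+ k)) + (h (y + z *+ k) - h y)); last by ring.
  apply: le_trans (ler_normD _ _) _; rewrite -[k.+1%:R]natr1 mulrDr mulr1 addrC.
  exact: lerD.
case: c => k; first by rewrite -pmulrn; apply: natl.
rewrite NegzE mulrNz -pmulrn normrN /= -pmulrn distrC.
by have := natl k.+1 (x - z *+ k.+1); rewrite subrK.
Qed.
Lemma lip_sum I (z : I -> T) (c : I -> int) h e x : 0 <= e -> (forall i, lip e (z i) h) ->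
  `|h (x + \sum_i z i *~ c i) - h x| <= e * (\sum_i `|c i|)%:~R.
Proof.
move=> e0 H; elim: (index_enum I) x => [|i s IH] x; first by rewrite !big_nil addr0 subrr normr0 mulr0.
rewrite !big_cons addrA intrD mulrDr.
rewrite (_ : _ - _ = (h (x + z i *~ c i + \sum_(j <- s) z j *~ c j) - h (x + z i *~ c i)) + (h (x + z i *~ c i) - h x)); last by ring.
by apply: le_trans (ler_normD _ _) _; rewrite addrC; apply: lerD; [exact: lip_mulz | exact: IH].
Qed.
Lemma lip_cyc h z n : (0 < n)%N -> (forall x, `|h x| <= 1) -> lip (2 / n%:R) z (cyc z n h).
Proof.
move=> n0 h1 x; have := @window R (fun t => h (x + z *~ t)) n 1 n0.
rewrite normr1 mulr1 => /(_ (fun=> h1 _)); apply: le_trans; rewrite le_eqVlt; apply/orP; left; apply/eqP.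
congr `|_ - _|; apply: eq_avg => t; rewrite -?pmulrn //.
by rewrite addn1 mulrS addrA.
Qed.

Lemma norm2_op I (s : I -> T) h : norm2 (op s h) <= norm2 h.
Proof.
rewrite /norm2 /op; apply: le_trans (avg_le (fun x => avg_sqr _)) _; rewrite avgC.
apply: avg_le_const; first by apply: avg_ge0 => x; apply: sqr_ge0.
by move=> i; rewrite (avg_shift (fun x => h x ^+ 2)).
Qed.
Lemma op_adj I (s : I -> T) h g :
  avg (fun x => op s h x * g x) = avg (fun x => h x * op (fun i => - s i) g x).
Proof.
rewrite (eq_avg (G := fun x => avg (fun i => h (x + s i) * g x))); last by move=> x; rewrite avgZr.
rewrite [RHS](eq_avg (G := fun x => avg (fun i => h x * g (x - s i)))); last by move=> x; rewrite avgZl.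
rewrite avgC [RHS]avgC; apply: eq_avg => i.
by rewrite -(avg_shift (fun x => h x * g (x - s i)) (s i)); apply: eq_avg => x; rewrite addrK.
Qed.
(** Translation averages commute, so adjoints can be moved across until both sides carry the same
    function. *)
Lemma norm2_op2 I J (s : I -> T) (s' : J -> T) h :
  avg (fun x => op (fun i => - s i) (op s h) x * op (fun i => - s' i) (op s' h) x) = norm2 (op s' (op s h)).
Proof.
rewrite op_adj (_ : (fun i => - - s i) = s); last by apply/funext => i; rewrite opprK.
rewrite [op s (op _ (op s' h))]op_comm [op s (op s' h)]op_comm -op_adj /norm2.
by apply: eq_avg => x; rewrite expr2.
Qed.
Lemma sqr_le1 (a : R) : `|a| <= 1 -> a ^+ 2 <= 1.
Proof. by move=> H; rewrite -real_normK ?num_real // expr_le1. Qed.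
Lemma norm2_le1 h : (forall x, `|h x| <= 1) -> norm2 h <= 1.
Proof. by move=> H; apply: avg_le_const => // x; apply: sqr_le1. Qed.
Lemma norm2_ge0 h : 0 <= norm2 h.
Proof. by apply: avg_ge0 => x; apply: sqr_ge0. Qed.

Section Spread.
Variables (I : finType) (Z : I -> T) (n : nat).
Hypothesis n0 : (0 < n)%N.
Let C i := @cyc (Z i) n.

(** The mean of the squared norm after [k] successive progression averages in independently chosen
    directions. *)
Fixpoint energy k h : R := if k is k'.+1 then avg (fun i => energy k' (C i h)) else norm2 h.

Lemma energy_ge0 k h : 0 <= energy k h.
Proof. by elim: k h => [|k IH] h /=; [exact: norm2_ge0 | apply: avg_ge0]. Qed.
Lemma energy_le1 k h : (forall x, `|h x| <= 1) -> energy k h <= 1.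
Proof.
elim: k h => [|k IH] h h1 /=; first exact: norm2_le1.
by apply: avg_le_const => // i; apply: IH; apply: op_norm.
Qed.
(** The mean of |C_i h|^2 is the inner product of h with the mean of A_i h, where A_i is the adjoint
    of C_i composed with C_i. By Cauchy-Schwarz its square is at most the mean of the products (A_i
    h)(A_j h), which [norm2_op2] identifies with the next energy. *)
Lemma energy_sqr k h : (forall x, `|h x| <= 1) -> (energy k.+1 h) ^+ 2 <= energy k.+2 h.
Proof.
elim: k h => [|k IH] h h1; last first.
  rewrite -[energy k.+2 h]/(avg _); apply: le_trans (avg_sqr _) _.
  by apply: avg_le => i; apply: IH; apply: op_norm.
rewrite /=; pose s i (j : 'I_n) := Z i *+ j; pose A i := op (fun j => - s i j) (op (s i) h).
have -> : avg (fun i => norm2 (C i h)) = avg (fun x => h x * avg (fun i => A i x)).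
  rewrite [RHS](eq_avg (G := fun x => avg (fun i => h x * A i x))); last by move=> x; rewrite avgZl.
  rewrite avgC; apply: eq_avg => i; rewrite /A -op_adj.
  by apply: eq_avg => x; rewrite expr2.
apply: le_trans (avg_sqr _) _; apply: (@le_trans _ _ (avg (fun x => avg (fun i => A i x) ^+ 2))).
  apply: avg_le => x; rewrite exprMn ler_piMl ?sqr_ge0 //.
  exact: sqr_le1.
rewrite (eq_avg (G := fun x => avg (fun i => avg (fun j => A i x * A j x)))); last first.
  move=> x; rewrite expr2 -avgZr; apply: eq_avg => i; by rewrite avgZl.
rewrite le_eqVlt; apply/orP; left; apply/eqP.
rewrite avgC; apply: eq_avg => i; rewrite avgC; apply: eq_avg => j.
exact: norm2_op2.
Qed.
Lemma energy_pow k h : (forall x, `|h x| <= 1) -> (energy 1 h) ^+ (2 ^ k) <= energy k.+1 h.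
Proof.
move=> h1; elim: k => [|k IH]; first by rewrite expn0 expr1.
rewrite expnSr exprM; apply: le_trans (energy_sqr _ h1).
by rewrite ler_sqr ?nnegrE ?energy_ge0 // exprn_ge0 // energy_ge0.
Qed.

(* Averaging the correlations over t, s and s' of the shifts t + s' - s. *)
Lemma correlation i n' h : (0 < n')%N -> (forall x, `|h x| <= 1) ->
  avg (fun t : 'I_n' => avg (fun x => h x * h (x + Z i *+ t))) <= norm2 (C i h) + 2 * n%:R / n'%:R.
Proof.
move=> n'0 h1; pose psi (c : int) := avg (fun x => h x * h (x + Z i *~ c)).
have psi1 c : `|psi c| <= 1 by apply: avg_norm_le => // x; rewrite normrM mulr_ile1.
have E t : avg (fun x => C i h x * C i h (x + Z i *+ t)) = avg (fun s : 'I_n => avg (fun s' : 'I_n => psi (t%:Z + (s'%:Z - s%:Z)))).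
  rewrite (eq_avg (G := fun x => avg (fun s : 'I_n => avg (fun s' : 'I_n => h (x + Z i *+ s) * h (x + Z i *+ t + Z i *+ s'))))); last first.
    by move=> x; rewrite -avgZr; apply: eq_avg => s; rewrite avgZl.
  rewrite avgC; apply: eq_avg => s; rewrite avgC; apply: eq_avg => s'.
  rewrite -(avg_shift _ (- (Z i *+ s))) /psi; apply: eq_avg => x; rewrite subrK; congr (_ * h _).
  by rewrite !mulrzDr mulrNz -!pmulrn -!addrA; congr (x + _); rewrite addrC -addrA.
have H1 : avg (fun t : 'I_n' => avg (fun x => C i h x * C i h (x + Z i *+ t))) <= norm2 (C i h).
  apply: avg_le_const; first exact: norm2_ge0.
  move=> t; set f := C i h.
  apply: (@le_trans _ _ (avg (fun x => 2^-1 * (f x ^+ 2) + 2^-1 * (f (x + Z i *+ t) ^+ 2)))).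
    apply: avg_le => x; have := sqr_ge0 (f x - f (x + Z i *+ t)).
    by move: (f x) (f _) => a b; nra.
  rewrite avgD !avgZl (avg_shift (fun x => f x ^+ 2)) /norm2; lra.
rewrite -lerBlDr; apply: le_trans H1.
rewrite [leRHS](eq_avg (fun t : 'I_n' => E t)) [leRHS]avgC -[leLHS](@avg_const R 'I_n) ?card_ord //; apply: avg_le => s.
rewrite [leRHS]avgC -[leLHS](@avg_const R 'I_n) ?card_ord //; apply: avg_le => s'.
have := @window R psi n' (s'%:Z - s%:Z) n'0 psi1; rewrite ler_distl => /andP[+ _].
apply: le_trans; rewrite lerD2l lerN2 [leRHS]mulrAC ler_wpM2l ?divr_ge0 ?ler0n //.
rewrite (_ : n%:R = n%:Z%:~R) // ler_int.
by have := ltn_ord s; have := ltn_ord s'; lia.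
Qed.
End Spread.
End Operators.

(** * Energy of box averages *)

Definition rowof m L (y : {ffun 'I_m -> 'I_L}) : 'rV[int]_m := \row_i (y i : nat)%:Z.
Definition l1 m (v : 'rV[int]_m) : int := \sum_l `|v 0 l|.

Lemma l1_rowof m L (y : {ffun 'I_m -> 'I_L}) k : l1 (k%:Z *: rowof y) <= (m * (k * L))%:Z.
Proof.
apply: (@le_trans _ _ (\sum_(l < m) (k * L)%:Z)); last first.
  by rewrite sumr_const card_ord -mulr_natr PoszM mulrC natz.
apply: ler_sum => l _; rewrite !mxE -PoszM ger0_norm // lez_nat leq_mul2l.
by rewrite (ltnW (ltn_ord _)) orbT.
Qed.

Section Boxes.
Variables (R : realFieldType) (T : finZmodType) (m : nat) (phi : 'rV[int]_m -> T).
Hypothesis phiD : {morph phi : x y / x + y}.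

Lemma phi0 : phi 0 = 0.
Proof. by apply: (addrI (phi 0)); rewrite -phiD !addr0. Qed.
Lemma phiN x : phi (- x) = - phi x.
Proof. by apply: (addrI (phi x)); rewrite -phiD !subrr phi0. Qed.
Lemma phiMz c x : phi (c *: x) = phi x *~ c.
Proof.
have natl n : phi (n%:Z *: x) = phi x *+ n.
  elim: n => [|n IH]; first by rewrite scale0r phi0.
  have -> : n.+1%:Z = n%:Z + 1 by lia.
  by rewrite scalerDl phiD IH scale1r mulrSr.
by case: c => n; rewrite ?natl // NegzE scaleNr phiN natl mulrNz.
Qed.
Lemma phi_sum (I : finType) (F : I -> 'rV[int]_m) : phi (\sum_i F i) = \sum_i phi (F i).
Proof. exact: (big_morph phi phiD phi0). Qed.

Definition box q L := @op R T _ (fun y : {ffun 'I_m -> 'I_L} => phi (q%:Z *: rowof y)).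

(** Singling out coordinate [l] of the cube writes the box average as a mean of translates of
    [cyc z L h]. *)
Lemma lip_box q L (h : T -> R) l : (0 < L)%N -> (forall x, `|h x| <= 1) ->
  lip (2 / L%:R) (phi (q%:Z *: delta_mx 0 l)) (box q L h).
Proof.
move=> L0 h1 x; set z := phi _.
have E x' : box q L h x' = avg (fun y : {ffun 'I_m -> 'I_L} =>
    cyc z L h (x' + phi (q%:Z *: (rowof y - (y l : nat)%:Z *: delta_mx 0 l)))).
  rewrite /box /op (avg_upd _ l) //; apply: eq_avg => y; apply: eq_avg => a; congr h.
  rewrite -addrA; congr (_ + _); rewrite [z *+ a]pmulrn -phiMz -phiD scalerA mulrC -scalerA -scalerDr.
  congr (phi (_ *: _)); apply/rowP => i; rewrite !mxE eqxx ffunE /=.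
  rewrite -[i == l :> nat]/(i == l); have [->|il] := eqVneq i l; first by rewrite !mulr1 subrr add0r.
  by rewrite !mulr0 subr0 addr0.
rewrite !E -avgB; apply: avg_norm_le => [|y]; first by rewrite divr_ge0 ?ler0n.
by rewrite addrAC; apply: lip_cyc.
Qed.

Lemma box_near q L (h : T -> R) v x : (0 < L)%N -> (forall x, `|h x| <= 1) ->
  `|box q L h (x + phi (q%:Z *: v)) - box q L h x| <= 2 / L%:R * (l1 v)%:~R.
Proof.
move=> L0 h1.
have -> : phi (q%:Z *: v) = \sum_l phi (q%:Z *: delta_mx 0 l) *~ v 0 l.
  rewrite {1}[v]row_sum_delta scaler_sumr phi_sum; apply: eq_bigr => l _.
  by rewrite scalerA mulrC -scalerA phiMz.
apply: lip_sum => [|l]; first by rewrite divr_ge0 ?ler0n.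
exact: lip_box.
Qed.

Lemma op_near (I : finType) (s : I -> T) (h : T -> R) e x : (0 < #|I|)%N ->
  (forall i, `|h (x + s i) - h x| <= e) -> `|op s h x - h x| <= e.
Proof.
move=> I0 H; rewrite /op -[h x in X in `|X|](avg_const (h x) I0) -avgB.
apply: avg_norm_le => //; case/card_gt0P: I0 => i _.
by apply: le_trans (H i).
Qed.

Lemma card_box L : (0 < L)%N -> (0 < #|{ffun 'I_m -> 'I_L}|)%N.
Proof. by move=> L0; rewrite card_ffun !card_ord expn_gt0 L0. Qed.

Lemma avg_digits n k (F : {ffun 'I_m -> 'I_(n * k)} -> R) G : (0 < k)%N ->
  (forall (y : {ffun 'I_m -> 'I_(n * k)}) (a : {ffun 'I_m -> 'I_n}) (b : {ffun 'I_m -> 'I_k}),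
    (forall i, y i = (a i * k + b i)%N :> nat) -> F y = G a b) ->
  avg F = avg (fun a : {ffun 'I_m -> 'I_n} => avg (fun b : {ffun 'I_m -> 'I_k} => G a b)).
Proof.
move=> k0 H.
have lt (a : 'I_n) (b : 'I_k) : (a * k + b < n * k)%N.
  by apply: (@leq_trans (a.+1 * k)); rewrite ?leq_mul2r ?ltn_ord ?orbT // mulSn addnC ltn_add2r.
pose f (x : {ffun 'I_m -> 'I_n} * {ffun 'I_m -> 'I_k}) := [ffun i => Ordinal (lt (x.1 i) (x.2 i))].
have ltd (y : 'I_(n * k)) : (y %/ k < n)%N by rewrite ltn_divLR.
have ltm (y : 'I_(n * k)) : (y %% k < k)%N by rewrite ltn_mod.
pose g (y : {ffun 'I_m -> 'I_(n * k)}) := ([ffun i => Ordinal (ltd (y i))], [ffun i => Ordinal (ltm (y i))]).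
have fg : cancel g f by move=> y; apply/ffunP => i; apply: val_inj; rewrite !ffunE /= -divn_eq.
have gf : cancel f g.
  move=> [a b]; congr (_, _); apply/ffunP => i; apply: val_inj; rewrite !ffunE /=.
    by rewrite divnMDl // divn_small ?addn0.
  by rewrite modnMDl modn_small.
rewrite -[RHS](avg_pair (fun x => G x.1 x.2)) /avg (reindex f) /=; last by exists g => ? _.
congr (_ / _%:R); last by rewrite card_prod !card_ffun !card_ord expnMn.
by apply: eq_bigr => -[a b] _; apply: H => i; rewrite ffunE.
Qed.

Lemma box_split q n k (h : T -> R) : (0 < k)%N -> box q (n * k) h = box (q * k) n (box q k h).
Proof.
move=> k0; apply/funext => x; rewrite /box /op; apply: avg_digits => // y a b E.
congr h; rewrite -addrA -phiD; congr (_ + phi _).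
by apply/rowP => i; rewrite !mxE E PoszD !PoszM; ring.
Qed.

Lemma box_refine q D l k (h : T -> R) : (0 < D)%N -> (0 < l)%N ->
  box q (k * l * D) h = box (q * D * l) k (box q D (box (q * D) l h)).
Proof.
by move=> D0 l0; rewrite box_split // box_split //; congr (box _ _ _); apply: op_comm.
Qed.

Lemma op_ge0 (I : finType) (s : I -> T) (h : T -> R) x : (forall x, 0 <= h x) -> 0 <= op s h x.
Proof. by move=> h0; apply: avg_ge0. Qed.

Lemma pow_op (I : finType) (s : I -> T) (h : T -> R) e : (forall x, 0 <= h x) ->
  avg (fun x => op s h x ^+ e.+1) <= avg (fun x => h x ^+ e.+1).
Proof.
move=> h0; apply: (@le_trans _ _ (avg (fun x => avg (fun i => h (x + s i) ^+ e.+1)))).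
  by apply: avg_le => x; apply: avg_pow.
rewrite avgC; apply: avg_le_const => [|i]; first by apply: avg_ge0 => x; rewrite exprn_ge0.
by rewrite (avg_shift (fun x => h x ^+ e.+1)).
Qed.

(** By [box_refine] the larger box average is an average of translates of the smaller one, and
    convexity applies. *)
Lemma box_monotone q D l k (h : T -> R) e : (0 < D)%N -> (0 < l)%N -> (forall x, 0 <= h x) ->
  avg (fun x => box q (k * l * D) h x ^+ e.+1) <= avg (fun x => box (q * D) l h x ^+ e.+1).
Proof.
move=> D0 l0 h0; rewrite box_refine //.
apply: le_trans (pow_op _ _ _) _; first by move=> x; do 2!apply: op_ge0 => ?.
by apply: pow_op => x; apply: op_ge0.
Qed.

Section Energy.
Variables (I : finType) (z : I -> 'rV[int]_m) (K M0 D l B T1 : nat).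
Hypotheses (M00 : (0 < M0)%N) (T10 : (0 < T1)%N) (l0 : (0 < l)%N).
Hypothesis hyper : forall nu, nu != 0 -> (M0 * #|[pred i | dot nu (z i) == 0%R]| <= K * #|I|)%N.
Hypothesis lattice : forall f : 'I_m -> I, \det (\matrix_(i, j) z (f i) 0 j) != 0 ->
  forall y : {ffun 'I_m -> 'I_l}, exists c : 'I_m -> int,
    D%:Z *: rowof y = \sum_i c i *: z (f i) /\ \sum_i `|c i| <= B%:Z.
Let Z i := phi (z i).
Let V (fs : seq I) : 'M[rat]_m := (\sum_(i <- fs) <<iv (z i)>>)%MS.

(** [fs] lists independent directions along which [H] has already been smoothed. Each further
    average adds a direction outside their span unless it is exceptional. After [m] of them, every
    vector D y is a bounded integer combination of [fs], so [H] is close to its box average. *)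
Lemma energy_bound k fs (H : T -> R) : (size fs + k = m)%N -> \rank (V fs) = size fs ->
  (forall x, 0 <= H x <= 1) -> (forall i, i \in fs -> lip (2 / T1%:R) (Z i) H) ->
  energy Z T1 k (fun x => H x - box D l H x) <= k%:R * (K%:R / M0%:R) + (2 / T1%:R * B%:R) ^+ 2.
Proof.
elim: k fs H => [|k IH] fs H.
  rewrite addn0 mul0r add0r /= => szf rkV H01 HL; have szf' : size fs == m by apply/eqP.
  pose f := tnth (Tuple szf'); pose M : 'M[int]_m := \matrix_(i, j) z (f i) 0 j.
  have VM : (V fs <= map_mx intr M)%MS.
    rewrite /V big_seq; apply: (big_ind (fun X => (X <= map_mx intr M)%MS)); first exact: sub0mx.
      by move=> X Y XM YM; rewrite addsmx_sub XM.
    move=> i ifs; rewrite genmxE; have /tnthP[j ->] : i \in Tuple szf' by [].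
    by apply: (eq_row_sub j); apply/rowP => jj; rewrite !mxE.
  have dM : \det M != 0.
    have : (map_mx intr M : 'M[rat]_m) \in unitmx.
      by rewrite -row_full_unit /row_full eqn_leq rank_leq_col /= -{1}szf -rkV mxrankS.
    by rewrite unitmxE det_map_mx unitfE intr_eq0.
  apply: avg_le_const => [|x]; first exact: sqr_ge0.
  rewrite -[(H x - _) ^+ 2]real_normK ?num_real // ler_sqr ?nnegrE ?mulr_ge0 ?invr_ge0 ?ler0n //.
  rewrite distrC; apply: op_near => [|y]; first exact: card_box.
  have [c [-> cB]] := lattice dM y; rewrite phi_sum (eq_bigr (fun i => Z (f i) *~ c i)) => [|i _]; last exact: phiMz.
  apply: (le_trans (lip_sum _ _ _ (e := 2 / T1%:R) _)) => [|i|]; first by rewrite divr_ge0 ?ler0n.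
    by apply: HL; apply: mem_tnth.
  by rewrite ler_wpM2l ?divr_ge0 ?ler0n // (_ : B%:R = B%:Z%:~R) // ler_int.
move=> szf rkV H01 HL; set c := (2 / T1%:R * B%:R) ^+ 2.
have rk : (\rank (V fs) < m)%N by rewrite rkV -szf addnS ltnS leq_addr.
(* A normal to the span of [fs]: directions inside the span are orthogonal to it, and [hyper] bounds
   their proportion by K/M0. *)
have [v vV v0] : exists2 v : 'rV[rat]_m, (v <= kermx (V fs)^T)%MS & v != 0.
  apply/rowV0Pn; rewrite -mxrank_eq0 mxrank_ker mxrank_tr; lia.
have [d d0 [nu Enu]] := clear_denoms v.
have nu0 : nu != 0.
  apply: contraNneq v0 => E0; move: Enu; rewrite E0 => /eqP.
  have -> : iv 0 = 0 :> 'rV_m by apply/rowP => i; rewrite !mxE.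
  by rewrite scaler_eq0 pnatr_eq0 gtn_eqF.
have good i : dot nu (z i) != 0 -> ~~ (iv (z i) <= V fs)%MS.
  apply: contraNN => /submxP[u Eu]; rewrite -(intr_eq0 rat) -dot_iv -Enu dotZl mulf_eq0; apply/orP; right.
  have := dot_mx v (iv (z i)); rewrite Eu trmx_mul mulmxA (sub_kermxP vV) mul0mx -Eu => /esym E1.
  by have := congr1 (fun A : 'M_1 => A 0 0) E1; rewrite !mxE eqxx mulr1n => ->.
rewrite /=; apply: (@le_trans _ _ (avg (fun i => (dot nu (z i) == 0%R)%:R + (k%:R * (K%:R / M0%:R) + c)))).
  apply: avg_le => i; have -> : cyc (Z i) T1 (fun x => H x - box D l H x) = (fun x => cyc (Z i) T1 H x - box D l (cyc (Z i) T1 H) x).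
    by rewrite /cyc opB; apply/funext => x; congr (_ - _); rewrite /box op_comm.
  have H1 := op_range (fun j : 'I_T1 => Z i *+ j) H01.
  have [di|di] := eqVneq (dot nu (z i)) 0; rewrite /= ?add0r.
    (* An exceptional direction is charged the trivial energy bound 1. *)
    apply: (@le_trans _ _ 1); last by rewrite lerDl addr_ge0 ?sqr_ge0 // mulr_ge0 ?divr_ge0 ?ler0n.
    apply: energy_le1 => x; have := H1 x; have := op_range (fun y : {ffun 'I_m -> 'I_l} => phi (D%:Z *: rowof y)) H1 x.
    rewrite -/(cyc _ _) -/(box _ _) => /andP[a0 a1] /andP[b0 b1]; rewrite ler_norml.
    by apply/andP; split; lra.
  apply: (IH (i :: fs)) => //; first by rewrite /= addSnnS.
    rewrite /V big_cons -/(V fs) /= -rkV; apply/eqP; rewrite eqn_leq; apply/andP; split.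
      apply: leq_trans (mxrank_adds_leqif _ _).1 _; rewrite genmxE -[(\rank (V fs)).+1]add1n leq_add2r.
      exact: rank_leq_row.
    apply: rank_ltmx; rewrite /ltmx addsmxSr /=; apply: contra (good i di) => H2.
    by apply: submx_trans H2; apply: submx_trans (addsmxSl _ _); rewrite genmxE.
  move=> j; rewrite inE => /orP[/eqP ->|jf].
    by apply: lip_cyc => // x; have /andP[a0 a1] := H01 x; rewrite ger0_norm.
  by apply: lip_op; [rewrite divr_ge0 ?ler0n | apply: HL].
have [I0|I0] := posnP #|I|.
  by rewrite /avg I0 invr0 mulr0 addr_ge0 ?sqr_ge0 // mulr_ge0 ?divr_ge0 ?ler0n.
rewrite avgD avg_const // addrA lerD2r -natr1 mulrDl mul1r addrC lerD2l.
rewrite /avg -natr_sum -(big_mkcond (fun i => dot nu (z i) == 0)) /= sum1_card.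
rewrite ler_pdivrMr ?ltr0n // mulrAC ler_pdivlMr ?ltr0n // -!natrM ler_nat mulnC.
exact: hyper.
Qed.
End Energy.
End Boxes.

Section UnitInterval.
Variable R : realFieldType.
Definition in01 (a : R) := 0 <= a <= 1.
Lemma in01M a b : in01 a -> in01 b -> in01 (a * b).
Proof. by move=> /andP[a0 a1] /andP[b0 b1]; rewrite /in01 mulr_ge0 //= mulr_ile1. Qed.
Lemma in01_1 : in01 1. Proof. by rewrite /in01 ler01 lexx. Qed.
Lemma in01X a k : in01 a -> in01 (a ^+ k).
Proof. by move=> Ha; elim: k => [|k IH]; rewrite ?exprS; [exact: in01_1 | exact: in01M]. Qed.
Lemma in01_prod (I : Type) (s : seq I) (P : pred I) (F : I -> R) :
  (forall i, in01 (F i)) -> in01 (\prod_(i <- s | P i) F i).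
Proof. by move=> H; apply: (big_ind in01) => //; [exact: in01_1 | exact: in01M]. Qed.
Lemma in01_norm a : in01 a -> `|a| <= 1.
Proof. by move=> /andP[a0 a1]; rewrite ger0_norm. Qed.
Lemma in01B a b : in01 a -> in01 b -> `|a - b| <= 1.
Proof. by move=> /andP[a0 a1] /andP[b0 b1]; rewrite ler_norml; apply/andP; split; lra. Qed.
Lemma pow_lip a b k : in01 a -> in01 b -> `|a ^+ k - b ^+ k| <= k%:R * `|a - b|.
Proof.
move=> Ha Hb; elim: k => [|k IH]; first by rewrite subrr normr0 mul0r.
have -> : a ^+ k.+1 - b ^+ k.+1 = a ^+ k * (a - b) + (a ^+ k - b ^+ k) * b by rewrite !exprSr; ring.
apply: le_trans (ler_normD _ _) _; rewrite !normrM -[k.+1%:R]natr1 mulrDl mul1r addrC.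
apply: lerD.
  by apply: le_trans IH; rewrite ler_piMr // in01_norm.
by rewrite ler_piMl // in01_norm // in01X.
Qed.
Lemma norm_amgm (a e : R) : 0 < e -> `|a| <= e + a ^+ 2 / e.
Proof.
move=> e0; rewrite -[a ^+ 2]real_normK ?num_real //; set c := `|a|.
rewrite -(ler_pM2r e0) mulrDl divfK ?gt_eqF // -subr_ge0.
have -> : e * e + c ^+ 2 - c * e = (c - 2^-1 * e) ^+ 2 + 3 / 4 * e ^+ 2 by field.
by rewrite addr_ge0 ?sqr_ge0 // mulr_ge0 ?sqr_ge0 // divr_ge0.
Qed.
End UnitInterval.

(** * Comparison of copies of one simplex with a power of a box average *)

Section SpectralDescent.
Variables (R : realFieldType) (T : finZmodType) (m' : nat).
Let m := m'.+1.
Variable phi : 'rV[int]_m -> T.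
Hypothesis phiD : {morph phi : x y / x + y}.
Variables (r M0 D l k Mm T0 T1 K B U : nat).
Let Om := {ffun 'I_r.+1 -> 'I_M0}.
Let L1 := (k * l * D)%N.
Variables (z : nat -> Om -> 'I_M0 -> 'I_M0 -> 'rV[int]_m) (u : nat -> Om -> nat -> 'rV[int]_m) (e : R).
Hypotheses (M00 : (0 < M0)%N) (D0 : (0 < D)%N) (l0 : (0 < l)%N) (k0 : (0 < k)%N) (Mm0 : (0 < Mm)%N)
  (T00 : (0 < T0)%N) (T10 : (0 < T1)%N).
Hypothesis hyper : forall j nu, (j < r)%N -> nu != 0 ->
  (M0 * #|[pred x : Om * ('I_M0 * 'I_M0) | dot nu (z j x.1 x.2.1 x.2.2) == 0%R]|
   <= K * #|{: Om * ('I_M0 * 'I_M0)}|)%N.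
Hypothesis lattice : forall j (f : 'I_m -> Om * ('I_M0 * 'I_M0)), (j < r)%N ->
  \det (\matrix_(i, i') z j (f i).1 (f i).2.1 (f i).2.2 0 i') != 0 ->
  forall y : {ffun 'I_m -> 'I_l}, exists c : 'I_m -> int,
    D%:Z *: rowof y = \sum_i c i *: z j (f i).1 (f i).2.1 (f i).2.2 /\ \sum_i `|c i| <= B%:Z.
Hypothesis later : forall j j' p a t, (j < j')%N -> (j' < r)%N -> u j (upd p j' a) t = u j p t.
Hypothesis diff : forall j p a a' t, (j < r)%N -> (t < T0)%N ->
  u j (upd p j a') t - u j (upd p j a) t = t%:Z *: z j p a a'.
Hypothesis size_u : forall j p t, (j < r)%N -> (t < T0)%N -> l1 (u j p t) <= U%:Z.
Hypotheses (e0 : 0 < e) (e1 : e <= 1).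
Hypothesis small_energy : m%:R * (K%:R / M0%:R) + (2 / T1%:R * B%:R) ^+ 2 <= (e ^+ 2 / 2) ^+ (2 ^ m') :> R.
Hypothesis small_T : 2 * T1%:R / T0%:R <= e ^+ 2 / 2 :> R.
Hypothesis small_U : 2 / L1%:R * U%:R <= e :> R.
Hypothesis small_l : 2 / L1%:R * (m * (D * l))%:R <= e :> R.
Hypothesis small_L : 2 / Mm%:R * (m * L1)%:R <= e ^+ 2 :> R.
Variable g : T -> R.
Hypothesis g01 : forall x, in01 (g x).

Let x0 := box phi D l g.
Let b := box phi 1 L1 g.
Let w := box phi 1 Mm g.

Let L10 : (0 < L1)%N. Proof. by rewrite !muln_gt0 k0 l0 D0. Qed.
Let x01 x : in01 (x0 x). Proof. exact: op_range. Qed.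
Let b01 x : in01 (b x). Proof. exact: op_range. Qed.
Let w01 x : in01 (w x). Proof. exact: op_range. Qed.
Let g1 x : `|g x| <= 1. Proof. exact: in01_norm. Qed.

Lemma near1 L v x C : (0 < L)%N -> l1 v <= C%:Z -> `|box phi 1 L g (x + phi v) - box phi 1 L g x| <= 2 / L%:R * C%:R.
Proof.
move=> L0 vC; have := box_near phiD 1 v x L0 g1; rewrite scale1r => H; apply: le_trans H _.
by rewrite ler_wpM2l ?divr_ge0 ?ler0n // (_ : C%:R = C%:Z%:~R) // ler_int.
Qed.

(** Parallelogram law for the mean h of [x0] and [b]: averaging h over the largest box gives almost
    [w], so |h|^2 cannot be much below |w|^2, while |b|^2 is at most |x0|^2. *)
Lemma stable_gap : norm2 (fun x => x0 x - b x) <= 4 * (norm2 x0 - norm2 w) + 8 * e ^+ 2.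
Proof.
have bx : norm2 b <= norm2 x0.
  by have := @box_monotone R T m phi phiD 1 D l k g 1 D0 l0 (fun x => (andP (g01 x)).1); rewrite mul1n.
pose h x := (x0 x + b x) / 2; pose v := box phi 1 Mm h.
have vw x : `|v x - w x| <= e ^+ 2.
  have -> : v x = (box phi D l w x + box phi 1 L1 w x) / 2.
    rewrite /v /h {1}/box /op avgZr avgD; congr ((_ + _) / _).
      by rewrite /w /box op_comm.
    by rewrite /w /box op_comm.
  have H1 : `|box phi D l w x - w x| <= e ^+ 2.
    apply: op_near => [|y]; first exact: card_box.
    apply: le_trans (near1 _ Mm0 (l1_rowof _ _)) _; apply: le_trans small_L.
    rewrite ler_wpM2l ?divr_ge0 ?ler0n // ler_nat leq_mul2l; apply/orP; right.
    by rewrite /L1 [(D * l)%N]mulnC -mulnA leq_pmull.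
  have H2 : `|box phi 1 L1 w x - w x| <= e ^+ 2.
    apply: op_near => [|y]; first exact: card_box.
    by apply: le_trans (near1 _ Mm0 (l1_rowof _ _)) _; rewrite mul1n.
  move: H1 H2; move: (box _ _ _ _ _) (box _ _ _ _ _) (w x) => a c d.
  rewrite !ler_norml => /andP[? ?] /andP[? ?]; apply/andP; split; lra.
have h01 x : in01 (h x).
  by have /andP[? ?] := x01 x; have /andP[? ?] := b01 x; rewrite /in01 /h; apply/andP; split; lra.
have v01 x : in01 (v x) by apply: op_range.
have nv : norm2 w - 2 * e ^+ 2 <= norm2 v.
  rewrite /norm2 -[X in _ - X](avg_const _ (cardT T)) -avgB; apply: avg_le => x.
  have := vw x; rewrite ler_norml => /andP[h1 h2].
  have /andP[v0 v1] := v01 x; have /andP[w0 w1] := w01 x.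
  by move: (v x) (w x) (e ^+ 2) h1 h2 v0 v1 w0 w1 => a c d; nra.
have nh : norm2 v <= norm2 h by apply: norm2_op.
have -> : norm2 (fun x => x0 x - b x) = 2 * norm2 x0 + 2 * norm2 b - 4 * norm2 h.
  rewrite /norm2 -!avgZl -avgD -avgB; apply: eq_avg => x; rewrite /h.
  by move: (x0 x) (b x) => a c; field.
lra.
Qed.

Let F x := g x - x0 x.

(** Parameter [j] is resampled inside, where [G] does not see it, and Cauchy-Schwarz removes [G]. By
    [diff] two samples differ by t z, so the average over t is a correlation, bounded by the energy
    of [F]; [energy_pow] and [energy_bound] make that small. *)
Lemma spread_bound j (G : Om -> 'I_T0 -> T -> R) : (j < r)%N -> (forall p t x, `|G p t x| <= 1) ->
  (forall p a t x, G (upd p j a) t x = G p t x) ->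
  `|avg (fun p => avg (fun t : 'I_T0 => avg (fun x => G p t x * F (x + phi (u j p t)))))| <= e.
Proof.
move=> jr G1 Gu; have F1 x : `|F x| <= 1 by apply: in01B.
pose Z (i : Om * ('I_M0 * 'I_M0)) := phi (z j i.1 i.2.1 i.2.2).
have E1 : energy Z T1 1 F <= e ^+ 2 / 2.
  have He := @energy_pow R T _ Z T1 m' F F1.
  have := @energy_bound R T m phi phiD _ (fun x : Om * ('I_M0 * 'I_M0) => z j x.1 x.2.1 x.2.2)
    K M0 D l B T1 M00 T10 l0 (fun nu => @hyper j nu jr) (fun f => @lattice j f jr) m [::] g.
  rewrite big_nil mxrank0 => /(_ erefl erefl g01 (fun i (H : i \in [::]) => False_ind _ (elimTF idP (in_nil i) H))).
  move=> Hb; have := le_trans (le_trans He Hb) small_energy.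
  by rewrite ler_pXn2r ?nnegrE ?energy_ge0 ?expn_gt0 // divr_ge0 // sqr_ge0.
pose Y p (t : 'I_T0) x := avg (fun a : 'I_M0 => F (x + phi (u j (upd p j a) t))).
set S := avg _; have SE : S = avg (fun p => avg (fun t : 'I_T0 => avg (fun x => G p t x * Y p t x))).
  rewrite /S (avg_upd _ (Ordinal (ltnW jr : (j < r.+1)%N))) //; apply: eq_avg => p.
  rewrite avgC; apply: eq_avg => t; rewrite avgC; apply: eq_avg => x; rewrite -avgZl.
  by apply: eq_avg => a /=; rewrite Gu.
rewrite -(@ler_sqr _ `|S|) ?nnegrE ?(ltW e0) // real_normK ?num_real // SE.
apply: le_trans (avg_sqr _) _; apply: (@le_trans _ _ (avg (fun p => avg (fun t => avg (fun x => Y p t x ^+ 2))))).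
  apply: avg_le => p; apply: le_trans (avg_sqr _) _; apply: avg_le => t.
  apply: le_trans (avg_sqr _) _; apply: avg_le => x; rewrite exprMn ler_piMl ?sqr_ge0 //.
  exact: sqr_le1.
have -> : avg (fun p => avg (fun t => avg (fun x => Y p t x ^+ 2))) =
    avg (fun i => avg (fun t : 'I_T0 => avg (fun x => F x * F (x + Z i *+ t)))).
  rewrite [RHS]avg_pair; apply: eq_avg => p; rewrite [RHS]avgC; apply: eq_avg => t.
  rewrite [RHS]avg_pair.
  rewrite (eq_avg (G := fun x => avg (fun a => avg (fun a' => F (x + phi (u j (upd p j a) t)) * F (x + phi (u j (upd p j a') t)))))); last first.
    by move=> x; rewrite expr2 -avgZr; apply: eq_avg => a; rewrite -avgZl.
  rewrite avgC; apply: eq_avg => a; rewrite avgC; apply: eq_avg => a'.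
  rewrite -[RHS](avg_shift _ (phi (u j (upd p j a) t))); apply: eq_avg => x; congr (_ * F _).
  rewrite -addrA; congr (_ + _); rewrite /Z /= pmulrn -(phiMz phiD) -diff // phiD (phiN phiD).
  by rewrite addrC subrK.
apply: (@le_trans _ _ (avg (fun i => norm2 (cyc (Z i) T1 F)) + 2 * T1%:R / T0%:R)).
  rewrite -[X in _ + X](@avg_const R (Om * ('I_M0 * 'I_M0))%type); last first.
    by rewrite !card_prod !card_ffun !card_ord !muln_gt0 expn_gt0 M00.
  by rewrite -avgD; apply: avg_le => i; apply: correlation.
have -> : e ^+ 2 = e ^+ 2 / 2 + e ^+ 2 / 2 by field.
exact: lerD E1 small_T.
Qed.

Let N1 := e + norm2 (fun x => x0 x - b x) / e.

Let normN1 : avg (fun x => `|x0 x - b x|) <= N1.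
Proof.
rewrite /N1 /norm2 -avgZr -[X in _ <= X + _](avg_const e (cardT T)) -avgD; apply: avg_le => x.
exact: norm_amgm.
Qed.

Let produ j (p : Om) (t : 'I_T0) x := \prod_(i < j) g (x + phi (u i p t)).
(** Interpolates between the count of copies ([j = r]) and the mean of [g * b ^ r] ([j = 0]). *)
Let A j := avg (fun p => avg (fun t : 'I_T0 => avg (fun x => g x * produ j p t x * b x ^+ (r - j)))).

(** g(x + u_j) becomes b(x) in three moves: g to x0 by [spread_bound], x0 to b by the L^1 bound
    [N1], and removal of the shift because [b] varies slowly. *)
Let Astep j : (j < r)%N -> `|A j.+1 - A j| <= 2 * e + N1.
Proof.
move=> jr; pose Q p t x := g x * produ j p t x * b x ^+ (r - j.+1).
have Q01 p t x : in01 (Q p t x).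
  by apply: in01M; [apply: in01M; [exact: g01 | exact: in01_prod] | exact: in01X].
have Q1 p t x : `|Q p t x| <= 1 by apply: in01_norm.
pose s p (t : 'I_T0) := phi (u j p t).
have -> : A j.+1 - A j = avg (fun p => avg (fun t => avg (fun x => Q p t x * F (x + s p t))))
   + (avg (fun p => avg (fun t => avg (fun x => Q p t x * (x0 (x + s p t) - b (x + s p t)))))
   + avg (fun p => avg (fun t => avg (fun x => Q p t x * (b (x + s p t) - b x))))).
  rewrite /A -!avgD -avgB; apply: eq_avg => p; rewrite -!avgD -avgB; apply: eq_avg => t.
  rewrite -!avgD -avgB; apply: eq_avg => x; rewrite /Q /F /produ big_ord_recr /= -/(s p t).
  rewrite (_ : (r - j = (r - j.+1).+1)%N) ?exprSr; last by lia.
  by ring.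
apply: le_trans (ler_normD _ _) _; rewrite mulr2n mulrDl mul1r -addrA; apply: lerD.
  apply: spread_bound => // p a t x; rewrite /Q /produ; congr (_ * _ * _).
  by apply: eq_bigr => i _; rewrite later.
have N10 : 0 <= N1 by apply: le_trans normN1; apply: avg_ge0.
apply: le_trans (ler_normD _ _) _; rewrite [leRHS]addrC; apply: lerD.
  apply: avg_norm_le => [//|p]; apply: avg_norm_le => [//|t].
  apply: le_trans (avg_norm _) _; apply: le_trans normN1.
  rewrite -[leRHS](avg_shift _ (s p t)).
  by apply: avg_le => x; rewrite normrM ler_piMl.
apply: avg_norm_le => [|p]; first exact: ltW.
apply: avg_norm_le => [|t]; first exact: ltW.
apply: avg_norm_le => [|x]; first exact: ltW.
rewrite normrM -[e]mul1r ler_pM //; apply: le_trans (near1 _ L10 _) small_U.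
exact: size_u.
Qed.

Theorem descent : `|avg (fun p => avg (fun t : 'I_T0 => avg (fun x => g x * \prod_(i < r) g (x + phi (u i p t)))))
    - avg (fun x => b x ^+ r.+1)| <= r.+1%:R * (12 * e + 4 / e * (norm2 x0 - norm2 w)).
Proof.
have -> : avg (fun p => avg (fun t : 'I_T0 => avg (fun x => g x * \prod_(i < r) g (x + phi (u i p t))))) = A r.
  by do 3!apply: eq_avg => ?; rewrite subnn expr0 mulr1.
have H1 j : (j <= r)%N -> `|A j - A 0| <= j%:R * (2 * e + N1).
  elim: j => [|j IH] jr; first by rewrite subrr normr0 mul0r.
  have -> : A j.+1 - A 0 = (A j.+1 - A j) + (A j - A 0) by ring.
  apply: le_trans (ler_normD _ _) _; rewrite -[j.+1%:R]natr1 mulrDl mul1r addrC.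
  by apply: lerD; [apply: IH; exact: ltnW | exact: Astep].
have A0 : A 0 = avg (fun x => g x * b x ^+ r).
  rewrite /A -[RHS](@avg_const R Om); last by rewrite card_ffun !card_ord expn_gt0 M00.
  apply: eq_avg => p; rewrite -[RHS](@avg_const R 'I_T0) ?card_ord //; apply: eq_avg => t.
  by apply: eq_avg => x; rewrite /produ big_ord0 mulr1 subn0.
(* [b] hardly changes over the box of step D and side l, so the remaining factor [g] may be averaged
   over it, which produces [x0]. *)
have H2 : `|A 0 - avg (fun x => x0 x * b x ^+ r)| <= r%:R * e.
  rewrite A0 -[X in `|X - _|](@avg_const R {ffun 'I_m -> 'I_l}) ?card_box //.
  rewrite [X in _ - X](eq_avg (G := fun x => avg (fun y : {ffun 'I_m -> 'I_l} => g (x + phi (D%:Z *: rowof y)) * b x ^+ r))); last first.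
    by move=> x; rewrite avgZr.
  rewrite [X in _ - X]avgC -avgB; apply: avg_norm_le => [|y]; first by rewrite mulr_ge0 ?ler0n ?ltW.
  rewrite -[X in `|X - _|](avg_shift _ (phi (D%:Z *: rowof y))) -avgB.
  apply: avg_norm_le => [|x]; first by rewrite mulr_ge0 ?ler0n ?ltW.
  rewrite -mulrBr normrM; apply: le_trans (ler_piMl _ _) _ => //.
  apply: le_trans (pow_lip _ _ _) _ => //; rewrite ler_wpM2l ?ler0n //.
  by apply: le_trans (near1 _ L10 (l1_rowof _ _)) small_l.
have H3 : `|avg (fun x => x0 x * b x ^+ r) - avg (fun x => b x ^+ r.+1)| <= N1.
  rewrite -avgB; apply: le_trans (avg_norm _) _; apply: le_trans normN1; apply: avg_le => x.
  rewrite exprS -mulrBl normrM ler_piMr // in01_norm //; exact: in01X.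
have -> : A r - avg (fun x => b x ^+ r.+1) = (A r - A 0) + ((A 0 - avg (fun x => x0 x * b x ^+ r)) + (avg (fun x => x0 x * b x ^+ r) - avg (fun x => b x ^+ r.+1))) by ring.
apply: le_trans (ler_normD _ _) _; apply: le_trans (lerD (H1 r (leqnn r)) (le_trans (ler_normD _ _) (lerD H2 H3))) _.
have N1b : N1 <= 9 * e + 4 / e * (norm2 x0 - norm2 w).
  have := stable_gap; rewrite /N1; move: (norm2 x0 - norm2 w) (norm2 _) => d c.
  rewrite -(ler_pM2r (_ : 0 < e^-1)) ?invr_gt0 //.
  have -> : (4 * d + 8 * e ^+ 2) / e = 4 / e * d + 8 * e by field; rewrite gt_eqF.
  by lra.
apply: (@le_trans _ _ (r.+1%:R * (3 * e + N1))); last first.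
  by rewrite ler_wpM2l ?ler0n //; lra.
rewrite -[r.+1%:R]natr1; have r0 : 0 <= r%:R :> R by rewrite ler0n.
move: (r%:R) r0 => rr r0; rewrite -subr_ge0.
have -> : (rr + 1) * (3 * e + N1) - (rr * (2 * e + N1) + (rr * e + N1)) = 3 * e by rewrite mulr2n; ring.
by rewrite mulr_ge0 // ltW.
Qed.
End SpectralDescent.

(** * Products of simplices *)

(** A finite family of tuples of [npt] points: all copies of one simplex, or tuples of points of a
    box. *)
Record pattern (T : Type) := Pattern { par : finType; npt : nat; pos : par -> 'I_npt -> T }.
Arguments Pattern {T} par npt pos.

Section Patterns.
Variables (R : realFieldType) (T : finZmodType).
Implicit Types (p : pattern T) (ps : seq (pattern T)) (f g : T -> R).

Definition spread p (w : par p) f x : R := \prod_j f (x + pos w j).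
(** Unfolded, this averages, over a base point and one parameter per pattern, the product of f over
    all sums of one point from each pattern: the density of product configurations. *)
Fixpoint Lam ps f : R :=
  if ps is p :: ps' then avg (fun w : par p => Lam ps' (spread w f)) else avg f.

Lemma spread01 p (w : par p) f : (forall x, in01 (f x)) -> forall x, in01 (spread w f x).
Proof. by move=> H x; apply: in01_prod. Qed.

Lemma Lam_swap p q ps f : Lam (p :: q :: ps) f = Lam (q :: p :: ps) f.
Proof.
rewrite /= avgC; apply: eq_avg => w; apply: eq_avg => v; congr Lam; apply/funext => x.
rewrite /spread exchange_big; apply: eq_bigr => i _; apply: eq_bigr => j _.
by rewrite addrAC.
Qed.
Lemma Lam_rcons p ps f : Lam (rcons ps p) f = Lam (p :: ps) f.
Proof.
elim: ps f => // q ps IH f; rewrite Lam_swap rcons_cons.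
by apply: eq_avg => w; apply: IH.
Qed.
Lemma Lam_cat ps qs f : Lam (ps ++ qs) f = Lam (qs ++ ps) f.
Proof.
elim: ps qs => [|p ps IH] qs; first by rewrite cats0.
by rewrite -Lam_rcons rcons_cat IH cat_rcons.
Qed.
Lemma Lam01 ps f : (forall x, in01 (f x)) -> in01 (Lam ps f).
Proof.
elim: ps f => [|p ps IH] f H /=; apply/andP.
  by split; [apply: avg_ge0 => x | apply: avg_le_const => // x]; case/andP: (H x).
by split; [apply: avg_ge0 => x | apply: avg_le_const => // x]; case/andP: (IH _ (spread01 x H)).
Qed.

Definition dominated p q := forall g, (forall x, in01 (g x)) -> Lam [:: p] g <= Lam [:: q] g.

(** Moved to the last place, the distinguished pattern meets f already spread by the others, again a
    function with values in [0, 1], so the one-pattern bound applies for all values of the other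
    parameters. *)
Lemma Lam_head_bound (P Q A C : pattern T) c1 c2 ps f : 0 <= c1 ->
  (forall g, (forall x, in01 (g x)) -> `|Lam [:: P] g - Lam [:: Q] g| <= c1 + c2 * (Lam [:: A] g - Lam [:: C] g)) ->
  (forall x, in01 (f x)) ->
  `|Lam (P :: ps) f - Lam (Q :: ps) f| <= c1 + c2 * (Lam (A :: ps) f - Lam (C :: ps) f).
Proof.
move=> c10 H; rewrite -!(Lam_rcons _ ps); elim: ps f => [|p ps IH] f Hf; first exact: H.
rewrite !rcons_cons /= -!avgB; apply: le_trans (avg_norm _) _.
apply: (@le_trans _ _ (avg (fun w : par p => c1) + c2 * avg (fun w : par p => Lam (rcons ps A) (spread w f) - Lam (rcons ps C) (spread w f)))).
  by rewrite -avgZl -avgD; apply: avg_le => w; apply: IH; apply: spread01.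
by rewrite lerD2r; apply: avg_le_const.
Qed.
Lemma Lam_head_mono p q ps f : dominated p q -> (forall x, in01 (f x)) -> Lam (p :: ps) f <= Lam (q :: ps) f.
Proof.
move=> H; rewrite -!(Lam_rcons _ ps); elim: ps f => [|p' ps IH] f Hf; first exact: H.
by rewrite !rcons_cons; apply: avg_le => w; apply: IH; apply: spread01.
Qed.
Lemma Lam_mono (X : Type) (r : seq X) (P Q : X -> pattern T) f :
  (forall x, List.In x r -> dominated (P x) (Q x)) -> (forall x, in01 (f x)) ->
  Lam (map P r) f <= Lam (map Q r) f.
Proof.
elim: r f => //= x r IH f H Hf.
apply: (le_trans (Lam_head_mono (p := P x) (q := Q x) _ _ Hf)); first by apply: H; left.
by apply: avg_le => w; apply: IH => [y yr|]; [apply: H; right | apply: spread01].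
Qed.

(** The [e] points range independently over the box, so that the density is the [e]-th moment of the
    box average. *)
Definition boxpat (Y : finType) (s : Y -> T) e :=
  Pattern {ffun 'I_e -> Y} e (fun w j => s (w j)).

Lemma Lam_box (Y : finType) (s : Y -> T) e g : Lam [:: boxpat s e] g = avg (fun x => op s g x ^+ e).
Proof.
rewrite /= avgC; apply: eq_avg => x; rewrite /spread /= /op /avg expr_div_n card_ffun card_ord natrX.
congr (_ / _); rewrite -[e in RHS]card_ord -prodr_const.
by rewrite (bigA_distr_bigA (fun (i : 'I_e) (y : Y) => g (x + s y))).
Qed.

(** Convexity at each pattern: once for its moment, once to pull the exponent of the remaining
    patterns out of the average over its parameters. *)
Lemma Lam_boxes_ge (Y : Type) (r : seq Y) (F : Y -> finType) (s : forall y, F y -> T) (e : Y -> nat) f :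
  (forall y, (0 < #|F y|)%N) -> (forall x, 0 <= f x) ->
  avg f ^+ (\prod_(y <- r) (e y).+1) <= Lam [seq boxpat (@s y) (e y).+1 | y <- r] f.
Proof.
move=> F0; elim: r f => [|y r IH] f f0; first by rewrite big_nil expr1.
rewrite big_cons /=; set E := (\prod_(j <- r) _)%N.
have E0 : (0 < E)%N by apply: prodn_gt0.
have s0 w x : 0 <= spread (p := boxpat (@s y) (e y).+1) w f x by apply: prodr_ge0.
apply: (@le_trans _ _ (avg (fun w => avg (spread (p := boxpat (@s y) (e y).+1) w f) ^+ E))); last first.
  by apply: avg_le => w; apply: IH.
rewrite -(prednK E0); apply: le_trans (avg_pow _ _); last by move=> w; apply: avg_ge0.
rewrite (prednK E0) exprM; apply: lerXn2r.
- by rewrite nnegrE exprn_ge0 // avg_ge0.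
- by rewrite nnegrE; apply: avg_ge0 => w; apply: avg_ge0.
have := Lam_box (@s y) (e y).+1 f; rewrite /= => ->.
apply: le_trans (avg_pow _ _) => [|x]; last exact: avg_ge0.
rewrite le_eqVlt; apply/orP; left; apply/eqP; congr (_ ^+ _); rewrite /op avgC.
rewrite -[LHS](avg_const _ (F0 y)); apply: eq_avg => i; by rewrite avg_shift.
Qed.
End Patterns.

(** * Replacing the simplices by boxes, one direction at a time *)

Section Directions.
Variables (R : realFieldType) (d : nat) (c : R).
Hypothesis c0 : 0 < c.

(** [S] are the true copies, [Q] their box models, [A] and [C] box patterns bracketing them from
    above and below. The boolean tells the count moment ([true]) from the energy ([false]).
    [stage_gap] is the outcome of the pigeonhole. *)
Record stage (T : finZmodType) (emin eta : R) (S Q : 'I_d -> pattern T) (A C : 'I_d * bool -> pattern T)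
    (f : T -> R) : Prop := Stage {
  stage_f : forall x, in01 (f x);
  stage_bound : forall e i g, emin <= e -> e <= 1 -> (forall x, in01 (g x)) ->
    `|Lam [:: S i] g - Lam [:: Q i] g| <= c * (e + e^-1 * (Lam [:: A (i, false)] g - Lam [:: C (i, false)] g));
  stage_CQ : forall i, dominated R (C (i, true)) (Q i);
  stage_QA : forall i, dominated R (Q i) (A (i, true));
  stage_CA : forall i, dominated R (C (i, false)) (A (i, false));
  stage_gap : forall r : seq ('I_d * bool), map fst r = enum 'I_d -> Lam (map A r) f - Lam (map C r) f <= eta }.

Let key (T : finZmodType) (x : 'I_d * bool * pattern T) := x.1.
Let pat (T : finZmodType) (x : 'I_d * bool * pattern T) := x.2.

(** Monotonicity replaces the first row by [A] and the second by [C]. The induction in [directions]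
    rotates the list of directions; [Lam_cat] undoes this. *)
Lemma stage_boxes (T : finZmodType) emin eta S Q A C (f : T -> R) (r r' : seq ('I_d * bool * pattern T)) k :
  stage emin eta S Q A C f -> map (fun x => x.1.1) r = rot k (enum 'I_d) -> map (@key T) r = map (@key T) r' ->
  (forall x, List.In x r -> dominated R (pat x) (A (key x))) ->
  (forall x, List.In x r' -> dominated R (C (key x)) (pat x)) ->
  Lam (map (@pat T) r) f - Lam (map (@pat T) r') f <= eta.
Proof.
move=> [f01 _ _ _ _ gap] rk rr' rA r'C.
have H1 : Lam (map (@pat T) r) f <= Lam (map A (map (@key T) r)) f by rewrite -map_comp; apply: Lam_mono.
have H2 : Lam (map C (map (@key T) r)) f <= Lam (map (@pat T) r') f by rewrite rr' -map_comp; apply: Lam_mono.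
pose L := rotr k (map (@key T) r).
have L1 : map fst L = enum 'I_d.
  by rewrite /L map_rotr -map_comp (eq_map (g := fun x => x.1.1)) // rk rotK.
have HL (F : 'I_d * bool -> pattern T) : Lam (map F L) f = Lam (map F (map (@key T) r)) f.
  by rewrite -[map (@key T) r](rotrK k) -/L map_rot /rot Lam_cat cat_take_drop.
have := gap L L1; rewrite !HL; lra.
Qed.

Theorem directions s (gamma : R) : 0 < gamma -> exists emin eta : R, [/\ 0 < emin, emin <= 1, 0 < eta &
  forall (T : finZmodType) S Q A C f, stage emin eta S Q A C f ->
  forall ds (bs : seq ('I_d * bool * pattern T)) k, size ds = s ->
    ds ++ map (fun x => x.1.1) bs = rot k (enum 'I_d) ->
    (forall x, List.In x bs -> dominated R (pat x) (A (key x)) /\ dominated R (C (key x)) (pat x)) ->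
    `|Lam (map S ds ++ map (@pat T) bs) f - Lam (map Q ds ++ map (@pat T) bs) f| <= gamma].
Proof.
elim: s gamma => [|s IH] gamma g0.
  exists 1, 1; split=> // T S Q A C f _ [] //= bs k _ _ _.
  by rewrite subrr normr0 ltW.
(* The final error is c e + (c/e)(2 gamma' + eta') + gamma'. The three constants make c e, (c/e)
   eta' and (2c/e + 1) gamma' each at most gamma/4. *)
pose e := Num.min 1 (gamma / (4 * c)).
have e0 : 0 < e by rewrite lt_min ltr01 divr_gt0 // mulr_gt0.
pose gamma' := gamma / (4 * (2 * c / e + 1)).
have ce0 : 0 < c / e by rewrite divr_gt0.
have den : 0 < 4 * (2 * c / e + 1) by rewrite -mulrA; lra.
have [emin [eta [emin0 emin1 eta0 H]]] := IH gamma' (divr_gt0 g0 den).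
pose eta' := Num.min eta (gamma / (4 * (c / e))).
exists (Num.min emin e), eta'; split.
- by rewrite lt_min emin0.
- by rewrite ge_min emin1.
- by rewrite lt_min eta0 divr_gt0 // mulr_gt0.
move=> T S Q A C f St ds bs k; case: ds => // i ds [szd] Ek Hbs; rewrite cat_cons in Ek.
pose LS P := Lam (P :: (map S ds ++ map (@pat T) bs)) f; pose LQ P := Lam (P :: (map Q ds ++ map (@pat T) bs)) f.
change (`|LS (S i) - LQ (Q i)| <= gamma).
have St' : stage emin eta S Q A C f.
  case: St => f01 bd CQ QA CA gap; split=> // [e' j g e1' e2'|r Hr].
    by apply: bd => //; rewrite ge_min e1'.
  by apply: le_trans (gap r Hr) _; rewrite ge_min lexx.
have Eb (x : bool) P : Lam (P :: (map S ds ++ map (@pat T) bs)) f = Lam (map S ds ++ map (@pat T) (rcons bs (i, x, P))) f.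
  by rewrite map_rcons -cats1 catA cats1 Lam_rcons.
have Eb' (x : bool) P : Lam (P :: (map Q ds ++ map (@pat T) bs)) f = Lam (map Q ds ++ map (@pat T) (rcons bs (i, x, P))) f.
  by rewrite map_rcons -cats1 catA cats1 Lam_rcons.
have Ek' x P : ds ++ map (fun x => x.1.1) (rcons bs (i, x, P)) = rot 1 (rot k (enum 'I_d)).
  by rewrite map_rcons -Ek rot1_cons -cats1 -cats1 catA.
have ok (x : bool) P : dominated R P (A (i, x)) -> dominated R (C (i, x)) P ->
    forall y, List.In y (rcons bs (i, x, P)) -> dominated R (pat y) (A (key y)) /\ dominated R (C (key y)) (pat y).
  move=> PA CP y; rewrite -cats1 => /(@List.in_app_or _ _ _ _)[/Hbs //|] /= [<-|//].
  by split.
have HP (x : bool) P : dominated R P (A (i, x)) -> dominated R (C (i, x)) P ->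
    `|Lam (P :: (map S ds ++ map (@pat T) bs)) f - Lam (P :: (map Q ds ++ map (@pat T) bs)) f| <= gamma'.
  move=> PA CP; rewrite (Eb x) (Eb' x).
  have [k' Ek2] : exists k', rot 1 (rot k (enum 'I_d)) = rot k' (enum 'I_d).
    have [kd|kd] := leqP k (size (enum 'I_d)); last first.
      by rewrite (rot_oversize (ltnW kd)); exists 1%N.
    have [d1|d1] := leqP 1 (size (enum 'I_d)); last first.
      by have := ltn_ord i; move: d1; rewrite size_enum_ord; lia.
    by rewrite rot_add_mod //; eexists.
  apply: (H T S Q A C f St' ds _ k') => //; first by rewrite Ek' Ek2.
  exact: ok.
have [f01 bd CQ QA CA gap] := St.
have HA : `|Lam (S i :: (map S ds ++ map (@pat T) bs)) f - Lam (Q i :: (map S ds ++ map (@pat T) bs)) f|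
   <= c * e + c / e * (Lam (A (i, false) :: (map S ds ++ map (@pat T) bs)) f - Lam (C (i, false) :: (map S ds ++ map (@pat T) bs)) f).
  apply: Lam_head_bound => // [|g g01]; first by rewrite mulr_ge0 ?ltW.
  rewrite -mulrA -mulrDr; apply: bd => //; first by rewrite ge_min lexx orbT.
  by rewrite ge_min lexx.
have trA j b : dominated R (A (j, b)) (A (j, b)) by move=> g _.
have trC j b : dominated R (C (j, b)) (C (j, b)) by move=> g _.
have BA := HP false _ (trA i false) (CA i).
have BC := HP false _ (CA i) (trC i false).
have BQ := HP true _ (QA i) (CQ i).
(* With all other directions turned into boxes by the induction hypothesis, the energy drop in
   direction [i] is a difference of all-box averages. *)
have gapAC : Lam (A (i, false) :: (map Q ds ++ map (@pat T) bs)) f - Lam (C (i, false) :: (map Q ds ++ map (@pat T) bs)) f <= eta'.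
  pose X P := (i, false, P) :: ([seq (j, true, Q j) | j <- ds] ++ bs).
  have XE P : P :: (map Q ds ++ map (@pat T) bs) = map (@pat T) (X P).
    by rewrite /X /= map_cat -map_comp.
  rewrite !XE; apply: (stage_boxes St (k := k)).
  - rewrite -Ek /X /= map_cat -map_comp; congr (_ :: (_ ++ _)).
    by rewrite -[RHS]map_id; apply: eq_map.
  - by [].
  - move=> x /= [<- //|] /(@List.in_app_or _ _ _ _)[|/Hbs[] //].
    by move=> /List.in_map_iff[j [<- _]]; apply: QA.
  move=> x /= [<- //|] /(@List.in_app_or _ _ _ _)[|/Hbs[] //].
  by move=> /List.in_map_iff[j [<- _]]; apply: CQ.
have ge1 : c * e <= gamma / 4.
  have : e <= gamma / (4 * c) by rewrite ge_min lexx orbT.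
  by rewrite ler_pdivlMr ?mulr_gt0 // => ?; rewrite ler_pdivlMr //; lra.
have ge2 : c / e * eta' <= gamma / 4.
  have : eta' <= gamma / (4 * (c / e)) by rewrite ge_min lexx orbT.
  have ce4 : 0 < 4 * (c / e) by rewrite mulr_gt0.
  by rewrite ler_pdivlMr // => ?; rewrite ler_pdivlMr //; lra.
have ge3 : (2 * (c / e) + 1) * gamma' = gamma / 4.
  rewrite /gamma' -[2 * c / e]mulrA; field.
  by rewrite (gt_eqF e0) /= gt_eqF // addr_gt0 // mulr_gt0.
move: HA BA BC BQ gapAC; rewrite -![Lam (_ :: (map S _ ++ _)) f]/(LS _) -![Lam (_ :: (map Q _ ++ _)) f]/(LQ _).
move: (LS (S i)) (LS (Q i)) (LQ (Q i)) (LS (A _)) (LQ (A _)) (LS (C _)) (LQ (C _)) => x1 x2 x3 x4 x5 x6 x7.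
move: (c / e) ce0 (c * e) ge1 ge2 ge3 => C0 C00 ce ge1 ge2 ge3 HA BA BC BQ gp.
have H3 : C0 * (x4 - x6) <= C0 * (2 * gamma' + eta').
  rewrite ler_pM2l //; move: BA BC; rewrite !ler_norml => /andP[? ?] /andP[? ?]; lra.
move: HA BQ; rewrite !ler_norml => /andP[? ?] /andP[? ?]; apply/andP; split; lra.
Qed.
End Directions.

(** * Choice of the constants for one direction *)

(** Cramer's rule: [D0] is the product of all nonzero determinants of [m] of the vectors, so D y has
    integral coordinates in each independent choice; finitely many y and choices give [B]. *)
Lemma cramer_bound m (I : finType) (z : I -> 'rV[int]_m) : exists2 D0 : nat, (0 < D0)%N &
  forall D l, (D0 %| D)%N -> exists B : nat, forall f : 'I_m -> I,
    \det (\matrix_(i, j) z (f i) 0 j) != 0 -> forall y : {ffun 'I_m -> 'I_l},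
    exists c : 'I_m -> int, D%:Z *: rowof y = \sum_i c i *: z (f i) /\ \sum_i `|c i| <= B%:Z.
Proof.
pose M (f : {ffun 'I_m -> I}) : 'M[int]_m := \matrix_(i, j) z (f i) 0 j.
pose dt f := if \det (M f) == 0 then 1%N else `|\det (M f)|%N.
have dt0 f : (0 < dt f)%N by rewrite /dt; case: eqP => // /eqP H; rewrite absz_gt0.
exists (\prod_f dt f)%N; first exact: prodn_gt0.
move=> D l D0D.
have H (f : {ffun 'I_m -> I}) (y : {ffun 'I_m -> 'I_l}) : exists c : 'rV[int]_m, \det (M f) != 0 ->
    D%:Z *: rowof y = \sum_i c 0 i *: z (f i).
  have [E|E] := eqVneq (\det (M f)) 0; first by exists 0.
  have /dvdzP[q Eq] : (\det (M f) %| D%:Z)%Z.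
    rewrite dvdzE /=; apply: dvdn_trans D0D; rewrite (bigD1 f) //= /dt (negbTE E).
    exact: dvdn_mulr.
  exists (q *: (rowof y *m \adj (M f))) => _; rewrite Eq -scalerA.
  have -> : \det (M f) *: rowof y = (rowof y *m \adj (M f)) *m M f.
    by rewrite -mulmxA mul_adj_mx mul_mx_scalar.
  rewrite mulmx_sum_row scaler_sumr; apply: eq_bigr => i _; rewrite scalerA.
  have -> : (q *: (rowof y *m \adj (M f))) 0 i = q * (rowof y *m \adj (M f)) 0 i by rewrite [LHS]mxE.
  by congr (_ *: _); apply/rowP => j; rewrite !mxE.
have [c Hc] := choice (fun fy : {ffun 'I_m -> I} * {ffun 'I_m -> 'I_l} => H fy.1 fy.2).
exists (\sum_fy \sum_i `|c fy ord0 i|%N)%N => f df y.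
exists (c ([ffun i => f i], y) 0); split.
  rewrite (Hc ([ffun i => f i], y)) /=; first by apply: eq_bigr => i _; rewrite ffunE.
  by move: df; rewrite (_ : M _ = \matrix_(i, j) z (f i) 0 j) //; apply/matrixP => i j; rewrite !mxE ffunE.
apply: (@le_trans _ _ (\sum_i `|c ([ffun i => f i], y) ord0 i|%N)%N%:Z).
  rewrite (big_morph Posz PoszD (erefl (Posz 0))); apply: ler_sum => i _.
  by rewrite abszE.
by rewrite lez_nat (bigD1 ([ffun i => f i], y)) //= leq_addr.
Qed.

Lemma small_div (R : archiRealFieldType) (a b : R) : 0 <= a -> 0 < b ->
  exists N : nat, forall n, (N <= n)%N -> (0 < n)%N -> a / n%:R <= b.
Proof.
move=> a0 b0; exists (Num.bound (a / b)) => n Nn n0.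
have := archi_boundP (divr_ge0 a0 (ltW b0)); rewrite ltr_pdivrMr // => H.
rewrite ler_pdivrMr ?ltr0n // mulrC; apply: le_trans (ltW H) _.
by rewrite ler_pM2r // ler_nat.
Qed.

Definition boxs (T : zmodType) m (phi : 'rV[int]_m -> T) q L (y : {ffun 'I_m -> 'I_L}) := phi (q%:Z *: rowof y).
Arguments boxs {T m} phi q L y.
Definition with0 m (v : nat -> 'rV[int]_m) a := if a is i.+1 then v i else 0.

(** The order of quantifiers is the order of choice: the family of copies, the factor kk of the
    averaging box, the factor n of the comparison box, all before the group, the homomorphism and
    the function. *)
Definition configured (R : archiRealFieldType) m (v : nat -> 'rV[int]_m) (emin : R) r C D l k :=
  exists (Om : finType) (ps : Om -> nat -> 'rV[int]_m),
    [/\ forall w, ps w 0%N = 0,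
      forall w a b, (a <= r)%N -> (b <= r)%N ->
        dot (ps w a) (ps w b) = (C ^ 2 * k)%:Z * dot (with0 v a) (with0 v b) &
    exists K : nat, forall kk, (K <= kk)%N -> (0 < kk)%N -> exists N : nat, forall n, (N <= n)%N -> (0 < n)%N ->
      forall (T : finZmodType) (phi : 'rV[int]_m -> T) (g : T -> R) (e c : R), {morph phi : x y / x + y} ->
      (forall x, in01 (g x)) -> emin <= e -> e <= 1 -> 12 * r.+1%:R <= c ->
      `|Lam [:: Pattern Om r.+1 (fun w j => phi (ps w j))] g
        - Lam [:: boxpat (boxs phi 1 (kk * l * D)) r.+1] g|
      <= c * (e + e^-1 * (Lam [:: boxpat (boxs phi D l) 2] g
           - Lam [:: boxpat (boxs phi 1 (n * (kk * l * D))) 2] g))].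

Section Direction.
Variables (R : archiRealFieldType) (m r : nat) (v : nat -> 'rV[int]_m) (emin : R).
Hypotheses (mE : m = (2 * r + 5)%N) (emin0 : 0 < emin) (emin1 : emin <= 1).
Hypothesis ind : forall i, (i < r)%N -> ~~ (iv (v i) <= \sum_(l < i) <<iv (v l)>>)%MS.

Theorem direction : exists2 C0 : nat, (0 < C0)%N & forall C, (0 < C)%N -> (C0 %| C)%N ->
  exists2 D0 : nat, (0 < D0)%N & forall D l, (0 < D)%N -> (D0 %| D)%N -> (0 < l)%N ->
  exists T0 : nat, forall k, (T0 ^ 2 <= k)%N ->
  configured v emin r C D l k.
Proof.
case: m mE v ind => [|m'] mE' v' ind'; first by lia.
(* The exceptional directions and the box approximation each receive half of the energy
   allowance. *)
pose half : R := (emin ^+ 2 / 2) ^+ (2 ^ m') / 2.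
have em2 : 0 < emin ^+ 2 by rewrite exprn_gt0.
have em21 : emin ^+ 2 <= 1 by rewrite expr_le1 // ltW.
have half0 : 0 < half by rewrite !divr_gt0 // exprn_gt0 // divr_gt0.
have half1 : half <= 1.
  rewrite ler_pdivrMr // mul1r; apply: le_trans (_ : 1 <= 2); last by rewrite ler1n.
  by rewrite exprn_ile1 // ?divr_ge0 ?(ltW em2) //; lra.
have [N0 HM] := small_div (a := (m'.+1 * (2 * 3 ^ m'.+1).+1)%:R) (ler0n _ _) half0.
pose M0 := N0.+1; have M00 : (0 < M0)%N by [].
have [C0 [z [C00 hyper Hconf]]] := configurations M0 mE' ind'.
exists C0 => // C Cpos /dvdnP[s Cs].
have s0 : (0 < s)%N by move: Cpos; rewrite Cs muln_gt0 => /andP[].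
pose Om := {ffun 'I_r.+1 -> 'I_M0}.
(* Everything is dilated by s = C / C0, so that all directions can later share one dilation [C]. *)
pose z' j p a a' := s%:Z *: z j p a a'.
have [D0 D00 HD] := cramer_bound (fun x : 'I_r * (Om * ('I_M0 * 'I_M0)) => z' x.1 x.2.1 x.2.2.1 x.2.2.2).
exists D0 => // D l Dpos D0D l0.
have [B HB] := HD D l D0D.
have [N1 HT1] := small_div (a := 2 * B%:R) (mulr_ge0 (ler0n R 2) (ler0n _ B)) half0.
pose T1 := N1.+1; have T10 : (0 < T1)%N by [].
have em22 : 0 < emin ^+ 2 / 2 by rewrite divr_gt0.
have [N2 HT0] := small_div (a := 2 * T1%:R) (mulr_ge0 (ler0n R 2) (ler0n _ T1)) em22.
pose T0 := N2.+1; have T00 : (0 < T0)%N by [].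
exists T0 => k Tk; have [u [gram later diff]] := Hconf T0 k Tk.
pose u' j p t := s%:Z *: u j p t.
pose ps (w : Om * 'I_T0) := with0 (fun j => u' j w.1 w.2).
exists (Om * 'I_T0)%type, ps; split=> //.
  move=> w [|a] [|b] ar br; rewrite ?dot0l ?dot0r ?mulr0 //= /u' dotZl dotZr gram // mulrA -!PoszM mulrA -PoszM.
  by congr (_%:Z * _); rewrite Cs !expnS !expn0; ring.
pose U := (\sum_(x : 'I_r * Om * 'I_T0) `|l1 (u' x.1.1 x.1.2 x.2)|)%N.
have HU j p t : (j < r)%N -> (t < T0)%N -> l1 (u' j p t) <= U%:Z.
  move=> jr tT; apply: (@le_trans _ _ `|l1 (u' j p t)|%N%:Z); first by rewrite abszE ler_norm.
  by rewrite lez_nat /U (bigD1 (Ordinal jr, p, Ordinal tT)) //= leq_addr.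
have [K1 HK1] := small_div (a := 2 * U%:R) (mulr_ge0 (ler0n R 2) (ler0n _ U)) emin0.
have [K2 HK2] := small_div (a := 2 * (m'.+1 * (D * l))%:R) (mulr_ge0 (ler0n R 2) (ler0n _ _)) emin0.
exists (maxn K1 K2) => kk; rewrite geq_max => /andP[K1k K2k] kk0.
set L1 := (kk * l * D)%N; have kL : (kk <= L1)%N by rewrite /L1 -mulnA leq_pmulr // muln_gt0 l0.
have L10 : (0 < L1)%N by apply: leq_trans kL.
have [N HN] := small_div (a := 2 * (m'.+1 * L1)%:R) (mulr_ge0 (ler0n R 2) (ler0n _ _)) em2.
exists N => n Nn n0 T phi g e c phiD g01 e1 e2 cr.
have e0 : 0 < e by apply: lt_le_trans e1.
have n10 : (0 < n * L1)%N by rewrite muln_gt0 n0.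
have ee : emin ^+ 2 <= e ^+ 2 by rewrite ler_sqr ?nnegrE ?(ltW emin0) ?(ltW e0).
have ee2 : (emin ^+ 2 / 2) ^+ (2 ^ m') <= (e ^+ 2 / 2) ^+ (2 ^ m').
  by apply: lerXn2r; rewrite ?nnegrE ?divr_ge0 ?sqr_ge0 // ler_pM2r // invr_gt0.
have H1 : m'.+1%:R * ((2 * 3 ^ m'.+1).+1%:R / M0%:R) + (2 / T1%:R * B%:R) ^+ 2 <= (e ^+ 2 / 2) ^+ (2 ^ m') :> R.
  apply: le_trans ee2; have Eh : (emin ^+ 2 / 2) ^+ (2 ^ m') = half + half by rewrite /half; field.
  rewrite Eh; apply: lerD; first by rewrite mulrA -natrM; apply: HM.
  have Hh := HT1 T1 (leqnSn _) T10; rewrite mulrAC; apply: le_trans (_ : half ^+ 2 <= _).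
    by rewrite ler_sqr ?nnegrE ?(ltW half0) // divr_ge0 // mulr_ge0.
  by rewrite expr2 ler_piMl // ltW.
have H2 : 2 * T1%:R / T0%:R <= e ^+ 2 / 2 :> R.
  by apply: le_trans (HT0 T0 (leqnSn _) T00) _; rewrite ler_pM2r ?invr_gt0.
have H3 : 2 / L1%:R * U%:R <= e :> R.
  by rewrite mulrAC; apply: le_trans (HK1 L1 (leq_trans K1k kL) L10) e1.
have H4 : 2 / L1%:R * (m'.+1 * (D * l))%:R <= e :> R.
  by rewrite mulrAC; apply: le_trans (HK2 L1 (leq_trans K2k kL) L10) e1.
have H5 : 2 / (n * L1)%:R * (m'.+1 * L1)%:R <= e ^+ 2 :> R.
  rewrite mulrAC; apply: le_trans ee; apply: HN => //.
  by apply: leq_trans Nn _; rewrite leq_pmulr.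
have hyper' j nu : (j < r)%N -> nu != 0 ->
    (M0 * #|[pred x : Om * ('I_M0 * 'I_M0) | dot nu (z' j x.1 x.2.1 x.2.2) == 0%R]|
     <= (2 * 3 ^ m'.+1).+1 * #|{: Om * ('I_M0 * 'I_M0)}|)%N.
  move=> jr nu0; apply: leq_trans (hyper j nu jr nu0); rewrite leq_mul2l; apply/orP; right.
  apply: subset_leq_card; apply/subsetP => x; rewrite !inE /z' dotZr mulf_eq0.
  by rewrite (gt_eqF (_ : 0 < s%:Z)) // ltz_nat.
have later' j j' p a t : (j < j')%N -> (j' < r)%N -> u' j (upd p j' a) t = u' j p t.
  by move=> H H'; rewrite /u' later.
have diff' j p a a' t : (j < r)%N -> (t < T0)%N -> u' j (upd p j a') t - u' j (upd p j a) t = t%:Z *: z' j p a a'.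
  by move=> H H'; rewrite /u' -scalerBr diff // /z' !scalerA mulrC.
have lattice' j (f : 'I_m'.+1 -> Om * ('I_M0 * 'I_M0)) : (j < r)%N ->
    \det (\matrix_(i, i') z' j (f i).1 (f i).2.1 (f i).2.2 0 i') != 0 ->
    forall y : {ffun 'I_m'.+1 -> 'I_l}, exists c : 'I_m'.+1 -> int,
      D%:Z *: rowof y = \sum_i c i *: z' j (f i).1 (f i).2.1 (f i).2.2 /\ \sum_i `|c i| <= B%:Z.
  by move=> jr dt y; apply: (HB (fun i => (Ordinal jr, f i))).
have := @descent R T m' phi phiD r M0 D l kk (n * L1) T0 T1 _ B U z' u' e M00 Dpos l0 kk0 n10 T00 T10
  hyper' lattice' later' diff' HU e0 e2 H1 H2 H3 H4 H5 g g01.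
have -> : Lam [:: Pattern (Om * 'I_T0)%type r.+1 (fun w j => phi (ps w j))] g =
    avg (fun p => avg (fun t : 'I_T0 => avg (fun x => g x * \prod_(i < r) g (x + phi (u' i p t))))).
  rewrite /= avg_pair; apply: eq_avg => p; apply: eq_avg => t; apply: eq_avg => x.
  by rewrite /spread /= big_ord_recl /= (phi0 phiD) addr0.
rewrite !Lam_box => H; apply: le_trans H _.
have D01 : norm2 (box phi 1 (n * L1) g) <= norm2 (box phi D l g).
  have g0 x : 0 <= g x by case/andP: (g01 x).
  have := @box_monotone R T m'.+1 phi phiD 1 1 L1 n g 1 isT L10 g0; rewrite muln1 mul1n => H6.
  apply: le_trans H6 _; have := @box_monotone R T m'.+1 phi phiD 1 D l kk g 1 Dpos l0 g0.
  by rewrite mul1n.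
move: D01; rewrite /norm2 -[op (boxs phi 1 (n * L1)) g]/(box phi 1 (n * L1) g) -[op (boxs phi D l) g]/(box phi D l g).
move: (avg _) (avg _) => a b ab; rewrite -subr_ge0 in ab.
apply: (@le_trans _ _ (12 * r.+1%:R * (e + e^-1 * (a - b)))); last first.
  by rewrite ler_wpM2r // addr_ge0 ?(ltW e0) // mulr_ge0 // invr_ge0 ltW.
have r0 : 0 <= r.+1%:R :> R := ler0n R _; move: (r.+1%:R : R) r0 => rr r0.
have -> : 12 * rr * (e + e^-1 * (a - b)) = rr * (12 * e + 12 / e * (a - b)) by ring.
rewrite ler_wpM2l // lerD2l ler_wpM2r // ler_pM2r ?invr_gt0 //.
by rewrite ler_nat.
Qed.
End Direction.

Lemma avg_gt0 (R : realFieldType) (I : finType) (F : I -> R) : 0 < avg F -> exists i, 0 < F i.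
Proof.
move=> F0; case: (pickP (fun i => 0 < F i)) => [i Hi|H]; first by exists i.
have : avg F <= 0 by apply: avg_le_const => // i; rewrite leNgt H.
by rewrite leNgt F0.
Qed.

Lemma half_loss (R : realFieldType) (a b c : R) : - (c / 2) <= a - b -> c <= b -> 0 < c / 2 -> 0 < a.
Proof. lra. Qed.

Lemma box_dominated (R : realFieldType) (T : finZmodType) m (phi : 'rV[int]_m -> T) q D l k e :
  {morph phi : x y / x + y} -> (0 < D)%N -> (0 < l)%N ->
  dominated R (boxpat (boxs phi q (k * l * D)) e.+1) (boxpat (boxs phi (q * D) l) e.+1).
Proof.
move=> phiD D0 l0 g g01; rewrite !Lam_box; apply: (box_monotone phiD) => // x.
by case/andP: (g01 x).
Qed.

(** * The pigeonhole over steps *)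

Section Copies.
Variables (R : archiRealFieldType) (d : nat) (r_ m_ : 'I_d -> nat) (v_ : forall i, nat -> 'rV[int]_(m_ i)).
Hypothesis mE : forall i, m_ i = (2 * r_ i + 5)%N.
Hypothesis ind : forall i j, (j < r_ i)%N -> ~~ (iv (v_ i j) <= \sum_(l < j) <<iv (v_ i l)>>)%MS.

Lemma Lam_pos (T : finZmodType) (Om : 'I_d -> finType) (ps : forall i, Om i -> nat -> 'rV[int]_(m_ i))
    (phi : forall i, 'rV[int]_(m_ i) -> T) (s : seq 'I_d) (f : T -> R) : uniq s -> (forall x, 0 <= f x) ->
  0 < Lam [seq Pattern (Om i) (r_ i).+1 (fun w j => phi i (ps i w j)) | i <- s] f ->
  exists (qs : forall i, nat -> 'rV[int]_(m_ i)) x, (forall i, i \in s -> exists w, qs i = ps i w) /\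
    forall j : 'I_d -> nat, (forall i, (j i <= r_ i)%N) -> 0 < f (x + \sum_(i <- s) phi i (qs i (j i))).
Proof.
elim: s f => [|i s IH] f us f0 /=.
  move=> /avg_gt0[x fx]; exists (fun _ _ => 0), x; split=> // j _.
  by rewrite big_nil addr0.
case/andP: us => is_ us /avg_gt0[w /(IH _ us)[|qs [x [Hs Hx]]]].
  by move=> x; apply: prodr_ge0.
exists (dfwith qs (ps i w)), x; split=> [k|j jr].
  rewrite inE => /orP[/eqP ->|ks]; first by exists w; rewrite dfwith_in.
  have ki : i != k by apply: contraNneq is_ => ->.
  by rewrite dfwith_out //; apply: Hs.
have := Hx j jr; rewrite /spread lt0r => /andP[/prodf_neq0 /(_ (Ordinal (jr i : (j i < (r_ i).+1)%N)) isT) /= H _].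
rewrite lt0r f0 andbT big_cons dfwith_in.
suff -> : \sum_(k <- s) phi k (dfwith qs (ps i w) k (j k)) = \sum_(k <- s) phi k (qs k (j k)).
  by rewrite [phi i _ + _]addrC addrA.
rewrite big_seq [RHS]big_seq; apply: eq_bigr => k ks.
by rewrite dfwith_out //; apply: contraNneq is_ => ->.
Qed.

Let bx (T : finZmodType) (phi : forall i, 'rV[int]_(m_ i) -> T) q l (x : 'I_d * bool) : pattern T :=
  boxpat (boxs (phi x.1) q l) (if x.2 then (r_ x.1).+1 else 2).
(** Each summand decreases from one stage to the next, so a small drop of the sum controls every
    choice of exponents at once, as [stage_gap] demands. *)
Let Phi (T : finZmodType) (phi : forall i, 'rV[int]_(m_ i) -> T) q l (f : T -> R) : R :=
  \sum_(k : {ffun 'I_d -> bool}) Lam (map (bx phi q l) [seq (i, k i) | i <- enum 'I_d]) f.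

Lemma Phi_bounds (T : finZmodType) (phi : forall i, 'rV[int]_(m_ i) -> T) q l (f : T -> R) :
  (forall x, in01 (f x)) -> 0 <= Phi phi q l f <= (2 ^ d)%:R.
Proof.
move=> f01; have H k := Lam01 (map (bx phi q l) [seq (i, k i) | i <- enum 'I_d]) f01.
apply/andP; split; first by apply: sumr_ge0 => k _; case/andP: (H k).
apply: (@le_trans _ _ (\sum_(k : {ffun 'I_d -> bool}) 1)).
  by apply: ler_sum => k _; case/andP: (H k).
by rewrite sumr_const card_ffun card_bool card_ord.
Qed.

(** [W] bounds the displacements independently of the group, so that copies in a large torus lift to
    the integers without wrapping around. *)
Definition copy_at (T : finZmodType) (phi : forall i, 'rV[int]_(m_ i) -> T) (f : T -> R) q0 W k :=
  exists (qs : forall i, nat -> 'rV[int]_(m_ i)) x,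
    [/\ forall i, qs i 0%N = 0, forall i a, (a <= r_ i)%N -> l1 (qs i a) <= W%:Z,
      forall i a b, (a <= r_ i)%N -> (b <= r_ i)%N ->
        dot (qs i a) (qs i b) = (q0 ^ 2 * k)%:Z * dot (with0 (v_ i) a) (with0 (v_ i) b) &
      forall j : 'I_d -> nat, (forall i, (j i <= r_ i)%N) -> 0 < f (x + \sum_i phi i (qs i (j i)))].

(** A compactness form: every unbounded [X] has a finite subset serving all dense functions on all
    groups. Applied to the exceptional [k] it gives a threshold depending on the set. *)
Theorem finite_copies (delta : R) : 0 < delta -> exists2 q0, (0 < q0)%N &
  forall X : nat -> Prop, (forall N, exists k, (N <= k)%N /\ X k) ->
  exists (ks : seq nat) (W : nat), (forall k, k \in ks -> X k) /\
    forall (T : finZmodType) (phi : forall i, 'rV[int]_(m_ i) -> T) (f : T -> R),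
      (forall i, {morph phi i : x y / x + y}) -> (forall x, in01 (f x)) -> delta <= avg f ->
      exists2 k, k \in ks & copy_at phi f q0 W k.
Proof.
move=> delta0; pose E := (\prod_(i <- enum 'I_d) (r_ i).+1)%N.
pose gamma := delta ^+ E / 2; have gamma0 : 0 < gamma by rewrite divr_gt0 // exprn_gt0.
pose c : R := (12 * \sum_i (r_ i).+1 + 1)%:R.
have c0 : 0 < c by rewrite ltr0n addn1.
have cr i : 12 * (r_ i).+1%:R <= c.
  by rewrite -natrM ler_nat (bigD1 i) //= mulnDr -addnA leq_addr.
have [emin [eta [emin0 emin1 eta0 Hdir]]] := directions d c0 d gamma0.
have HC i : exists C0, (0 < C0)%N /\ forall C, (0 < C)%N -> (C0 %| C)%N ->
    exists2 D0 : nat, (0 < D0)%N & forall D l, (0 < D)%N -> (D0 %| D)%N -> (0 < l)%N ->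
    exists T0 : nat, forall k, (T0 ^ 2 <= k)%N -> configured (v_ i) emin (r_ i) C D l k.
  by have [C0 C00 H] := direction (mE i) emin0 emin1 (@ind i); exists C0.
have {HC}[C0 HC] := choice HC; pose C := (\prod_i C0 i)%N.
have C_gt0 : (0 < C)%N by apply: prodn_gt0 => i; case: (HC i).
have HD i : exists D0, (0 < D0)%N /\ forall D l, (0 < D)%N -> (D0 %| D)%N -> (0 < l)%N ->
    exists T0 : nat, forall k, (T0 ^ 2 <= k)%N -> configured (v_ i) emin (r_ i) C D l k.
  have [_ H] := HC i; have [|D0 D00 H'] := H C C_gt0; last by exists D0.
  by rewrite /C (bigD1 i) //= dvdn_mulr.
have {HD}[D0 HD] := choice HD; pose D := (\prod_i D0 i)%N.
have D_gt0 : (0 < D)%N by apply: prodn_gt0 => i; case: (HD i).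
have DD i : (D0 i %| D)%N by rewrite /D (bigD1 i) //= dvdn_mulr.
pose Kn := Num.bound ((2 ^ d)%:R / eta : R).
have HKn : (2 ^ d)%:R < Kn%:R * eta.
  by have := archi_boundP (divr_ge0 (ler0n _ (2 ^ d)) (ltW eta0)); rewrite ltr_pdivrMr.
exists (C * D ^ Kn)%N; first by rewrite muln_gt0 C_gt0 expn_gt0 D_gt0.
move=> X HX.
(* Each failed stage adds eta to the telescoping drop of [Phi], which never exceeds 2^d < Kn eta; so
   a stage succeeds. *)
have claim n : (n <= Kn)%N -> forall l, (0 < l)%N -> exists (ks : seq nat) (W : nat), (forall k, k \in ks -> X k) /\
    forall (T : finZmodType) (phi : forall i, 'rV[int]_(m_ i) -> T) (f : T -> R),
      (forall i, {morph phi i : x y / x + y}) -> (forall x, in01 (f x)) -> delta <= avg f ->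
      (exists2 k, k \in ks & copy_at phi f (C * D ^ Kn) W k) \/
      exists l', n%:R * eta <= Phi phi (D ^ n) l f - Phi phi 1 l' f.
  elim: n => [|n IH] nK l l0.
    exists [::], 0%N; split=> // T phi f phiD f01 df; right; exists l.
    by rewrite mul0r expn0 subrr.
  have HT i : exists T0 : nat, forall k, (T0 ^ 2 <= k)%N -> configured (v_ i) emin (r_ i) C D l k.
    by case: (HD i) => _; apply.
  have {HT}[T0 HT] := choice HT.
  have [kap [Tk Xk]] := HX ((\sum_i T0 i) ^ 2)%N.
  (* At stage n the copies are dilated by a further D^n; this power makes the total factor (C
     D^Kn)^2 kap, the same at every stage. *)
  pose k := (kap * D ^ (2 * (Kn - n)))%N.
  have Hcf i : configured (v_ i) emin (r_ i) C D l k.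
    apply: HT; apply: (@leq_trans kap); last by rewrite /k leq_pmulr // expn_gt0 D_gt0.
    by apply: leq_trans Tk; rewrite leq_exp2r // (bigD1 i) //= leq_addr.
  pose Om i := sval (cid (Hcf i)); have HOm i := svalP (cid (Hcf i)).
  pose ps i : Om i -> nat -> 'rV[int]_(m_ i) := sval (cid (HOm i)).
  have Hps i := svalP (cid (HOm i)).
  have HK i : exists K, forall kk, (K <= kk)%N -> (0 < kk)%N -> exists N, forall n', (N <= n')%N -> (0 < n')%N ->
      forall (T : finZmodType) (phi : 'rV[int]_(m_ i) -> T) (g : T -> R) (e c : R), {morph phi : x y / x + y} ->
      (forall x, in01 (g x)) -> emin <= e -> e <= 1 -> 12 * (r_ i).+1%:R <= c ->
      `|Lam [:: Pattern (Om i) (r_ i).+1 (fun w j => phi (ps i w j))] g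
        - Lam [:: boxpat (boxs phi 1 (kk * l * D)) (r_ i).+1] g|
      <= c * (e + e^-1 * (Lam [:: boxpat (boxs phi D l) 2] g
           - Lam [:: boxpat (boxs phi 1 (n' * (kk * l * D))) 2] g)).
    by case: (Hps i).
  have {HK}[K HK] := choice HK; pose kk := (\sum_i K i).+1.
  have Kk i : (K i <= kk)%N by rewrite /kk (bigD1 i) //= leqW // leq_addr.
  have [N HN] := choice (fun i => HK i kk (Kk i) isT); pose n' := (\sum_i N i).+1.
  have Nn i : (N i <= n')%N by rewrite /n' (bigD1 i) //= leqW // leq_addr.
  pose L1 := (kk * l * D)%N; have L10 : (0 < L1)%N by rewrite !muln_gt0 l0 D_gt0.
  have l'0 : (0 < n' * L1)%N by rewrite muln_gt0 L10.
  have [ks [W [Xks HW]]] := IH (ltnW nK) _ l'0.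
  pose q := (D ^ n)%N.
  pose W' := (W + \sum_i \sum_(w : Om i) \sum_(a < (r_ i).+1) `|l1 (q%:Z *: ps i w a)|)%N.
  exists (kap :: ks), W'; split=> [k'|T phi f phiD f01 df].
    by rewrite inE => /orP[/eqP ->|/Xks].
  pose L' := (n' * L1)%N.
  have [gap|gap] := lerP (Phi phi (D ^ n.+1) l f - Phi phi q L' f) eta; last first.
    have [[k' k'ks [qs [x [H1 H2 H3 H4]]]]|[l'' Hl]] := HW T phi f phiD f01 df.
      left; exists k'; first by rewrite inE k'ks orbT.
      exists qs, x; split=> // i a ai; apply: le_trans (H2 i a ai) _.
      by rewrite lez_nat leq_addr.
    right; exists l''; rewrite -[n.+1%:R]natr1 mulrDl mul1r.
    have Hl' : n%:R * eta <= Phi phi q L' f - Phi phi 1 l'' f := Hl.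
    by have := lerD (ltW gap) Hl'; rewrite subrKA [eta + _]addrC.
  left; exists kap; first by rewrite inE eqxx.
  (* Rescaling by q = D^n turns the steps 1 and D of [configured] into D^n and D^(n+1). *)
  pose phi' i x := phi i (q%:Z *: x).
  have phi'D i : {morph phi' i : x y / x + y} by move=> x y; rewrite /phi' scalerDr phiD.
  have boxE i q' L : boxs (phi' i) q' L = boxs (phi i) (q * q') L.
    by apply/funext => y; rewrite /boxs /phi' scalerA PoszM.
  pose S i := Pattern (Om i) (r_ i).+1 (fun w (j : 'I_(r_ i).+1) => phi' i (ps i w j)).
  pose Q i := boxpat (boxs (phi' i) 1 L1) (r_ i).+1.
  have CQ i b : dominated R (bx phi q L' (i, b)) (bx phi q L1 (i, b)).
    have H e := @box_dominated R T _ (phi i) q 1 L1 n' e (phiD i) isT L10.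
    by move: H; rewrite !muln1 /bx /= => H; case: b; apply: H.
  have QA i b : dominated R (bx phi q L1 (i, b)) (bx phi (D ^ n.+1) l (i, b)).
    have H e := @box_dominated R T _ (phi i) q D l kk e (phiD i) D_gt0 l0.
    by move: H; rewrite -expnSr /bx /= => H; case: b; apply: H.
  have CA x : dominated R (bx phi q L' x) (bx phi (D ^ n.+1) l x).
    by case: x => i b g g01; apply: le_trans (CQ i b g g01) (QA i b g g01).
  have QE i : Q i = bx phi q L1 (i, true) by rewrite /Q boxE muln1.
  have St : stage c emin eta S Q (bx phi (D ^ n.+1) l) (bx phi q L') f.
    split=> //.
    - move=> e i g e1 e2 g01; have := HN i n' (Nn i) isT T (phi' i) g e c (phi'D i) g01 e1 e2 (cr i).
      by rewrite /Q !boxE !muln1 -expnSr; apply.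
    - by move=> i; rewrite QE; apply: CQ.
    - by move=> i; rewrite QE; apply: QA.
    move=> r Hr; pose kf := [ffun i : 'I_d => (nth (i, false) r (index i (enum 'I_d))).2].
    have szr : size r = size (enum 'I_d) by rewrite -Hr size_map.
    have rE : r = [seq (i, kf i) | i <- enum 'I_d].
      have [E0|[x0 _]] : r = [::] \/ exists x0 : 'I_d * bool, True.
      - by case: (r) => [|y r']; [left | right; exists y].
      - by rewrite -Hr E0.
      apply: (@eq_from_nth _ x0) => [|j jr]; first by rewrite size_map.
      have je : (j < size (enum 'I_d))%N by rewrite -szr.
      rewrite (nth_map x0.1) // ffunE index_uniq ?enum_uniq // -Hr (nth_map x0) //.
      by rewrite (set_nth_default x0) //; case: (nth x0 r j).
    rewrite {1 2}rE; apply: le_trans gap; rewrite /Phi -sumrB (bigD1 kf) //= lerDl.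
    by apply: sumr_ge0 => k' _; rewrite subr_ge0; apply: Lam_mono => // x _; apply: CA.
  have := Hdir T S Q _ _ f St (enum 'I_d) [::] 0%N (size_enum_ord d).
  rewrite cats0 rot0 => /(_ erefl (fun x H => False_ind _ H)); rewrite /= !cats0 => HL.
  have LQ : delta ^+ E <= Lam (map Q (enum 'I_d)) f.
    have := @Lam_boxes_ge R T 'I_d (enum 'I_d) (fun i => {ffun 'I_(m_ i) -> 'I_L1}) (fun i => boxs (phi' i) 1 L1) r_ f.
    move=> H; apply: le_trans (H _ _) => [|i|x]; [|exact: card_box|by case/andP: (f01 x)].
    by apply: lerXn2r => //; rewrite nnegrE; [exact: ltW | apply: avg_ge0 => x; case/andP: (f01 x)].
  have LS : 0 < Lam (map S (enum 'I_d)) f.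
    by move: HL; rewrite ler_norml => /andP[H1 _]; exact: half_loss H1 LQ gamma0.
  have [|qs [x [Hqs Hx]]] := Lam_pos (enum_uniq _) _ LS; first by move=> x; case/andP: (f01 x).
  have Hq i : exists w, qs i = ps i w by apply: Hqs; rewrite mem_enum.
  exists (fun i a => q%:Z *: qs i a), x; split.
  - move=> i; have [w ->] := Hq i.
    have -> : ps i w 0%N = 0 by case: (Hps i) => H _ _; exact: H.
    by rewrite scaler0.
  - move=> i a ai; have [w ->] := Hq i.
    apply: (@le_trans _ _ `|l1 (q%:Z *: ps i w a)|%N%:Z); first by rewrite abszE ler_norm.
    rewrite lez_nat /W' (bigD1 i) //= (bigD1 w) //= (bigD1 (Ordinal (ai : (a < (r_ i).+1)%N))) //=.
    by rewrite addnC -!addnA leq_addr.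
  - move=> i a b ai bi; have [w ->] := Hq i; rewrite dotZl dotZr.
    have -> : dot (ps i w a) (ps i w b) = (C ^ 2 * k)%:Z * dot (with0 (v_ i) a) (with0 (v_ i) b).
      by case: (Hps i) => _ H _; exact: H.
    rewrite !mulrA -!PoszM; congr (_%:Z * _).
    have -> : (D ^ Kn = D ^ (Kn - n) * D ^ n)%N by rewrite -expnD subnK // ltnW.
    rewrite /k /q [(2 * _)%N]mulnC expnM !expnS !expn0.
    by move: (D ^ n)%N (D ^ (Kn - n))%N => A1 A2; ring.
  move=> j jr; have := Hx j jr; by rewrite big_enum.
have [ks [W [Xks H]]] := claim Kn (leqnn _) 1%N isT.
exists ks, W; split=> // T phi f phiD f01 df.
have [//|[l' Hl]] := H T phi f phiD f01 df.
have /andP[_ H1] := Phi_bounds phi (D ^ Kn) 1 f01; have /andP[H2 _] := Phi_bounds phi 1 l' f01.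
have := lt_le_trans HKn (le_trans Hl (lerB H1 H2)); rewrite subr0 ltxx.
done.
Qed.
End Copies.

From mathcomp Require Import all_classical all_reals all_analysis.
Import numFieldNormedType.Exports.
Local Open Scope classical_set_scope.
Local Open Scope ring_scope.

(** * From the torus to the integer lattice *)

Lemma euclid_dot (R : realType) m (v w : 'rV[int]_m) :
  euclid (intvec R v - intvec R w) = Num.sqrt ((dot (v - w) (v - w))%:~R).
Proof.
congr Num.sqrt; rewrite /dot rmorph_sum; apply: eq_bigr => j _.
by rewrite !mxE rmorphM rmorphB expr2.
Qed.

Definition dilates (R : realType) m (lam : R) (k : nat) (p q : 'I_k -> 'rV[int]_m) :=
  forall a b, (dot (q a - q b) (q a - q b))%:~R = lam ^+ 2 * (dot (p a - p b) (p a - p b))%:~R.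

Lemma dot_ge0 m (v : 'rV[int]_m) : 0 <= dot v v.
Proof. by apply: sumr_ge0 => i _; rewrite -expr2 sqr_ge0. Qed.

Lemma euclid_scale (R : realType) m (lam : R) (v w v' w' : 'rV[int]_m) : 0 <= lam ->
  euclid (intvec R v' - intvec R w') = lam * euclid (intvec R v - intvec R w) <->
  (dot (v' - w') (v' - w'))%:~R = lam ^+ 2 * (dot (v - w) (v - w))%:~R :> R.
Proof.
move=> lam0; rewrite !euclid_dot.
have d0 u : 0 <= (dot u u : int)%:~R :> R by rewrite ler0z dot_ge0.
split=> [/(congr1 (fun x => x ^+ 2))|->]; first by rewrite exprMn !sqr_sqrtr.
by rewrite sqrtrM ?sqr_ge0 // sqrtr_sqr ger0_norm.
Qed.

(** Dilation preserves coincidences in both directions, so sending p a to q a is well defined and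
    injective. *)
Lemma simplex_copy (R : realType) m (lam : R) k (p q : 'I_k -> 'rV[int]_m) : 0 < lam ->
  dilates lam p q -> isometric_copy lam (range p) (range q).
Proof.
move=> lam0 H.
have qp a b : (q a == q b) = (p a == p b).
  have := H a b; rewrite -[q a == q b]subr_eq0 -[p a == p b]subr_eq0 -!dot_eq0.
  rewrite -(intr_eq0 R (dot (q a - q b) _)) => ->; rewrite mulf_eq0 intr_eq0.
  by rewrite expf_eq0 /= gt_eqF.
have [phi Hphi] : exists phi : 'rV[int]_m -> 'rV[int]_m, forall a, phi (p a) = q a.
  have /choice[phi Hphi] v : exists w, forall a, p a = v -> w = q a.
    have [[a Ha]|N] := pselect (exists a, p a = v); last by exists 0 => a Ha; case: N; exists a.
    by exists (q a) => b Hb; apply/eqP; rewrite qp Ha Hb.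
  by exists phi => a; apply: (Hphi (p a)).
exists phi; split; first split.
- by move=> _ [a _ <-]; exists a.
- move=> _ _ /set_mem[a _ <-] /set_mem[b _ <-]; rewrite !Hphi => /eqP; rewrite qp => /eqP //.
- by move=> _ [a _ <-]; exists (p a); [exists a | rewrite Hphi].
move=> _ _ [a _ <-] [b _ <-]; rewrite !Hphi; apply/euclid_scale; first exact: ltW.
exact: H.
Qed.

Lemma dot_blocks d (m_ : 'I_d -> nat) (x : 'rV[int]_(\sum_i m_ i)) :
  dot x x = \sum_i dot (submxrow x i) (submxrow x i).
Proof.
have := dot_mx x x; rewrite -{1 2}[x]submxrowK tr_mxrow mul_mxrow_mxcol.
rewrite (eq_bigr (fun i => (dot (submxrow x i) (submxrow x i))%:M)) => [|i _]; last exact: dot_mx.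
move=> /(congr1 (fun A : 'M[int]_1 => A ord0 ord0)); rewrite summxE !mxE eqxx mulr1n => <-.
by apply: eq_bigr => i _; rewrite !mxE eqxx mulr1n.
Qed.

Lemma product_copy (R : realType) d (m_ : 'I_d -> nat) (lam : R) (A A' : forall i, set 'rV[int]_(m_ i)) :
  0 <= lam -> (forall i, isometric_copy lam (A i) (A' i)) -> isometric_copy lam (block_prod A) (block_prod A').
Proof.
move=> lam0 H; pose phi i := sval (cid (H i)); have Hphi i := svalP (cid (H i)).
pose Phi (x : 'rV[int]_(\sum_i m_ i)) : 'rV[int]_(\sum_i m_ i) := \mxrow_i phi i (submxrow x i).
have sub x i : submxrow (Phi x) i = phi i (submxrow x i) by rewrite mxrowK.
have ext (x y : 'rV[int]_(\sum_i m_ i)) : (forall i, submxrow x i = submxrow y i) -> x = y.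
  by move=> E; rewrite -[x]submxrowK -[y]submxrowK; apply: eq_mxrow.
exists Phi; split; first split.
- move=> x Ax i; rewrite sub; have [[fA _ _] _] := Hphi i; exact: fA.
- move=> x y /set_mem Ax /set_mem Ay E; apply: ext => i; have [[_ fI _] _] := Hphi i.
  apply: fI; rewrite ?inE; [exact: Ax | exact: Ay |].
  by rewrite -[LHS](sub x i) -[RHS](sub y i) E.
- move=> y Ay; have Hy i : exists x, A i x /\ phi i x = submxrow y i.
    by have [[_ _ fS] _] := Hphi i; have [x Ax E] := fS _ (Ay i); exists x.
  exists (\mxrow_i sval (cid (Hy i))).
    by move=> i; rewrite mxrowK; case: (svalP (cid (Hy i))).
  by apply: ext => i; rewrite sub mxrowK; case: (svalP (cid (Hy i))).
move=> v w Av Aw; apply/euclid_scale => //.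
rewrite !dot_blocks !rmorph_sum mulr_sumr; apply: eq_bigr => i _.
rewrite !submxrowB !sub; apply/euclid_scale => //.
by have [_ H'] := Hphi i; apply: H'; [exact: Av | exact: Aw].
Qed.

Definition seqpt m k (p : 'I_k -> 'rV[int]_m) a := if insub a is Some a' then p a' else 0.

Lemma seqptE m k (p : 'I_k -> 'rV[int]_m) (a : 'I_k) : seqpt p a = p a.
Proof. by rewrite /seqpt valK. Qed.

(** A rational relation among the edges is a real affine relation among the vertices with
    coefficient 1 at p_(j+1); the coefficient at p_0 balances the sum. *)
Lemma edges_independent (R : realType) m r (p : 'I_r.+1 -> 'rV[int]_m) :
  affinely_independent (fun i => intvec R (p i)) ->
  forall j, (j < r)%N -> ~~ (iv (seqpt p j.+1 - seqpt p 0) <= \sum_(l < j) <<iv (seqpt p l.+1 - seqpt p 0%N)>>)%MS.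
Proof.
move=> aff j jr; apply/negP => /sub_sumsmxP[w Ew].
pose v l := seqpt p l.+1 - seqpt p 0%N.
have Ha (l : 'I_j) : exists a, w l *m <<iv (v l)>>%MS = a *: iv (v l).
  by apply/sub_rVP; apply: submx_trans (submxMl _ _) _; rewrite genmxE.
have [a Ea] := choice Ha.
pose b i : R := if (i == j)%N then 1 else if insub i is Some l then - ratr (a l) else 0.
pose c (i : 'I_r.+1) : R := if (i : nat) is i'.+1 then b i' else - \sum_(i < r) b i.
have iR (x : 'rV[int]_m) : intvec R x = map_mx ratr (iv x).
  by apply/rowP => k; rewrite !mxE ratr_int.
have bv : \sum_(i < r) b i *: intvec R (v i) = 0.
  rewrite -(big_mkord predT (fun i => b i *: intvec R (v i))) (big_cat_nat (n := j.+1)) //=.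
  rewrite [X in _ + X]big_nat [X in _ + X]big1 => [|i /andP[ji _]]; last first.
    rewrite /b gtn_eqF // insubF ?scale0r //; lia.
  rewrite addr0 big_nat_recr //= {2}/b eqxx scale1r big_mkord iR Ew raddf_sum -big_split /=.
  rewrite big1 // => l _; rewrite Ea {1}/b ltn_eqF // valK iR.
  by apply/rowP => k; rewrite !mxE rmorphM /= mulNr addNr.
have : c (Ordinal (jr : (j.+1 < r.+1)%N)) = 0.
  apply: aff; first by rewrite big_ord_recl /= addNr.
  rewrite big_ord_recl /= /c /= scaleNr scaler_suml -sumrN -big_split /=; apply: etrans bv.
  apply: eq_bigr => i _; rewrite -(seqptE p (lift ord0 i)) -(seqptE p ord0) addrC -scalerBr.
  by congr (_ *: _); rewrite /v; apply/rowP => k; rewrite !mxE rmorphB.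
by rewrite /c /= /b eqxx => /eqP; rewrite oner_eq0.
Qed.

Section Transfer.
Variables (R : realType) (d : nat) (m_ : 'I_d -> nat) (N' : nat).
Local Notation n := (\sum_i m_ i)%N.
Let Mo := (N'.*2).+2.
(** The modulus 2N' + 2 exceeds (N' + 1) + W for W at most N', which leaves room for a point of the
    cube and a displacement. *)
Let T : finZmodType := 'rV['I_((N'.*2).+2)]_n.

Definition emb i (x : 'rV[int]_(m_ i)) : 'rV[int]_n := \mxrow_k eqtype.dfwith (fun k => 0 : 'rV[int]_(m_ k)) x k.
Definition red (x : 'rV[int]_n) : T := map_mx intr x.

Lemma embD i : {morph @emb i : x y / x + y}.
Proof.
move=> x y; rewrite /emb -mxrowD; apply: eq_mxrow => k.
have [<-|ik] := eqVneq i k; first by rewrite !eqtype.dfwith_in.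
by rewrite !eqtype.dfwith_out // addr0.
Qed.
Lemma emb_0 i : emb (0 : 'rV[int]_(m_ i)) = 0.
Proof. by apply: (addrI (emb (0 : 'rV[int]_(m_ i)))); rewrite -embD !addr0. Qed.
Lemma sum_emb (x : forall i, 'rV[int]_(m_ i)) : \sum_i emb (x i) = \mxrow_i x i.
Proof.
rewrite -mxrow_sum; apply: eq_mxrow => k; rewrite (bigD1 k) //= eqtype.dfwith_in big1 ?addr0 // => i ik.
by rewrite eqtype.dfwith_out.
Qed.
Lemma redD : {morph red : x y / x + y}.
Proof. by move=> x y; apply/rowP => k; rewrite !mxE rmorphD. Qed.
Lemma red_sum (I : finType) (F : I -> 'rV[int]_n) : red (\sum_i F i) = \sum_i red (F i).
Proof. by apply: (big_morph red redD); apply/rowP => k; rewrite !mxE. Qed.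
Lemma red_inj x y : red x = red y -> (forall j, `|x 0 j - y 0 j| < Mo%:Z) -> x = y.
Proof.
move=> /rowP E H; apply/rowP => j; have := E j; rewrite !mxE => /eqP.
rewrite -subr_eq0 -rmorphB /=; move: (H j); move: (x 0 j - y 0 j) (subr_eq0 (x 0 j) (y 0 j)) => z zE zM.
suff H0 : (z%:~R : 'I_Mo) = 0 -> z = 0 by move=> /eqP/H0/eqP; rewrite zE => /eqP.
have nat0 (a : nat) : (a < Mo)%N -> (a%:R : 'I_Mo) = 0 -> a = 0%N.
  by move=> aM; have := Zp_nat N'.*2 a => -> /(congr1 val) /=; rewrite modn_small.
case: z zM {zE} => a aM; first by rewrite -pmulrn => /nat0 ->.
rewrite NegzE mulrNz => /eqP; rewrite oppr_eq0 -pmulrn => /eqP /nat0 H1.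
by have := H1 _; move: aM; rewrite NegzE normrN; lia.
Qed.

Lemma transfer (r_ : 'I_d -> nat) (v_ : forall i, nat -> 'rV[int]_(m_ i)) q0 W (ks : seq nat) (delta : R)
    (S : set 'rV[int]_n) (s : seq 'rV[int]_n) (o : 'rV[int]_n) :
  (forall (T : finZmodType) (phi : forall i, 'rV[int]_(m_ i) -> T) (f : T -> R),
      (forall i, {morph phi i : x y / x + y}) -> (forall x, in01 (f x)) -> delta <= avg f ->
      exists2 k, k \in ks & copy_at r_ v_ phi f q0 W k) ->
  (W <= N')%N -> uniq s -> (forall x, x \in s -> S x /\ forall j, o 0 j <= x 0 j <= o 0 j + N'.+1%:Z) ->
  delta * (2 * N'.+1)%:R ^+ n <= (size s)%:R ->
  exists2 k, k \in ks & exists (qs : forall i, nat -> 'rV[int]_(m_ i)) s0,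
    (forall i a b, (a <= r_ i)%N -> (b <= r_ i)%N ->
        dot (qs i a) (qs i b) = (q0 ^ 2 * k)%:Z * dot (with0 (v_ i) a) (with0 (v_ i) b)) /\
    forall j : 'I_d -> nat, (forall i, (j i <= r_ i)%N) -> S (s0 + \mxrow_i qs i (j i)).
Proof.
move=> H WN us Hs sz; pose f (x : T) : R := (x \in map red s)%:R.
have in_gap x y j : x \in s -> y \in s -> `|x 0 j - y 0 j| <= N'.+1%:Z.
  by move=> /Hs[_ /(_ j)] /andP[? ?] /Hs[_ /(_ j)] /andP[? ?]; lia.
have inj : {in s &, injective red}.
  move=> x y xs ys E; apply: red_inj E _ => j; apply: le_lt_trans (in_gap x y j xs ys) _.
  by rewrite ltz_nat /Mo -addnn !ltnS leq_addr.
have [|||k kks [qs [x [q00 qW gram pos]]]] := H T (fun i x => red (emb x)) f.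
- by move=> i x y; rewrite embD redD.
- by move=> x; rewrite /f; case: (_ \in _); rewrite /in01 ?ler01 ?lexx.
- rewrite /avg /f -natr_sum; have -> : (\sum_(i : T) (i \in map red s) = size s)%N.
    have us' : uniq (map red s) by rewrite map_inj_in_uniq.
    rewrite -(size_map red) -(card_uniqP us') -sum1_card [RHS]big_mkcond; apply: eq_bigr => i _.
    by case: (_ \in _).
  rewrite card_mx mul1n card_ord ler_pdivlMr ?ltr0n ?expn_gt0 // natrX.
  by apply: le_trans sz; rewrite le_eqVlt; apply/orP; left; apply/eqP; congr (_ * _%:R ^+ _); lia.
exists k => //.
have posj j : (forall i, (j i <= r_ i)%N) -> exists2 y, y \in s & red y = x + red (\mxrow_i qs i (j i)).
  move=> jr; have := pos j jr; rewrite -red_sum sum_emb /f ltr0n lt0b => /mapP[y ys ->].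
  by exists y.
have [s0 s0s Es0] := posj (fun=> 0%N) (fun=> leq0n _).
have emb0 : \mxrow_i qs i 0%N = 0 :> 'rV[int]_n.
  rewrite -sum_emb; apply: big1 => i _.
  have -> : qs i 0%N = 0 := q00 i.
  exact: emb_0.
have red0 : red 0 = 0 by apply: (addrI (red 0)); rewrite -redD !addr0.
have Ex : x = red s0 by rewrite Es0 emb0 red0 addr0.
exists qs, s0; split=> // j jr; have [y ys Ey] := posj j jr.
(* The congruence modulo 2N' + 2 is an equality: y and s0 lie in a common cube of side N' + 1, and
   the displacement is at most W. *)
suff <- : y = s0 + \mxrow_i qs i (j i) by case: (Hs y ys).
apply: red_inj; first by rewrite redD -Ex.
move=> l; have H1 := in_gap y s0 l ys s0s.
have H2 : `|(\mxrow_i qs i (j i) : 'rV[int]_n) 0 l| <= W%:Z.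
  rewrite mxE; apply: le_trans (qW (tagnat.sig1 l) _ (jr (tagnat.sig1 l))).
  by rewrite /l1 (bigD1 (tagnat.sig2 l)) //= lerDl sumr_ge0.
rewrite [(s0 + _) 0 l]mxE opprD addrA; apply: le_lt_trans (ler_normB _ _) _.
apply: le_lt_trans (lerD H1 H2) _; rewrite -PoszD ltz_nat /Mo -addnn.
by move: WN; clear; lia.
Qed.
End Transfer.

(** * Dense cubes from the upper Banach density *)

Section Density.
Variable R : realType.

(** [fset_set] sends an infinite set to the empty one, so a positive count certifies finiteness. *)
Lemma card_set_finite (T : choiceType) (A : set T) : (0 < card_set A)%N -> finite_set A.
Proof. by rewrite /card_set /fset_set; case: pselect => // H; rewrite cardfs0. Qed.

Lemma card_cube n N : (0 < card_set (@cube R n N))%N -> (N ^ n <= card_set (@cube R n N))%N.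
Proof.
move=> /card_set_finite fin.
pose g (y : {ffun 'I_n -> 'I_N}) : 'rV[int]_n := \row_j ((y j : nat)%:Z - N./2%:Z).
have g_inj : injective g.
  move=> y y' /rowP E; apply/ffunP => j; apply: val_inj; have := E j; rewrite !mxE => /addIr.
  by case.
have -> : (N ^ n = size [seq g y | y <- enum {ffun 'I_n -> 'I_N}])%N.
  by rewrite size_map -cardE card_ffun !card_ord.
apply: uniq_leq_size; first by rewrite map_inj_uniq // enum_uniq.
move=> _ /mapP[y _ ->]; rewrite in_fset_set // inE => j; rewrite mxE.
have h1 : (N./2 * 2 <= N)%N by have := odd_double_half N; lia.
have h2 : (y j <= N./2 * 2)%N by have := ltn_ord (y j); have := odd_double_half N; case: (odd N) => /=; lia.
have h1' : N./2%:R * 2 <= N%:R :> R by rewrite -natrM ler_nat.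
have h2' : (y j : nat)%:R <= N./2%:R * 2 :> R by rewrite -natrM ler_nat.
have h3 : 0 <= (y j : nat)%:R :> R by rewrite ler0n.
by rewrite rmorphB /= -!pmulrn; split; lra.
Qed.

(** A cube of density above delta/2 is passed to a torus of side 2(N + 1), at most 4N, whence the
    factor 4^n. *)
Lemma dense_cube n (S : set 'rV[int]_n) (delta : R) N1 : 0 < delta -> delta <= upper_Banach_density R S ->
  exists2 N, (N1 <= N)%N & exists (s : seq 'rV[int]_n) (o : 'rV[int]_n),
    [/\ uniq s, forall x, x \in s -> S x /\ forall j, o 0 j <= x 0 j <= o 0 j + N.+1%:Z &
      delta / 2 / (4 ^ n)%:R * (2 * N.+1)%:R ^+ n <= (size s)%:R].
Proof.
move=> d0; rewrite /upper_Banach_density; set F := (fun N : nat => sup _) => dF.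
have [N [NN FN]] : exists N, (maxn N1 1 <= N)%N /\ delta / 2 < F N.
  apply/not_existsP => H.
  have FH N : (maxn N1 1 <= N)%N -> F N <= delta / 2.
    by move=> HN; rewrite leNgt; apply/negP => H'; apply: (H N).
  (* Without convergence [lim] takes its default value 0, which contradicts the positive lower
     bound. *)
  have [cv|ncv] := pselect (cvg (F @ \oo)).
    have : lim (F @ \oo) <= delta / 2.
      by apply: limr_le => //; exists (maxn N1 1) => // N; apply: FH.
    by move=> /(le_trans dF); lra.
  by move: dF; rewrite dvgP // leNgt d0.
move: NN; rewrite geq_max => /andP[N1N N0].
have [|_ [t _ <-] Ht] := sup_gt _ FN; first by exists ((card_set (in_translate S N (0 : 'rV[R]_n)))%:R / (card_set (@cube R n N))%:R); exists 0.
exists N => //; set A := in_translate S N t in Ht.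
have c0 : (0 < card_set (@cube R n N))%N.
  by rewrite lt0n; apply: contraTneq Ht => ->; rewrite invr0 mulr0 -leNgt divr_ge0 ?ltW.
have a0 : (0 < card_set A)%N.
  by rewrite lt0n; apply: contraTneq Ht => ->; rewrite mul0r -leNgt divr_ge0 ?ltW.
have finA := card_set_finite a0.
exists (enum_fset (fset_set A)), (\row_j Num.floor (t 0 j - N%:R / 2)); split.
- exact: fset_uniq.
- move=> x xA; have : x \in A by rewrite -(in_fset_set finA).
  rewrite inE => -[Sx [y cy Exy]]; split=> // j; rewrite mxE.
  have := congr1 (fun u : 'rV[R]_n => u ord0 j) Exy; rewrite !mxE => Ej.
  have [c1 c2] := cy j; set z := Num.floor _.
  have z1 : z%:~R <= t 0 j - N%:R / 2 by apply: floor_le_tmp.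
  have z2 : t 0 j - N%:R / 2 < (z + 1)%:~R by apply: floorD1_gt.
  apply/andP; split; first by rewrite -(ler_int R); move: (x 0 j) Ej => x0 Ej; lra.
  rewrite -ltzD1 -(ltr_int R) !rmorphD /= -pmulrn; move: z2; rewrite rmorphD /= -[N.+1%:R]natr1.
  by move: (x 0 j) Ej => x0 Ej; lra.
apply: (@le_trans _ _ (delta / 2 * (card_set (@cube R n N))%:R)); last first.
  by move: Ht; rewrite ltr_pdivlMr ?ltr0n //; apply: ltW.
rewrite -[delta / 2 / _ * _]mulrA ler_pM2l ?divr_gt0 // mulrC ler_pdivrMr ?ltr0n ?expn_gt0 //.
rewrite -natrX -natrM ler_nat; apply: leq_trans (leq_mul (card_cube c0) (leqnn _)).
have N4 : (2 * N.+1 <= N * 4)%N by move: N0; clear; lia.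
by rewrite -expnMn; have [->|n0] := posnP n; rewrite ?expn0 // leq_exp2r.
Qed.
End Density.

(** * Assembly for products of simplices in the integer lattice *)

Section Products.
Variables (R : realType) (d : nat) (n_ : 'I_d -> nat).
Local Notation m_ := (fun i => (2 * n_ i + 3)%N).
Local Notation n := (\sum_(i < d) (2 * n_ i + 3))%N.
Variables (p : forall i, 'I_(n_ i) -> 'rV[int]_(2 * n_ i + 3)).
Arguments p : clear implicits.
Hypothesis aff : forall i, affinely_independent (fun a => intvec R (p i a)).
Let Delta i : set 'rV[int]_(2 * n_ i + 3) := range (p i).
Arguments Delta : clear implicits.
Let v_ i j : 'rV[int]_(2 * n_ i + 3) := seqpt (p i) j.+1 - seqpt (p i) 0.

Lemma independent i : (0 < n_ i)%N -> forall j, (j < (n_ i).-1)%N ->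
  ~~ (iv (v_ i j) <= \sum_(l < j) <<iv (v_ i l)>>)%MS.
Proof.
rewrite /v_; move: (p i) (@aff i); move: (2 * n_ i + 3)%N; case: (n_ i) => // r m q Hq _.
exact: edges_independent Hq.
Qed.

Lemma gram_dilates i (lam : R) (K : nat) (qs : nat -> 'rV[int]_(2 * n_ i + 3)) s0 : lam ^+ 2 = K%:R ->
  (forall a b, (a < n_ i)%N -> (b < n_ i)%N ->
     dot (qs a) (qs b) = K%:Z * dot (with0 (v_ i) a) (with0 (v_ i) b)) ->
  dilates lam (p i) (fun a => s0 + qs a).
Proof.
move=> lamK H a b; have E : s0 + qs a - (s0 + qs b) = qs a - qs b by rewrite opprD addrACA subrr add0r.
have V (c : 'I_(n_ i)) : with0 (v_ i) c = p i c - seqpt (p i) 0.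
  rewrite -seqptE; case: c => -[|c] //= _.
  by rewrite subrr.
have -> : p i a - p i b = with0 (v_ i) a - with0 (v_ i) b by rewrite !V opprB addrA subrK.
rewrite E lamK (_ : K%:R = K%:Z%:~R) // -rmorphM /=; congr (_%:~R).
by rewrite !dotDl !dotDr !dotNl !dotNr !H //; ring.
Qed.

Lemma product_of_gram (S : set 'rV[int]_n) (lam : R) (K : nat)
    (qs : forall i, nat -> 'rV[int]_(2 * n_ i + 3)) s0 : 0 < lam -> lam ^+ 2 = K%:R ->
  (forall i a b, (a < n_ i)%N -> (b < n_ i)%N ->
     dot (qs i a) (qs i b) = K%:Z * dot (with0 (v_ i) a) (with0 (v_ i) b)) ->
  (forall j : 'I_d -> nat, (forall i, (j i < n_ i)%N) -> S (s0 + \mxrow_i qs i (j i))) ->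
  contains_product_copy S lam Delta.
Proof.
move=> lam0 lamK gram pos; pose A i := range (fun a : 'I_(n_ i) => submxrow s0 i + qs i a).
have HA i : isometric_copy lam (Delta i) (A i).
  by apply: simplex_copy => //; apply: gram_dilates lamK _; apply: gram.
exists (block_prod A); split; [|apply: product_copy => //; exact: ltW|by exists A].
move=> x Ax; have /choice[j Hj] i : exists a, (a < n_ i)%N /\ submxrow x i = submxrow s0 i + qs i a.
  by have [a _ E] := Ax i; exists a.
have -> : x = s0 + \mxrow_i qs i (j i).
  rewrite -[x]submxrowK -[s0]submxrowK -mxrowD; apply: eq_mxrow => i.
  by rewrite (Hj i).2.
by apply: pos => i; case: (Hj i).
Qed.

(** Serves the degenerate case in which some factor has no points: the product is then empty, yet
    copies of all factors must be exhibited. *)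
Lemma single_copies i : exists2 q, (0 < q)%N & forall k (lam : R), (0 < k)%N -> 0 < lam ->
  lam ^+ 2 = (q ^ 2 * k)%:R -> exists A, isometric_copy lam (Delta i) A.
Proof.
have [n0|n0] := posnP (n_ i).
  exists 1%N => // k lam _ lam0 _; exists (range (p i)); apply: simplex_copy => // a.
  by exfalso; have := leq_ltn_trans (leq0n a) (ltn_ord a); rewrite n0.
have E : (2 * n_ i + 3 = 2 * (n_ i).-1 + 5)%N by lia.
have [E0 [e0 [q [_ q0 _ H]]]] := scaled_copies E (independent n0).
exists q => // k lam k0 lam0 lamk; have [a [Ga _]] := H k k0.
exists (range (fun c : 'I_(n_ i) => 0 + with0 a c)); apply: simplex_copy => //.
apply: gram_dilates lamk _ => -[|b] [|c] bn cn; rewrite ?dot0l ?dot0r ?mulr0 //=.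
by apply: Ga; lia.
Qed.

Lemma empty_product i (S : set 'rV[int]_n) (lam : R) : n_ i = 0%N -> 0 < lam ->
  (forall i, exists A, isometric_copy lam (Delta i) A) -> contains_product_copy S lam Delta.
Proof.
move=> n0 lam0 H; pose A i := sval (cid (H i)); have HA i : isometric_copy lam (Delta i) (A i) := svalP (cid (H i)).
exists (block_prod A); split; [|apply: product_copy => //; exact: ltW|by exists A].
move=> x /(_ i); have [phi [[_ _ surj] _]] := HA i.
by move=> /surj[_ [a _ _] _]; exfalso; have := leq_ltn_trans (leq0n a) (ltn_ord a); rewrite n0.
Qed.

Lemma finite_product_copies (delta : R) : (forall i, (0 < n_ i)%N) -> 0 < delta -> exists2 q0, (0 < q0)%N &
  forall X : nat -> Prop, (forall N, exists k, (N <= k)%N /\ X k) ->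
  exists (ks : seq nat) (W : nat), (forall k, k \in ks -> X k) /\
    forall N (S : set 'rV[int]_n) (s : seq 'rV[int]_n) (o : 'rV[int]_n), (W <= N)%N -> uniq s ->
      (forall x, x \in s -> S x /\ forall j, o 0 j <= x 0 j <= o 0 j + N.+1%:Z) ->
      delta * (2 * N.+1)%:R ^+ n <= (size s)%:R ->
      exists2 k, k \in ks & forall lam : R, 0 < lam -> lam ^+ 2 = (q0 ^ 2 * k)%:R -> contains_product_copy S lam Delta.
Proof.
move=> n0 d0; have mE i : (2 * n_ i + 3 = 2 * (n_ i).-1 + 5)%N by have := n0 i; lia.
have [q0 q00 H] := @finite_copies R d (fun i => (n_ i).-1) m_ v_ mE (fun i => independent (n0 i)) delta d0.
exists q0 => // X HX; have [ks [W [Xks HW]]] := H X HX; exists ks, W; split=> // N S s o WN us Hs sz.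
have [k kks [qs [s0 [gram pos]]]] := transfer HW WN us Hs sz.
exists k => // lam lam0 lamk; apply: (product_of_gram lam0 lamk (qs := qs) (s0 := s0)) => [i a b an bn|j jn].
  by apply: gram; have := n0 i; lia.
by apply: pos => i; have := jn i; lia.
Qed.

(** If no threshold existed, the bad [k] would be unbounded; a finite set of them would serve every
    dense large cube, and a cube of [S] would contain a copy for a bad [k]. *)
Lemma large_copies (delta : R) : 0 < delta -> exists2 q0, (0 < q0)%N &
  forall S : set 'rV[int]_n, delta <= upper_Banach_density R S ->
  exists L : nat, forall k (lam : R), (L <= k)%N -> 0 < lam -> lam ^+ 2 = (q0 ^ 2 * k)%:R ->
    contains_product_copy S lam Delta.
Proof.
move=> d0; have [n0|/existsNP[i n0]] := pselect (forall i, (0 < n_ i)%N); last first.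
  have /choice[q Hq] j : exists q, (0 < q)%N /\ forall k (lam : R), (0 < k)%N -> 0 < lam ->
      lam ^+ 2 = (q ^ 2 * k)%:R -> exists A, isometric_copy lam (Delta j) A.
    by have [q q0 H] := single_copies j; exists q.
  exists (\prod_j q j)%N; first by apply: prodn_gt0 => j; case: (Hq j).
  move=> S _; exists 1%N => k lam k0 lam0 lamk.
  apply: (@empty_product i) => // [|j]; first by apply/eqP; rewrite eqn0Ngt; apply/negP.
  case: (Hq j) => qj H; apply: (H ((\prod_(j' | j' != j) q j') ^ 2 * k)%N) => //.
    by rewrite muln_gt0 k0 expn_gt0 prodn_gt0 // => j'; case: (Hq j').
  by rewrite lamk (bigD1 j) //= expnMn mulnA.
have d1 : 0 < delta / 2 / (4 ^ n)%:R by rewrite !divr_gt0 // ltr0n expn_gt0.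
have [q0 q00 H] := finite_product_copies n0 d1.
exists q0 => // S dS; apply: contrapT => /forallNP bad.
pose X k := ~ forall lam : R, 0 < lam -> lam ^+ 2 = (q0 ^ 2 * k)%:R -> contains_product_copy S lam Delta.
have [N|ks [W [Xks HW]]] := H X.
  apply: contrapT => /forallNP H'; case: (bad N) => k lam Nk lam0 lamk.
  apply: contrapT => H2; apply: (H' k); split=> // H3; apply: H2; exact: H3.
have [N WN [s [orig [us Hs sz]]]] := dense_cube W d0 dS.
by have [k kks Hk] := HW N S s orig WN us Hs sz; apply: (Xks k kks).
Qed.

Lemma small_copies (delta : R) : 0 < delta -> exists N0 : nat, forall N, (N0 <= N)%N ->
  forall S : set 'rV[int]_n, (forall x, S x -> forall j, 1 <= x ord0 j /\ x ord0 j <= N%:Z) ->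
    delta * N%:R ^+ n <= (card_set S)%:R ->
    exists lam : R, [/\ sqrtN lam, 1 <= lam, lam <= N%:R & contains_product_copy S lam Delta].
Proof.
move=> d0; have [n0|/existsNP[i n0]] := pselect (forall i, (0 < n_ i)%N); last first.
  exists 1%N => N N1 S _ _; exists 1; split=> //; first by split=> //; exists 1; rewrite expr1n.
    by rewrite ler1n.
  apply: (@empty_product i) => // [|j]; first by apply/eqP; rewrite eqn0Ngt; apply/negP.
  by exists (range (p j)); apply: simplex_copy => // a b; rewrite expr1n mul1r.
(* The torus around {1..N}^n has side 2N, so the density drops by 2^n. *)
have d1 : 0 < delta / (2 ^ n)%:R by rewrite divr_gt0 // ltr0n expn_gt0.
have [q0 q00 H] := finite_product_copies n0 d1.
have [N|ks [W [ks0 HW]]] := H (fun k => (0 < k)%N); first by exists N.+1; rewrite leqnSn.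
exists (W + (\sum_(k <- ks) q0 * k).+1)%N => N NN S HS sz.
have Ngt : (0 < N)%N by lia.
have fin : finite_set S.
  apply: card_set_finite; rewrite -(ltr0n R); apply: lt_le_trans sz.
  by rewrite mulr_gt0 // exprn_gt0 // ltr0n.
have [||x||k kks Hk] := HW N.-1 S (enum_fset (fset_set S)) (const_mx 1).
- by lia.
- exact: fset_uniq.
- move=> xS; have : x \in S by rewrite -(in_fset_set fin).
  rewrite inE => Sx; split=> // j; rewrite !mxE prednK //; have [h1 h2] := HS x Sx j.
  by apply/andP; split; [exact: h1 | apply: le_trans h2 _; rewrite lerDr].
- rewrite prednK //; apply: le_trans sz; rewrite natrM exprMn mulrA natrX divfK //.
(* As sqrt k is at most k, this dilation is at most q0 k, which the bound on N dominates for every k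
   in [ks]. *)
have k0 := ks0 k kks; pose lam : R := q0%:R * Num.sqrt k%:R.
have lamk : lam ^+ 2 = (q0 ^ 2 * k)%:R by rewrite exprMn sqr_sqrtr ?ler0n // -natrX -natrM.
have lam0 : 0 < lam by rewrite mulr_gt0 ?ltr0n // sqrtr_gt0 ltr0n.
have K1 : (0 < q0 ^ 2 * k)%N by rewrite muln_gt0 expn_gt0 q00.
exists lam; split; [|..|exact: Hk].
- by split=> //; exists (q0 ^ 2 * k)%:Z; rewrite lamk.
- by rewrite -(@ler_sqr _ 1) ?nnegrE ?(ltW lam0) // expr1n lamk ler1n.
have kN : (q0 * k <= N)%N.
  apply: leq_trans NN; rewrite (big_rem k kks) /=; lia.
apply: (@le_trans _ _ (q0 * k)%:R); last by rewrite ler_nat.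
rewrite natrM ler_pM2l ?ltr0n // -[leRHS]ger0_norm ?ler0n // -sqrtr_sqr ler_sqrt ?sqr_ge0 //.
by rewrite -natrX ler_nat -{1}[k]expn1 leq_pexp2l.
Qed.
End Products.

Theorem theorem1p4 (R : realType) (d : nat) (n_ : 'I_d -> nat)
    (Delta : forall i : 'I_d, set 'rV[int]_(2 * n_ i + 3)) :
  (1 <= d)%N ->
  (forall i, nondegenerate_simplex R (n_ i) (Delta i)) ->
  let n := (\sum_(i < d) (2 * n_ i + 3))%N in
  exists lambda0 : set 'rV[int]_n -> int,
  forall delta : R, 0 < delta -> delta <= 1 ->
    (exists q0 : int, 0 < q0 /\
       forall S : set 'rV[int]_n,
         delta <= upper_Banach_density R S ->
         forall lam : R, sqrtN lam -> (lambda0 S)%:~R <= lam ->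
           contains_product_copy S (q0%:~R * lam) Delta)
    /\
    (exists N0 : nat, forall N : nat, (N0 <= N)%N ->
       forall S : set 'rV[int]_n,
         (forall x, S x -> forall j, 1 <= x ord0 j /\ x ord0 j <= N%:Z) ->
         delta * N%:R ^+ n <= (card_set S)%:R ->
         exists lam : R,
           [/\ sqrtN lam, 1 <= lam, lam <= N%:R &
               contains_product_copy S lam Delta]).
Proof.
move=> _ simp n.
have [p [DE aff]] : exists p : forall i, 'I_(n_ i) -> 'rV[int]_(2 * n_ i + 3),
    (forall i, Delta i = range (p i)) /\ forall i, affinely_independent (fun a => intvec R (p i a)).
  by exists (fun i => sval (cid (simp i))); split=> i; case: (svalP (cid (simp i))).
have -> : Delta = (fun i => range (p i)) by apply: functional_extensionality_dep.
have /choice[qf Hqf] j : exists q, (0 < q)%N /\ forall S : set 'rV[int]_n, j.+1%:R^-1 <= upper_Banach_density R S ->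
    exists L : nat, forall k (lam : R), (L <= k)%N -> 0 < lam -> lam ^+ 2 = (q ^ 2 * k)%:R ->
      contains_product_copy S lam (fun i => range (p i)).
  have j0 : 0 < j.+1%:R^-1 :> R by rewrite invr_gt0 ltr0n.
  by have [q q0 H] := large_copies aff j0; exists q.
(* The dilation factor for density delta is divisible by the one belonging to the least j with
   1/(j+1) at most the density of S; the threshold can then be chosen from S alone. *)
have /choice[l0 Hl0] (S : set 'rV[int]_n) : exists L : int, forall j, j.+1%:R^-1 <= upper_Banach_density R S ->
    (forall j', (j' < j)%N -> ~ (j'.+1%:R^-1 <= upper_Banach_density R S)) ->
    forall k (lam : R), L <= k%:Z -> 0 < lam -> lam ^+ 2 = (qf j ^ 2 * k)%:R ->
      contains_product_copy S lam (fun i => range (p i)).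
  have [/ex_min[j Pj jmin]|none] := pselect (exists j, is_true (j.+1%:R^-1 <= upper_Banach_density R S)); last first.
    by exists 0 => j Pj; case: none; exists j.
  have [L HL] := (Hqf j).2 S Pj; exists L%:Z => j' Pj' j'min.
  have -> : j' = j.
    by case: (ltngtP j' j) => // H; [case: (jmin _ H) | case: (j'min _ H)].
  by move=> k lam; rewrite lez_nat => ?; apply: HL.
exists l0 => delta d0 d1; split; last by apply: small_copies.
pose kd := Num.bound delta^-1.
have kdP : kd.+1%:R^-1 <= delta.
  rewrite -[leRHS]invrK lef_pV2 ?posrE ?ltr0n ?invr_gt0 //.
  apply: ltW; apply: (@lt_le_trans _ _ kd%:R); last by rewrite ler_nat.
  by apply: archi_boundP; rewrite invr_ge0 ltW.
pose q0 := (\prod_(j < kd.+1) qf j)%N.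
have q00 : (0 < q0)%N by apply: prodn_gt0 => j; case: (Hqf j).
exists q0%:Z; split=> [|S dS lam [lam0 [kz lamk]] Ll]; first by rewrite ltz_nat.
have [j Pj jmin] := ex_min (ex_intro (fun j => is_true (j.+1%:R^-1 <= upper_Banach_density R S)) kd (le_trans kdP dS)).
have jkd : (j <= kd)%N.
  by rewrite leqNgt; apply/negP => H; apply: (jmin _ H); apply: le_trans kdP dS.
have [t t0 q0E] : exists2 t, (0 < t)%N & q0 = (qf j * t)%N.
  exists (\prod_(i < kd.+1 | i != Ordinal (jkd : (j < kd.+1)%N)) qf i)%N.
    by apply: prodn_gt0 => i; case: (Hqf i).
  by rewrite /q0 (bigD1 (Ordinal (jkd : (j < kd.+1)%N))).
have kz0 : 0 < kz by rewrite -(ltr0z R) -lamk exprn_gt0.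
case: kz kz0 lamk => // k k0; rewrite -pmulrn => lamk.
have lam1 : 1 <= lam by rewrite -(@ler_sqr _ 1) ?nnegrE ?(ltW lam0) // expr1n lamk ler1n.
(* (q0 lam)^2 = (qf j)^2 (t^2 k) with k = lam^2, and t^2 k is at least lam^2, hence at least lam and
   the threshold. *)
apply: (Hl0 S j Pj jmin (t ^ 2 * k)%N).
- apply: (@le_trans _ _ k%:Z); last by rewrite lez_nat leq_pmull // expn_gt0 t0.
  rewrite -(ler_int R); apply: le_trans Ll _; rewrite -pmulrn -lamk expr2.
  by rewrite ler_peMr // ltW.
- by rewrite mulr_gt0 // ltr0z ltz_nat.
by rewrite exprMn lamk -pmulrn -natrX -natrM q0E expnMn mulnA.
Qed.
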